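(* Let $N\ge 1$, $\alpha_1,\dots,\alpha_N\in\{0,1\}$, $R(z)=\exp(r(z))\in \mathrm{Id}+z\,\mathrm{End}(\mathbb C^N)[[z]]$, $T(z)=\sum_{j\ge1}\sum_a\Delta T^a_j z^j\tilde e_a\in z\mathbb C^N[[z]]$ with $\Delta T_1^a=0$ whenever $\alpha_a=1$, and $\Delta=(\Delta_1,\dots,\Delta_N)\in\mathbb C^N$ (with fixed square roots $\sqrt{\Delta_a}$). Let $$Z=\widehat R\,\widehat T\,\widehat\Delta\cdot\prod_{a=1}^N\tau_{\alpha_a}(\hbar,\mathbf T^a)$$ be the associated generalized ancestor potential, and let $\widehat W=\widehat R\,\widehat V\,\widehat W_\Delta\,\widehat V^{-1}\widehat R^{-1}$ be the associated cut-and-join operator (all defined in the context). The operator $\widehat W$ is of the cubic form $$\widehat W=\sum_{a,b,c=1}^N\ \sum_{\substack{i\le j\le k\\ i+j+k\ge0}}A^{i,j,k}_{a,b,c}\,\widehat J^a_i\widehat J^b_j\widehat J^c_k+\sum_{a=1}^N\sum_{j=-1}^\infty B^j_a\widehat J^a_j$$ with coefficients $A^{i,j,k}_{a,b,c},B^j_a\in\mathbb C$ independent of $\mathbf T$ and $\hbar$, and $$Z=\exp\left(\hbar\widehat W\right)\cdot 1 .$$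
   Context: Notation. $(2k-1)!!=1\cdot3\cdots(2k-1)$, $(-1)!!=1$. $\mathbb C^N$ has orthonormal basis $\tilde e_1,\dots,\tilde e_N$. Formal variables $\mathbf T=\{T^a_k\}_{1\le a\le N,\,k\ge0}$, $\mathbf T^a=\{T^a_k\}_{k\ge0}$; $T_k^a$ and $\partial/\partial T_k^a$ are $0$ for $k<0$. Operators are (formal completions of) differential operators acting on $\mathbb C[\mathbf T][[\hbar]]$; $\exp(\hbar\widehat W)\cdot1=\sum_n\frac{\hbar^n}{n!}\widehat W^n\cdot1$. Put $\widehat J^a_k=(2k-1)!!\,\partial/\partial T^a_{k-1}$ for $k>0$ and $\widehat J^a_k=T^a_{|k|}/(2|k|-1)!!$ for $k\le0$. Virasoro operators in one family $\{T_k\}_{k\ge 0}$: $$\widehat L_m=\tfrac12\sum_{i+j=-m-1}\frac{T_iT_j}{(2i-1)!!(2j-1)!!}+\sum_{k\ge0}\frac{(2k+2m+1)!!}{(2k-1)!!}T_k\frac{\partial}{\partial T_{k+m}}+\tfrac12\sum_{i+j=m-1}(2i+1)!!(2j+1)!!\frac{\partial^2}{\partial T_i\partial T_j};$$ $\widehat L_m(\mathbf T^a)$ is this operator in the variables $\mathbf T^a$. Tau-functions. $\tau_1$ is the Kontsevich--Witten tau-function $\tau_1(\hbar,\mathbf T)=\exp\big(\sum_{2g-2+n>0}\frac{\hbar^{2g-2+n}}{n!}\sum_{k_1,\dots,k_n\ge0}\int_{\overline{\mathcal M}_{g,n}}\psi_1^{k_1}\cdots\psi_n^{k_n}\,T_{k_1}\cdots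 T_{k_n}\big)$; $\tau_0$ is the Brézin--Gross--Witten tau-function, given by the same formula with Norbury's class $\Theta_{g,n}\in H^{4g-4+2n}(\overline{\mathcal M}_{g,n})$ inserted in the integral. Equivalently (known), $\tau_\alpha$ is the unique element of $\mathbb C[\mathbf T][[\hbar]]$ with $\tau_\alpha|_{\mathbf T=0}=1$ and $\big(\tfrac12\widehat L_k-\frac{(2k+2\alpha+1)!!}{2\hbar}\frac{\partial}{\partial T_{k+\alpha}}+\frac{\delta_{k,0}}{16}\big)\tau_\alpha=0$ for all $k\ge-\alpha$. Operators. Write $r(z)=\sum_{k\ge1}r_kz^k$, $r_k\tilde e_a=\sum_b(r_k)^b_a\tilde e_b$, $(r_k)^{ab}=(r_k)_a^b$. Then $$\widehat R=\exp\Big(\sum_{k\ge1}\sum_{a,b}\Big(\sum_{j\ge0}(r_k)^b_aT^a_j\frac{\partial}{\partial T^b_{k+j}}+\tfrac12\sum_{j=0}^{k-1}(-1)^{j+1}(r_k)^{ab}\frac{\partial^2}{\partial T^a_j\partial T^b_{k-j-1}}\Big)\Big),$$ $$\widehat T=\exp\Big(\frac1\hbar\sum_{k\ge1}\sum_a\Delta T^a_k\frac{\partial}{\partial T^a_k}\Big),\qquad \widehat\Delta\cdot\prod_a\tau_{\alpha_a}(\hbar,\mathbf T^a)=\prod_a\tau_{\alpha_a}(\hbar\sqrt{\Delta_a},\mathbf T^a).$$ No symplectic condition on $R$ is assumed. Virasoro group element. For each $a$ let $v^a(z)=\sqrt{\Delta_a}\sum_{k\ge1+\alpha_a}\frac{\Delta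 T^a_k}{(2k+1)!!}z^{2k+1}$ and $f^a(z)=z\big(1-(2\alpha_a+1)v^a(z)/z^{2\alpha_a+1}\big)^{1/(2\alpha_a+1)}\in z+z^3\mathbb C[[z^2]]$. Let $\chi^a_k$ ($k\ge1$) be the unique constants with $f^a(z)=\exp\big(-\sum_{k\ge1}\chi_k^az^{2k+1}\frac{\partial}{\partial z}\big)\cdot z$. Then $\widehat V=\prod_{a=1}^N\exp\big(\sum_{k\ge1}\chi^a_k\widehat L_k(\mathbf T^a)\big)$. Initial cut-and-join operator: $$\widehat W_\Delta=\sum_{a=1}^N\frac{\sqrt{\Delta_a}}{2\alpha_a+1}\sum_{k\ge0}\frac{T^a_k}{(2k-1)!!}\Big(\widehat L_{k-\alpha_a}(\mathbf T^a)+\frac{\delta_{k,\alpha_a}}8\Big).$$ *)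

(* Defs.v *)
From HB Require Import structures.
From mathcomp Require Import all_boot all_order all_algebra.
From mathcomp Require Import finmap multinomials.monalg.
From mathcomp Require Import classical_sets functions fsbigop.

Set Implicit Arguments.
Unset Strict Implicit.
Unset Printing Implicit Defensive.

Import Order.TTheory GRing.Theory Num.Theory.

Local Open Scope classical_set_scope.
Local Open Scope ring_scope.

(* Infinite sums are written \sum_(i \in A) _, the sum of the nonzero terms   *)
(* (0 if there are infinitely many). Each infinite sum of operators below has *)
(* finitely many nonzero terms on any given polynomial: with deg T_k = 2k+1,  *)
(* the exponents of R_hat and V_hat strictly lower the degree. The sum        *)
(* defining T_hat is finite on the products of tau-functions it is applied to *)
(* when Delta T_1^a = 0 for alpha_a = 1: the coefficient of hbar^n in         *)
(* tau_alpha is homogeneous of degree (2 alpha + 1) n.                        *)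

(* F[T_v : v \in V], with V a possibly infinite set of variables. *)
Notation pol F V := {malg F[{cmonom V}]}.

Definition var (F : fieldType) (V : choiceType) (v : V) : pol F V := << ucm v >>.

Definition pderiv (F : fieldType) (V : choiceType) (v : V) (p : pol F V) :
    pol F V :=
  \sum_(m <- msupp p) << p@_m *+ m v *g divcm m (ucm v) >>.

Definition rename (F : fieldType) (V W : choiceType) (x : V -> W)
    (p : pol F V) : pol F W :=
  mmap (fun c => c%:MP)
    (fun m : {cmonom V} => \prod_(v <- finsupp m) var F (x v) ^+ m v) p.

(* oddfact n = (2n-1)!!, so (2n+1)!! is oddfact n.+1. *)
Definition oddfact (n : nat) : nat := (\prod_(i < n) (2 * i + 1))%N.

(* A family {T_k} of variables is given by its embedding x : nat -> V, with   *)
(* T_k = var F (x k).                                                         *)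
Definition pderivz (F : fieldType) (V : choiceType) (x : nat -> V) (k : int)
    (p : pol F V) : pol F V :=
  if k is Posz n then pderiv (x n) p else 0.

(* In the middle sum only k + m >= 0 contributes, by the convention built     *)
(* into pderivz, so the absolute value is harmless.                           *)
Definition virasoro (F : fieldType) (V : choiceType) (x : nat -> V) (m : int)
    (p : pol F V) : pol F V :=
  2^-1 *: (\sum_(ij \in [set ij : nat * nat | ij.1%:Z + ij.2%:Z = - m - 1])
    (oddfact ij.1 * oddfact ij.2)%:R^-1 *: (var F (x ij.1) * var F (x ij.2) * p))
  + \sum_(k \in [set: nat])
      ((oddfact `|k%:Z + m + 1|)%:R / (oddfact k)%:R) *:
        (var F (x k) * pderivz x (k%:Z + m) p)
  + 2^-1 *: (\sum_(ij \in [set ij : nat * nat | ij.1%:Z + ij.2%:Z = m - 1])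
    (oddfact ij.1.+1 * oddfact ij.2.+1)%:R *:
       pderiv (x ij.1) (pderiv (x ij.2) p)).

Definition current (F : fieldType) (V : choiceType) (x : nat -> V) (k : int)
    (p : pol F V) : pol F V :=
  if 0 < k then (oddfact `|k|)%:R *: pderivz x (k - 1) p
  else (oddfact `|k|)%:R^-1 *: (var F (x `|k|%N) * p).

Definition expop (F : fieldType) (V : choiceType) (D : pol F V -> pol F V)
    (p : pol F V) : pol F V :=
  \sum_(n \in [set: nat]) n`!%:R^-1 *: iter n D p.

Definition opinv (F : fieldType) (V : choiceType) (D : pol F V -> pol F V) :
    pol F V -> pol F V :=
  'pinv_(fun=> 0) [set: pol F V] D.

(* A[[t]] is represented by coefficient functions nat -> A; Laurent series    *)
(* by coefficient functions int -> A.                                         *)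
Definition ps_one (A : comNzRingType) : nat -> A := fun n => (n == 0%N)%:R.

Definition ps_X (A : comNzRingType) : nat -> A := fun n => (n == 1%N)%:R.

Definition ps_mul (A : comNzRingType) (f g : nat -> A) : nat -> A :=
  fun n => \sum_(i < n.+1) f i * g (n - i)%N.

Definition ps_exp (A : comNzRingType) (f : nat -> A) (n : nat) : nat -> A :=
  iter n (ps_mul f) (ps_one A).

Definition ps_deriv (A : comNzRingType) (f : nat -> A) : nat -> A :=
  fun n => f n.+1 *+ n.+1.

Definition laurent (A : comNzRingType) (f : nat -> A) : int -> A :=
  fun e => if e is Posz n then f n else 0.

Definition gbinom (F : fieldType) (c : F) (n : nat) : F :=
  (\prod_(i < n) (c - i%:R)) / n`!%:R.

(* (1 + u)^c, by the binomial series, for u with zero constant term. *)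
Definition ps_pow1D (F : fieldType) (u : nat -> F) (c : F) : nat -> F :=
  fun d => \sum_(n < d.+1) gbinom c n * ps_exp u n d.

(* Kontsevich-Witten (al = 1) and Brezin-Gross-Witten (al = 0) tau-functions, *)
(* characterized as the unique solutions of their Virasoro constraints; t n   *)
(* is the coefficient of hbar^n, and the second condition is the coefficient  *)
(* of hbar^e of the k-th constraint.                                          *)
Definition is_tau (F : fieldType) (al : nat) (t : nat -> pol F nat) : Prop :=
  (forall n, (t n)@_(mone) = (n == 0%N)%:R) /\
  (forall k : int, - al%:Z <= k -> forall e : int,
     2^-1 *: virasoro id k (laurent t e)
     - ((oddfact `|k + al%:Z + 1|)%:R / 2) *:
         pderivz id (k + al%:Z) (laurent t (e + 1))
     + ((k == 0)%:R / 16) *: laurent t e = 0).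

(* The variable T^a_k is (a, k). *)
Definition Delta_hat (F : fieldType) (N : nat) (sqD : 'I_N -> F)
    (tau : 'I_N -> nat -> pol F nat) : nat -> pol F ('I_N * nat)%type :=
  \big[@ps_mul _/ps_one _]_(a < N)
    (fun n => sqD a ^+ n *: rename (pair a) (tau a n)).

(* dT k a = \Delta T^a_k *)
Definition T_gen (F : fieldType) (N : nat) (dT : nat -> 'I_N -> F)
    (p : pol F ('I_N * nat)%type) : pol F ('I_N * nat)%type :=
  \sum_(k \in [set k : nat | (1 <= k)%N])
    \sum_(a < N) dT k a *: pderiv (a, k) p.

(* exp(hbar^-1 * T_gen): the coefficient of hbar^e collects                   *)
(* T_gen^n / n! applied to the coefficient of hbar^(e + n).                   *)
Definition T_hat (F : fieldType) (N : nat) (dT : nat -> 'I_N -> F)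
    (G : int -> pol F ('I_N * nat)%type) : int -> pol F ('I_N * nat)%type :=
  fun e => \sum_(n \in [set: nat])
    n`!%:R^-1 *: iter n (T_gen dT) (G (e + n%:Z)).

(* Matrices act on columns: (r_k)^b_a = r k b a. *)
Definition R_gen (F : fieldType) (N : nat) (r : nat -> 'M[F]_N)
    (p : pol F ('I_N * nat)%type) : pol F ('I_N * nat)%type :=
  \sum_(k \in [set k : nat | (1 <= k)%N]) \sum_(a < N) \sum_(b < N)
    (\sum_(j \in [set: nat])
       r k b a *: (var F (a, j) * pderiv (b, (k + j)%N) p)
     + 2^-1 *: \sum_(j < k)
         ((-1) ^+ j.+1 * r k b a) *:
           pderiv (a, (j : nat)) (pderiv (b, (k - j - 1)%N) p)).

Definition R_hat (F : fieldType) (N : nat) (r : nat -> 'M[F]_N) :=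
  expop (R_gen r).

Definition v_ser (F : fieldType) (al : nat) (s : F) (t : nat -> F) : nat -> F :=
  fun d => if odd d && (1 + al <= d./2)%N
           then s * t d./2 / (oddfact d./2.+1)%:R else 0.

Definition f_ser (F : fieldType) (al : nat) (s : F) (t : nat -> F) : nat -> F :=
  ps_mul (ps_X F)
    (ps_pow1D
       (fun d => - ((2 * al + 1)%:R * v_ser al s t (d + (2 * al + 1))%N))
       (2 * al + 1)%:R^-1).

(* The vector field - sum_(k >= 1) chi_k z^(2k+1) d/dz. *)
Definition chi_field (F : fieldType) (chi : nat -> F) (g : nat -> F) :
    nat -> F :=
  fun d => - ps_mul (fun e => if odd e && (1 <= e./2)%N then chi e./2 else 0)
                    (ps_deriv g) d.

Definition chi_flow (F : fieldType) (chi : nat -> F) : nat -> F :=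
  fun d => \sum_(n \in [set: nat]) n`!%:R^-1 * iter n (chi_field chi) (ps_X F) d.

Definition V_gen (F : fieldType) (N : nat) (a : 'I_N) (chi : nat -> F)
    (p : pol F ('I_N * nat)%type) : pol F ('I_N * nat)%type :=
  \sum_(k \in [set k : nat | (1 <= k)%N]) chi k *: virasoro (pair a) k%:Z p.

Definition V_hat (F : fieldType) (N : nat) (chi : 'I_N -> nat -> F) :
    pol F ('I_N * nat)%type -> pol F ('I_N * nat)%type :=
  \big[(fun D E => D \o E)/id]_(a < N) expop (V_gen a (chi a)).

Definition W_Delta (F : fieldType) (N : nat) (alpha : 'I_N -> nat)
    (sqD : 'I_N -> F) (p : pol F ('I_N * nat)%type) :
    pol F ('I_N * nat)%type :=
  \sum_(a < N) (sqD a / (2 * alpha a + 1)%:R) *: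
    \sum_(k \in [set: nat]) (oddfact k)%:R^-1 *:
      (var F (a, k) * (virasoro (pair a) (k%:Z - (alpha a)%:Z) p
                       + ((k == alpha a)%:R / 8) *: p)).

Definition W_hat (F : fieldType) (N : nat) (alpha : 'I_N -> nat)
    (sqD : 'I_N -> F) (r : nat -> 'M[F]_N) (chi : 'I_N -> nat -> F) :
    pol F ('I_N * nat)%type -> pol F ('I_N * nat)%type :=
  R_hat r \o V_hat chi \o W_Delta alpha sqD
    \o opinv (V_hat chi) \o opinv (R_hat r).

Definition ancestor (F : fieldType) (N : nat) (sqD : 'I_N -> F)
    (r : nat -> 'M[F]_N) (dT : nat -> 'I_N -> F)
    (tau : 'I_N -> nat -> pol F nat) : int -> pol F ('I_N * nat)%type :=
  fun e => R_hat r (T_hat dT (laurent (Delta_hat sqD tau)) e).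

(* exp(hbar W) . 1 *)
Definition exp_hbar (F : fieldType) (V : choiceType) (W : pol F V -> pol F V) :
    int -> pol F V :=
  laurent (fun n => n`!%:R^-1 *: iter n W 1).

Definition cubic_form (F : fieldType) (N : nat)
    (A : 'I_N -> 'I_N -> 'I_N -> int -> int -> int -> F)
    (B : 'I_N -> int -> F) (p : pol F ('I_N * nat)%type) :
    pol F ('I_N * nat)%type :=
  \sum_(a < N) \sum_(b < N) \sum_(c < N)
    \sum_(t \in [set t : int * int * int |
           [/\ t.1.1 <= t.1.2, t.1.2 <= t.2 & 0 <= t.1.1 + t.1.2 + t.2]])
      A a b c t.1.1 t.1.2 t.2 *:
        current (pair a) t.1.1 (current (pair b) t.1.2 (current (pair c) t.2 p))
  + \sum_(a < N) \sum_(j \in [set j : int | -1 <= j])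
      B a j *: current (pair a) j p.

(* Main.v *)
Require Import Defs.
From HB Require Import structures.
From mathcomp Require Import all_boot all_order all_algebra.
From mathcomp Require Import finmap multinomials.monalg.
From mathcomp Require Import boolp classical_sets functions fsbigop reals.
From mathcomp Require Import real_closed.complex.
From mathcomp Require Import zify ring.

(** A bound on the order alone would leave quadratic and constant terms in W; parity under T -> -T,
    which reverses the sign of every J, excludes them. The index ranges come from the degree: W
    raises it by at most 3 and J_i by 1 - 2i, whence i + j + k >= 0 for cubic terms and j >= -1 for
    linear ones. As W has infinitely many terms, its coefficients are not collected from explicit
    series: they are its iterated commutators with the J, which are scalars.

    The vector field enters because D_n = (2n+1)!! d/dT_n satisfies [L_k, D_n] = -(2n+1) D_(n+k):
    under D_n <-> z^(2n+1), the commutator with L_k is -z^(2k+1) d/dz. The constraints turn L_k into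
    D_(k+alpha), which up to a factor is the field applied to z^(2 alpha + 1). This is why f^(2
    alpha + 1), and not f, gives the translation.

    Delta_a = 0 is allowed. The constraints can then not be solved for L_k G, but G does not involve
    T^a, and the identities hold with 0 as the inverse of 0. *)

(* All operators are linear endomorphisms of the polynomial ring, graded by
   deg T_k = 2k + 1, and exponentials of operators lowering the degree act by locally
   finite sums.
   - Cubic form. Measure the order of an operator by the length of its vanishing
     iterated commutators with the currents J. The Virasoro operators and the exponent
     of R have order at most 2 and are even in J, so conjugation by the exponentials
     keeps W_Delta, of order 3 and odd, in that class; an odd operator of order at most
     3 is a normally ordered cubic polynomial in J, plus a linear one.
   - The coefficients G_n of the product of the tau-functions satisfy the Virasoro
     constraints of each family. Weighted by T_k, they add up to
     E G_(n+1) = 3 W_Delta G_n, where E is the Euler operator of the degree rescaled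
     such that G_n has degree 3n. Hence G_n = W_Delta^n 1 / n!.
   - T_hat G = V_hat G: by the constraints, X = sum_a sum_k chi_k L_k(T^a) acts on G as
     hbar^-1 times a first order operator Y_1, and [X, Y_j] = Y_(j+1), where X acts on the
     coefficients of Y_j as the vector field of the flow f. Integrating, exp X acts as
     the exponential of hbar^-1 sum_j Y_j / j!, which is the exponent of T_hat since
     f^(2 alpha + 1) = z^(2 alpha + 1) - (2 alpha + 1) v.
   - All the exponentials fix 1, hence Z_n = R V W_Delta^n 1 / n! = W^n 1 / n!. *)

Set Implicit Arguments.
Unset Strict Implicit.
Unset Printing Implicit Defensive.

Import Order.TTheory GRing.Theory Num.Theory.

Local Open Scope classical_set_scope.
Local Open Scope ring_scope.

(** * Linear endomorphisms *)

Section Endomorphisms.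
Context (F : fieldType) (U : lmodType F).

Definition is_lin (f : U -> U) := forall c p q, f (c *: p + q) = c *: f p + f q.

Record endo := Endo { endo_fun :> U -> U; endo_lin : is_lin endo_fun }.

Lemma endoP (A B : endo) : A =1 B -> A = B.
Proof.
case: A B => [f lf] [g lg] /= /funext fg; subst g.
by rewrite (Prop_irrelevance lf lg).
Qed.

HB.instance Definition _ := gen_eqMixin endo.
HB.instance Definition _ := gen_choiceMixin endo.

Lemma is_lin0 : is_lin (fun=> 0).
Proof. by move=> c p q; rewrite scaler0 addr0. Qed.
Lemma is_linN (A : endo) : is_lin (fun p => - A p).
Proof. by move=> c p q; rewrite endo_lin opprD scalerN. Qed.
Lemma is_linD (A B : endo) : is_lin (fun p => A p + B p).
Proof. by move=> c p q; rewrite !endo_lin scalerDr addrACA. Qed.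
Lemma is_lin1 : is_lin id. Proof. by []. Qed.
Lemma is_linM (A B : endo) : is_lin (fun p => A (B p)).
Proof. by move=> c p q; rewrite !endo_lin. Qed.
Lemma is_linZ (a : F) (A : endo) : is_lin (fun p => a *: A p).
Proof. by move=> c p q; rewrite !endo_lin scalerDr !scalerA mulrC. Qed.

(* Sealed: unification must not unfold the operations down to those of U. *)
Fact endo0_seal : {A : endo | forall p, A p = 0}.
Proof. by exists (Endo is_lin0). Qed.
Fact endoN_seal : {f : endo -> endo | forall A p, f A p = - A p}.
Proof. by exists (fun A => Endo (is_linN A)). Qed.
Fact endoD_seal : {f : endo -> endo -> endo | forall A B p, f A B p = A p + B p}.
Proof. by exists (fun A B => Endo (is_linD A B)). Qed.
Fact endo1_seal : {A : endo | forall p, A p = p}.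
Proof. by exists (Endo is_lin1). Qed.
Fact endoM_seal : {f : endo -> endo -> endo | forall A B p, f A B p = A (B p)}.
Proof. by exists (fun A B => Endo (is_linM A B)). Qed.
Fact endoZ_seal : {f : F -> endo -> endo | forall a A p, f a A p = a *: A p}.
Proof. by exists (fun a A => Endo (is_linZ a A)). Qed.

Definition endo0 := sval endo0_seal.
Definition endoN := sval endoN_seal.
Definition endoD := sval endoD_seal.
Definition endo1 := sval endo1_seal.
Definition endoM := sval endoM_seal.
Definition endoZ := sval endoZ_seal.

Let endo0_def p : endo0 p = 0 := svalP endo0_seal p.
Let endoN_def A p : endoN A p = - A p := svalP endoN_seal A p.
Let endoD_def A B p : endoD A B p = A p + B p := svalP endoD_seal A B p.
Let endo1_def p : endo1 p = p := svalP endo1_seal p.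
Let endoM_def A B p : endoM A B p = A (B p) := svalP endoM_seal A B p.
Let endoZ_def a A p : endoZ a A p = a *: A p := svalP endoZ_seal a A p.
Let def := (endo0_def, endoN_def, endoD_def, endo1_def, endoM_def, endoZ_def).

Lemma endo_addA : associative endoD.
Proof. by move=> A B C; apply: endoP => p; rewrite !def addrA. Qed.
Lemma endo_addC : commutative endoD.
Proof. by move=> A B; apply: endoP => p; rewrite !def addrC. Qed.
Lemma endo_add0 : left_id endo0 endoD.
Proof. by move=> A; apply: endoP => p; rewrite !def add0r. Qed.
Lemma endo_addN : left_inverse endo0 endoN endoD.
Proof. by move=> A; apply: endoP => p; rewrite !def addNr. Qed.

HB.instance Definition _ :=
  GRing.isZmodule.Build endo endo_addA endo_addC endo_add0 endo_addN.

Lemma endoB0 (A : endo) : A 0 = 0.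
Proof. by have := endo_lin A (-1) 0 0; rewrite scaler0 addr0 scaleN1r addNr. Qed.

Lemma endo_mulA : associative endoM.
Proof. by move=> A B C; apply: endoP => p; rewrite !def. Qed.
Lemma endo_mul1 : left_id endo1 endoM.
Proof. by move=> A; apply: endoP => p; rewrite !def. Qed.
Lemma endo_1mul : right_id endo1 endoM.
Proof. by move=> A; apply: endoP => p; rewrite !def. Qed.
Lemma endo_mulDl : left_distributive endoM +%R.
Proof. by move=> A B C; apply: endoP => p; rewrite !def. Qed.
Lemma endo_mulDr : right_distributive endoM +%R.
Proof.
move=> A B C; apply: endoP => p; rewrite !def.
by have := endo_lin A 1 (B p) (C p); rewrite !scale1r.
Qed.

HB.instance Definition _ :=
  GRing.Zmodule_isPzRing.Build endo endo_mulA endo_mul1 endo_1mul endo_mulDl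
    endo_mulDr.

Lemma endo_scaleA a b A : endoZ a (endoZ b A) = endoZ (a * b) A.
Proof. by apply: endoP => p; rewrite !def scalerA. Qed.
Lemma endo_scale1 : left_id 1 endoZ.
Proof. by move=> A; apply: endoP => p; rewrite !def scale1r. Qed.
Lemma endo_scaleDr : right_distributive endoZ +%R.
Proof. by move=> a A B; apply: endoP => p; rewrite !def scalerDr. Qed.
Lemma endo_scaleDl A : {morph endoZ^~ A : a b / a + b}.
Proof. by move=> a b; apply: endoP => p; rewrite !def scalerDl. Qed.

HB.instance Definition _ :=
  GRing.Zmodule_isLmodule.Build F endo endo_scaleA endo_scale1 endo_scaleDr
    endo_scaleDl.

Lemma endo_scaleAl (a : F) (A B : endo) : a *: (A * B) = (a *: A) * B.
Proof.
apply: endoP => p; rewrite -[a *: (A * B)]/(endoZ a (endoM A B)).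
by rewrite -[a *: A * B]/(endoM (endoZ a A) B) !def.
Qed.

Lemma endo_scaleAr (a : F) (A B : endo) : a *: (A * B) = A * (a *: B).
Proof.
apply: endoP => p; rewrite -[a *: (A * B)]/(endoZ a (endoM A B)).
rewrite -[A * (a *: B)]/(endoM A (endoZ a B)) !def.
by have := endo_lin A a (B p) 0; rewrite endoB0 !addr0.
Qed.

Lemma endoE0 p : (0 : endo) p = 0.
Proof. exact: endo0_def. Qed.
Lemma endoE1 p : (1 : endo) p = p.
Proof. exact: endo1_def. Qed.
Lemma endoEN (A : endo) p : (- A) p = - A p.
Proof. exact: endoN_def. Qed.
Lemma endoED (A B : endo) p : (A + B) p = A p + B p.
Proof. exact: endoD_def. Qed.
Lemma endoEB (A B : endo) p : (A - B) p = A p - B p.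
Proof. by rewrite endoED endoEN. Qed.
Lemma endoEM (A B : endo) p : (A * B) p = A (B p).
Proof. exact: endoM_def. Qed.
Lemma endoEZ a (A : endo) p : (a *: A) p = a *: A p.
Proof. exact: endoZ_def. Qed.
Lemma endoEMn (A : endo) n p : (A *+ n) p = A p *+ n.
Proof. by elim: n => [|n IH]; rewrite ?mulr0n ?endoE0 // !mulrS endoED IH. Qed.
Lemma endoEX (A : endo) n p : (A ^+ n) p = iter n A p.
Proof. by elim: n => [|n IH]; rewrite ?expr0 ?endoE1 // exprS endoEM IH. Qed.
Lemma endoE_sum I (r : seq I) (P : pred I) (A : I -> endo) p :
  (\sum_(i <- r | P i) A i) p = \sum_(i <- r | P i) A i p.
Proof.
exact: (big_morph (fun A : endo => A p) (fun A B => endoED A B p) (endoE0 p)).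
Qed.

Lemma endo_additive (A : endo) : {morph A : p q / p + q}.
Proof. by move=> p q; have := endo_lin A 1 p q; rewrite !scale1r. Qed.
Lemma endo_scale (A : endo) a : {morph A : p / a *: p}.
Proof. by move=> p; have := endo_lin A a p 0; rewrite !addr0 endoB0 addr0. Qed.
Lemma endo_sum (A : endo) I (r : seq I) (P : pred I) (f : I -> U) :
  A (\sum_(i <- r | P i) f i) = \sum_(i <- r | P i) A (f i).
Proof. exact: (big_morph A (endo_additive A) (endoB0 A)). Qed.

Definition mkendo (f : U -> U) : endo :=
  if pselect (is_lin f) is left lf then Endo lf else 0.

Lemma mkendoE f : is_lin f -> mkendo f = f :> (U -> U).
Proof. by rewrite /mkendo; case: pselect. Qed.

End Endomorphisms.
Arguments endo {F} U.

(** * Polynomials *)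

(* A sealed copy of mcoeff: unification unfolds mcoeff without end on
   mismatched polynomials. *)
Fact coef_seal (F : fieldType) (V : choiceType) :
  {f : {cmonom V} -> pol F V -> F | forall k p, f k p = p@_k}.
Proof. by exists (fun k p => p@_k). Qed.
Definition coef (F : fieldType) (V : choiceType) := sval (coef_seal F V).

Section Coef.
Context (F : fieldType) (V : choiceType).
Implicit Types (p q : pol F V) (k m : {cmonom V}).

Lemma coefE k p : coef k p = p@_k.
Proof. exact: (svalP (coef_seal F V)). Qed.
Lemma coefP p q : (forall k, coef k p = coef k q) -> p = q.
Proof. by move=> pq; apply/malgP => k; have := pq k; rewrite !coefE. Qed.
Lemma coef_add k p q : coef k (p + q) = coef k p + coef k q.
Proof. by rewrite !coefE; exact: mcoeffD. Qed.
Lemma coef_scale k c p : coef k (c *: p) = c * coef k p.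
Proof. by rewrite !coefE; exact: mcoeffZ. Qed.
Lemma coef0p k : coef k (0 : pol F V) = 0.
Proof. by rewrite coefE; exact: mcoeff0. Qed.
Lemma coef_sump k I (r : seq I) (P : pred I) (f : I -> pol F V) :
  coef k (\sum_(i <- r | P i) f i) = \sum_(i <- r | P i) coef k (f i).
Proof. exact: (big_morph (coef k) (coef_add k) (coef0p k)). Qed.
Lemma coefU k c m : coef k (<< c *g m >> : pol F V) = c *+ (m == k).
Proof. by rewrite coefE; exact: mcoeffU. Qed.
Lemma coef_neq0 k p : (coef k p != 0) = (k \in msupp p).
Proof. by rewrite coefE; exact: mcoeff_neq0. Qed.
Lemma coef_outdom k p : k \notin msupp p -> coef k p = 0.
Proof. by rewrite coefE; exact: mcoeff_outdom. Qed.
Lemma coef_lin k c p q : coef k (c *: p + q) = c * coef k p + coef k q.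
Proof. by rewrite coef_add coef_scale. Qed.
Lemma coef_mone p q : coef mone (p * q) = coef mone p * coef mone q.
Proof. by rewrite !coefE; have [] := @mcoeff1g_is_multiplicative {cmonom V} F. Qed.
End Coef.

Lemma ucm_divcm (V : choiceType) (v : V) (m : {cmonom V}) :
  m v != 0%N -> mmul (ucm v) (divcm m (ucm v)) = m.
Proof.
move=> mv; apply/eqP/cmP => i; rewrite cmM divcmE cmU subnKC //.
by case: eqP => // <-; rewrite lt0n.
Qed.

Lemma divcm_ucm (V : choiceType) (v : V) (m : {cmonom V}) :
  divcm (mmul (ucm v) m) (ucm v) = m.
Proof. by apply/eqP/cmP => i; rewrite divcmE cmM addKn. Qed.

Lemma mon_ind (V : choiceType) (P : {cmonom V} -> Prop) :
  P mone -> (forall v m, P m -> P (mmul (ucm v) m)) -> forall m, P m.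
Proof.
move=> P1 PM m; move: {2}(mdeg m) (erefl (mdeg m)) => n.
elim: n m => [|n IH] m dm; first by rewrite (mdeg_eq0I dm).
have [v mv] : exists v, m v != 0%N.
  apply: contrapT => /forallNP m0; suff : m = mone by move=> m1; rewrite m1 mdeg1 in dm.
  by apply/eqP/cmP => i; rewrite cm1; have /negP := m0 i; rewrite negbK => /eqP.
have mE : m = mmul (ucm v) (divcm m (ucm v)).
  apply/eqP/cmP => i; rewrite cmM divcmE cmU subnKC //.
  by case: eqP => // <-; rewrite lt0n.
rewrite mE; apply/PM/IH; apply: succn_inj.
by rewrite -dm [in RHS]mE mdegM mdegU.
Qed.

(* U is kept abstract: on concrete polynomials unification computes with finite maps. *)
Section MonomialBasis.
Context (F : fieldType) (V : choiceType) (U : lmodType F) (mon : {cmonom V} -> U).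
Context (Der Var : V -> endo U) (Par : endo U).
Hypothesis mon_ext :
  forall A B : endo U, (forall m, A (mon m) = B (mon m)) -> A = B.
Hypothesis Var_mon : forall v m, Var v (mon m) = mon (mmul (ucm v) m).
Hypothesis Der_mon : forall v m,
  Der v (mon m) = (m v)%:R *: mon (divcm m (ucm v)).
Hypothesis Par_mon : forall m, Par (mon m) = (-1) ^+ mdeg m *: mon m.

Lemma mon_VarC u v : Var u * Var v = Var v * Var u.
Proof.
apply: mon_ext => m; rewrite !endoEM !Var_mon; congr mon.
by apply/eqP/cmP => i; rewrite !cmM addnCA.
Qed.

Lemma mon_Der_Var v u :
  Der v * Var u = (v == u)%:R *: (1 : endo U) + Var u * Der v.
Proof.
apply: mon_ext => m; rewrite endoED endoEZ endoE1 !endoEM Var_mon !Der_mon.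
rewrite endo_scale Var_mon cmM cmU; case: eqVneq => [->|nvu].
  rewrite add1n scale1r divcm_ucm mulrS scalerDl scale1r; congr (_ + _).
  case: (eqVneq (m v) 0%N) => [->|mv]; first by rewrite !scale0r.
  by rewrite ucm_divcm.
rewrite add0n scale0r add0r.
case: (eqVneq (m v) 0%N) => [->|mv]; first by rewrite !scale0r.
congr (_ *: mon _); apply/eqP/cmP => i; rewrite divcmE !cmM divcmE !cmU.
by move: mv; case: (eqVneq v i) => [<-|]; case: (eqVneq u i) => //; move: nvu; case: eqVneq => //; lia.
Qed.

Lemma mon_DerC u v : Der u * Der v = Der v * Der u.
Proof.
apply: mon_ext => m; rewrite !endoEM !Der_mon !endo_scale !Der_mon !scalerA.
rewrite !divcmE !cmU -!natrM; case: (eqVneq u v) => [->//|nuv].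
rewrite !subn0 mulnC.
congr (_ *: mon _); apply/eqP/cmP => i; rewrite !divcmE; lia.
Qed.

Lemma mon_Par_Var v : Par * Var v = - (Var v * Par).
Proof.
apply: mon_ext => m; rewrite endoEN !endoEM Var_mon !Par_mon endo_scale Var_mon.
by rewrite mdegM mdegU exprS mulN1r scaleNr.
Qed.

Lemma mon_Par_Der v : Par * Der v = - (Der v * Par).
Proof.
apply: mon_ext => m; rewrite endoEN !endoEM Par_mon !Der_mon !endo_scale Par_mon.
rewrite Der_mon !scalerA -scaleNr.
case: (eqVneq (m v) 0%N) => [->|mv]; first by rewrite mul0r mulr0 oppr0 !scale0r.
rewrite -[in (-1) ^+ mdeg m](ucm_divcm mv) mdegM mdegU exprS mulN1r mulNr opprK.
by rewrite mulrC.
Qed.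

End MonomialBasis.

Section Generated.
Context (F : fieldType) (V : choiceType) (U : lmodType F) (one : U).
Context (Der Var : V -> endo U).
Hypothesis gen_ind : forall P : U -> Prop,
  (forall c p q, P p -> P q -> P (c *: p + q)) -> P one ->
  (forall v p, P p -> P (Var v p)) -> forall p, P p.
Hypothesis Der_one : forall v, Der v one = 0.
Hypothesis Der_Var : forall v u,
  Der v * Var u = (v == u)%:R *: (1 : endo U) + Var u * Der v.

Lemma gen_ext (A B : endo U) : A one = B one ->
  (forall v p, A p = B p -> A (Var v p) = B (Var v p)) -> A = B.
Proof.
move=> AB1 ABM; apply: endoP; apply: gen_ind => [c p q Ap Aq||v p]; last exact: ABM.
  by rewrite !endo_lin Ap Aq.
exact: AB1.
Qed.

(** The Leibniz rule, written as an identity of operators: induction on q alone then suffices, each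
    step being the relation [Der_Var]. *)
Lemma gen_Der_Mul (Mul : U -> endo U) v q :
    (forall c p q, Mul (c *: p + q) = c *: Mul p + Mul q) -> Mul one = 1 ->
    (forall u p, Mul (Var u p) = Var u * Mul p) ->
  Der v * Mul q = Mul (Der v q) + Mul q * Der v.
Proof.
move=> MulD Mul1 MulV.
elim/gen_ind: q => [c p q IHp IHq||u q IH].
- rewrite endo_lin !MulD mulrDr IHq mulrDl -endo_scaleAl -endo_scaleAr IHp.
  by rewrite scalerDr addrACA.
- rewrite Der_one Mul1 mulr1 mul1r; have := MulD (-1) one one.
  by rewrite scaleN1r addNr scaleN1r addNr => ->; rewrite add0r.
- rewrite MulV mulrA Der_Var mulrDl -mulrA IH -endo_scaleAl mul1r -endoEM Der_Var.
  by rewrite endoED endoEZ endoE1 endoEM MulD MulV -!mulrA mulrDr addrA.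
Qed.

Lemma gen_scalar (A : endo U) c : A one = c *: one ->
  (forall v, A * Var v = Var v * A) -> A = c *: (1 : endo U).
Proof.
move=> A1 AV; apply: gen_ext => [|v p IH]; first by rewrite A1 endoEZ endoE1.
by rewrite -endoEM AV endoEM IH !endoEZ !endoE1 endo_scale.
Qed.

End Generated.

(** * Filtrations by degree and operators shifting them *)

(** Exhaustive and zero in negative degrees, so that an operator of negative shift is locally
    nilpotent. It is abstract because two different weights on the same polynomials are used. *)
Record filtration (F : fieldType) (U : lmodType F) := Filtration {
  wle :> int -> U -> Prop;
  wle0 : forall d, wle d 0;
  wleL : forall d c p q, wle d p -> wle d q -> wle d (c *: p + q);
  wleS : forall d d' p, d <= d' -> wle d p -> wle d' p;
  wle_neg : forall d p, d < 0 -> wle d p -> p = 0;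
  wle_exists : forall p, exists d : nat, wle d p }.

Section Shift.
Context (F : fieldType) (U : lmodType F) (wle : filtration U).
Implicit Types (A B : endo U) (c d : int).

Lemma wleD d p q : wle d p -> wle d q -> wle d (p + q).
Proof. by move=> dp dq; rewrite -[p]scale1r; apply: wleL. Qed.
Lemma wleZ d (a : F) p : wle d p -> wle d (a *: p).
Proof. by move=> dp; rewrite -[a *: p]addr0; apply/wleL/wle0. Qed.
Lemma wleN d p : wle d p -> wle d (- p).
Proof. by rewrite -scaleN1r; apply: wleZ. Qed.
Lemma wle_sum d I (r : seq I) (P : pred I) f :
  (forall i, P i -> wle d (f i)) -> wle d (\sum_(i <- r | P i) f i).
Proof.
by move=> H; elim/big_rec: _ => [|i x Pi]; [exact: wle0|apply/wleD/H].
Qed.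

Definition shift c (A : endo U) := forall d p, wle d p -> wle (d + c) (A p).

Lemma shiftS c c' A : c <= c' -> shift c A -> shift c' A.
Proof. by move=> cc sA d p /sA; apply: wleS; lia. Qed.

Lemma shift0 c : shift c 0. Proof. by move=> d p _; rewrite endoE0; apply: wle0. Qed.
Lemma shift1 : shift 0 1. Proof. by move=> d p; rewrite addr0 endoE1. Qed.
Lemma shiftD c A B : shift c A -> shift c B -> shift c (A + B).
Proof. by move=> sA sB d p dp; rewrite endoED; apply: wleD; [exact: sA|exact: sB]. Qed.
Lemma shiftZ c a A : shift c A -> shift c (a *: A).
Proof. by move=> sA d p dp; rewrite endoEZ; apply/wleZ/sA. Qed.
Lemma shiftN c A : shift c A -> shift c (- A).
Proof. by move=> sA d p dp; rewrite endoEN; apply/wleN/sA. Qed.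
Lemma shiftB c A B : shift c A -> shift c B -> shift c (A - B).
Proof. by move=> sA sB; apply/shiftD/shiftN. Qed.
Lemma shiftM c c' A B : shift c A -> shift c' B -> shift (c + c') (A * B).
Proof. by move=> sA sB d p /sB/sA; rewrite endoEM; apply: wleS; lia. Qed.
Lemma shift_sum c I (r : seq I) (P : pred I) f :
  (forall i, P i -> shift c (f i)) -> shift c (\sum_(i <- r | P i) f i).
Proof.
by move=> H; elim/big_rec: _ => [|i x Pi]; [exact: shift0|apply/shiftD/H].
Qed.
Lemma shiftX c A n : shift c A -> shift (c *+ n) (A ^+ n).
Proof.
move=> sA; elim: n => [|n IH]; first by rewrite expr0; exact: shift1.
by rewrite exprS mulrS; apply: shiftM.
Qed.

Lemma shift_eq0 c A d p : shift c A -> wle d p -> d + c < 0 -> A p = 0.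
Proof. by move=> sA /sA dp dc; apply: wle_neg dc dp. Qed.

End Shift.

Section Polynomials.
Context (F : fieldType) (V : choiceType).
Local Notation U := (pol F V).
Implicit Types (p q : U) (v u : V) (m k : {cmonom V}).

Lemma coef_pderiv v p k : coef k (pderiv v p) = coef (mmul k (ucm v)) p *+ (k v).+1.
Proof.
rewrite /pderiv coef_sump.
have cond m : (m v != 0%N) && (divcm m (ucm v) == k) = (m == mmul k (ucm v)).
  apply/andP/eqP => [[mv /eqP <-]|->].
    apply/eqP/cmP => i; rewrite cmM divcmE cmU subnK //.
    by case: eqP => // <-; rewrite lt0n.
  split; first by rewrite cmM cmUU addn1.
  by apply/cmP => i; rewrite divcmE cmM addnK.
rewrite (eq_bigr (fun m => if m == mmul k (ucm v) then coef m p *+ m v else 0)).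
  rewrite -big_mkcond; have [kin|kout] := boolP (mmul k (ucm v) \in msupp p).
    rewrite (big_rem _ kin) eqxx /= big_seq_cond big1 ?addr0.
      by rewrite cmM cmUU addn1.
    by move=> m /andP[]; rewrite mem_rem_uniq ?fset_uniq // inE => /andP[/negPf ->].
  rewrite (coef_outdom kout) mul0rn big_seq_cond big1 // => m /andP[mp /eqP mk].
  by rewrite mk (negPf kout) in mp.
move=> m _; rewrite -cond coefU -coefE; case: (eqVneq (m v) 0%N) => [->|_] /=.
  by rewrite mulr0n mul0rn.
by case: eqP => _; rewrite ?mulr1n ?mulr0n.
Qed.

Lemma pderiv_lin v : is_lin (@pderiv F V v).
Proof.
move=> c p q; apply/coefP => k; rewrite coef_pderiv coef_lin mulrnDl -mulrnAr.
by rewrite -!coef_pderiv; symmetry; apply: coef_lin.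
Qed.

Fact Der_seal : {D : V -> endo U | forall v p, D v p = pderiv v p}.
Proof. by exists (fun v => Endo (pderiv_lin v)). Qed.
Definition Der := sval Der_seal.

Lemma DerE v p : pderiv v p = Der v p.
Proof. by symmetry; exact: (svalP Der_seal). Qed.

Lemma coef_Der v p k : coef k (Der v p) = coef (mmul k (ucm v)) p *+ (k v).+1.
Proof. by rewrite -DerE coef_pderiv. Qed.

Lemma mul_lin q : is_lin (fun p => q * p).
Proof. by move=> c p r; rewrite mulrDr scalerAr. Qed.

Fact Mul_seal : {M : U -> endo U | forall q p, M q p = q * p}.
Proof. by exists (fun q => Endo (mul_lin q)). Qed.
Definition Mul := sval Mul_seal.

Lemma MulE q p : Mul q p = q * p.
Proof. exact: (svalP Mul_seal). Qed.

Fact Var_seal : {X : V -> endo U | forall v, X v = Mul (var F v)}.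
Proof. by exists (fun v => Mul (var F v)). Qed.
Definition Var := sval Var_seal.

Lemma varU v c m : var F v * << c *g m >> = << c *g mmul (ucm v) m >>.
Proof. by rewrite /var malgM_def fgmulUU mul1r. Qed.

Lemma monalgZ c m : << c *g m >> = c *: << m >> :> U.
Proof.
apply/coefP => k; rewrite coefU; transitivity (c * coef k (<< m >> : U)).
  by rewrite coefU mulrnAr mulr1.
by symmetry; apply: coef_scale.
Qed.

Lemma Der_mon v m : Der v << m >> = (m v)%:R *: << divcm m (ucm v) >>.
Proof.
rewrite -monalgZ; apply/coefP => k; rewrite coef_Der !coefU.
case: (eqVneq m (mmul k (ucm v))) => [->|mk].
  have -> : divcm (mmul k (ucm v)) (ucm v) = k.
    by apply/eqP/cmP => i; rewrite divcmE cmM addnK.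
  by rewrite eqxx cmM cmUU addn1 !mulr1n.
rewrite mulr0n mul0rn; case: eqP => [mk'|_]; last by rewrite mulr0n.
case: (posnP (m v)) => [->|mv]; first by rewrite mulr0n mul0rn.
case/eqP: mk; rewrite -mk'; apply/eqP/cmP => i; rewrite cmM divcmE cmU subnK //.
by case: eqP => // <-.
Qed.

Lemma pol_mon_ind (P : U -> Prop) :
    (forall c p q, P p -> P q -> P (c *: p + q)) -> (forall m, P << m >>) ->
  forall p, P p.
Proof.
move=> PD PM p; have P0 : P 0.
  by rewrite -(addNr << mone >>) -scaleN1r; apply: PD.
rewrite (monalgE p); elim/big_rec: _ => // m q _ Pq.
by rewrite monalgZ; apply: PD.
Qed.

Lemma pol_ind (P : U -> Prop) :
    (forall c p q, P p -> P q -> P (c *: p + q)) -> P 1 ->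
    (forall v p, P p -> P (var F v * p)) ->
  forall p, P p.
Proof.
move=> PD P1 PM; apply: pol_mon_ind; first exact: PD.
by apply: mon_ind => [|v m Pm]; [exact: P1|rewrite -varU; apply: PM].
Qed.

Lemma endo_mon (A B : endo U) : (forall m, A << m >> = B << m >>) -> A = B.
Proof.
move=> AB; apply: endoP; apply: pol_mon_ind => [c p q Ap Aq|m]; last exact: AB.
by rewrite !endo_lin Ap Aq.
Qed.

Lemma VarE v p : Var v p = var F v * p.
Proof. by rewrite /Var (svalP Var_seal) MulE. Qed.

Lemma Var_mon v m : Var v << m >> = << mmul (ucm v) m >>.
Proof. by rewrite VarE; exact: varU. Qed.

Lemma Var_ind (P : U -> Prop) :
    (forall c p q, P p -> P q -> P (c *: p + q)) -> P 1 ->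
    (forall v p, P p -> P (Var v p)) ->
  forall p, P p.
Proof.
move=> PD P1 PM; apply: pol_ind; [exact: PD|exact: P1|move=> v p /(PM v)].
by rewrite VarE.
Qed.

Lemma Der1 v : Der v 1 = 0.
Proof. by rewrite [LHS]Der_mon cm1 scale0r. Qed.

Lemma Der_Var v u : Der v * Var u = (v == u)%:R *: (1 : endo U) + Var u * Der v.
Proof. exact: mon_Der_Var endo_mon Var_mon Der_mon v u. Qed.

Lemma VarC u v : Var u * Var v = Var v * Var u.
Proof. exact: mon_VarC endo_mon Var_mon u v. Qed.

Lemma DerC u v : Der u * Der v = Der v * Der u.
Proof. exact: mon_DerC endo_mon Der_mon u v. Qed.

Lemma Mul_lin c p q : Mul (c *: p + q) = c *: Mul p + Mul q.
Proof.
apply: endoP => r; rewrite endoED endoEZ !MulE.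
by rewrite [LHS]mulrDl; congr (_ + _); symmetry; apply: scalerAl.
Qed.

Lemma Mul_Var u p : Mul (Var u p) = Var u * Mul p.
Proof.
apply: endoP => r; rewrite endoEM MulE (VarE u p) (VarE u) MulE.
by symmetry; apply: mulrA.
Qed.

Lemma Mul1 : Mul 1 = 1.
Proof. by apply: endoP => r; rewrite endoE1 MulE; apply: mul1r. Qed.

Lemma Der_Mul v q : Der v * Mul q = Mul (Der v q) + Mul q * Der v.
Proof. exact: (gen_Der_Mul Var_ind Der1 Der_Var v q Mul_lin Mul1 Mul_Var). Qed.

Lemma DerM v p q : Der v (p * q) = Der v p * q + p * Der v q.
Proof.
have /(congr1 (fun A : endo U => A q)) := Der_Mul v p.
by rewrite endoED !endoEM !MulE.
Qed.

Lemma coef_mone_var v : coef mone (var F v) = 0.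
Proof. by rewrite coefU cm1_eq1. Qed.

(* An operator commuting with all variables is multiplication by its value at 1,
   and a polynomial killed by all derivations is constant. *)
Lemma endo_scalar (charF : forall n, n.+1%:R != 0 :> F) (A : endo U) :
    (forall v, A * Var v = Var v * A) -> (forall v, A * Der v = Der v * A) ->
  exists c, A = c *: (1 : endo U).
Proof.
move=> AV AD; exists (coef mone (A 1)); apply: (gen_scalar Var_ind) AV.
rewrite -[RHS](monalgZ _ mone).
apply/coefP; apply: mon_ind => [|v m _]; first by rewrite coefU eqxx mulr1n.
have /(congr1 (fun B : endo U => B 1)) := AD v; rewrite !endoEM Der1 endoB0.
move=> /(congr1 (coef m)); rewrite coef_Der coef0p => /esym/eqP.
rewrite -mulr_natr mulf_eq0 (negPf (charF _)) orbF mulmC => /eqP ->.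
rewrite coefU; case: eqP => [/esym/eqP|_]; last by rewrite mulr0n.
by rewrite cmM_eq1 cm1_eq1.
Qed.

Section Weight.
Variable w : V -> nat.

Definition wt m : nat := (\sum_(v <- finsupp m) w v * m v)%N.

Lemma wtEw m (d : {fset V}) : (finsupp m `<=` d)%fset ->
  wt m = (\sum_(v <- d) w v * m v)%N.
Proof.
move=> le; rewrite /wt; apply: big_fset_incl => // v vd.
by rewrite -cmE_eq0 => /eqP ->; rewrite muln0.
Qed.

Lemma wtM m k : wt (mmul m k) = (wt m + wt k)%N.
Proof.
rewrite (@wtEw m (finsupp m `|` finsupp k)%fset) ?fsubsetUl //.
rewrite (@wtEw k (finsupp m `|` finsupp k)%fset) ?fsubsetUr //.
rewrite (@wtEw (mmul m k) (finsupp m `|` finsupp k)%fset) ?mdomD //.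
by rewrite -big_split /=; apply: eq_bigr => v _; rewrite cmM mulnDr.
Qed.

Lemma wtU v : wt (ucm v) = w v.
Proof. by rewrite /wt mdomU big_seq_fset1 cmUU muln1. Qed.

Lemma wt1 : wt mone = 0%N.
Proof. by rewrite /wt mdom1 big_seq_fset0. Qed.

(** A predicate on integers rather than an upper bound: variables and derivations translate it in
    opposite directions without truncation at 0. *)
Definition wsub (Q : int -> Prop) p := forall m, m \in msupp p -> Q (wt m).

Lemma wsub0 Q : wsub Q 0.
Proof. by move=> m; rewrite msupp0 in_fset0. Qed.

Lemma wsubS (Q Q' : int -> Prop) p :
  (forall x, Q x -> Q' x) -> wsub Q p -> wsub Q' p.
Proof. by move=> QQ Qp m /Qp/QQ. Qed.

Lemma wsub_coef (Q : int -> Prop) p :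
  (forall m, coef m p <> 0 -> Q (wt m)) <-> wsub Q p.
Proof.
split=> H m; first by rewrite -coef_neq0 => /eqP/H.
by move/eqP; rewrite coef_neq0 => /H.
Qed.

Lemma wsubD Q p q : wsub Q p -> wsub Q q -> wsub Q (p + q).
Proof.
move=> Qp Qq m /(fsubsetP (msuppD_le p q)); rewrite in_fsetU => /orP[].
- exact: Qp.
- exact: Qq.
Qed.

Lemma wsubZ Q c p : wsub Q p -> wsub Q (c *: p).
Proof. by move=> Qp m /(fsubsetP (msuppZ_le c p))/Qp. Qed.

Lemma wsub_sum Q I (r : seq I) (P : pred I) f :
  (forall i, P i -> wsub Q (f i)) -> wsub Q (\sum_(i <- r | P i) f i).
Proof.
move=> H; elim/big_rec: _ => [|i x Pi Qx]; first exact: wsub0.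
by apply: wsubD Qx; apply: H.
Qed.

Lemma wsub_var (Q : int -> Prop) v p :
  wsub Q p -> wsub (fun x => Q (x - (w v)%:Z)) (var F v * p).
Proof.
move=> Qp; rewrite (monalgE p) mulr_sumr big_seq; apply: wsub_sum => m mp k.
rewrite varU => /(fsubsetP msuppU_le); rewrite in_fset1 => /eqP ->.
by rewrite wtM wtU PoszD addrC addKr; apply: Qp.
Qed.

Lemma wsub_Der (Q : int -> Prop) v p :
  wsub Q p -> wsub (fun x => Q (x + (w v)%:Z)) (Der v p).
Proof.
move=> Qp; apply/wsub_coef => m; rewrite coef_Der => /eqP.
rewrite -mulr_natr mulf_eq0 negb_or => /andP[+ _]; rewrite coef_neq0 => /Qp.
by rewrite wtM wtU PoszD.
Qed.

Lemma wsub1 (Q : int -> Prop) : Q 0 -> wsub Q 1.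
Proof.
by move=> Q0 m; rewrite msuppU1 in_fset1 => /eqP ->; rewrite wt1.
Qed.

Lemma wsub_Var (Q : int -> Prop) v p :
  wsub Q p -> wsub (fun x => Q (x - (w v)%:Z)) (Var v p).
Proof. by rewrite VarE; apply: wsub_var. Qed.

Let wled d := wsub (fun x => x <= d).

Lemma wled_neg d p : d < 0 -> wled d p -> p = 0.
Proof.
move=> d0 dp; apply/coefP => m; rewrite coef0p; apply/eqP/negP => /negP.
by rewrite coef_neq0 => /dp; apply/negP; rewrite -ltNge; lia.
Qed.

Lemma wled_exists p : exists d : nat, wled d p.
Proof.
exists (\max_(m <- msupp p) wt m)%N => m mp.
by rewrite lez_nat; apply: leq_bigmax_seq.
Qed.

Definition wfil : filtration U :=
  @Filtration F U wled (fun d => @wsub0 _)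
    (fun d c p q dp dq => wsubD (wsubZ (c := c) dp) dq)
    (fun d d' p dd => @wsubS _ _ p (fun x xd => le_trans xd dd))
    wled_neg wled_exists.

Lemma shift_Var v : shift wfil (w v) (Var v).
Proof. by move=> d p /(@wsub_Var _ v); apply: wsubS => x; lia. Qed.

Lemma shift_Der v : shift wfil (- (w v)%:Z) (Der v).
Proof. by move=> d p /(@wsub_Der _ v); apply: wsubS => x; lia. Qed.

End Weight.

Section Parity.

(** The substitution T_v -> -T_v. It anticommutes with every variable and every derivation, so it
    tells even operators from odd ones. *)
Definition par p : U := [malg m in msupp p => (-1) ^+ mdeg m * p@_m].

Lemma coef_par p m : coef m (par p) = (-1) ^+ mdeg m * coef m p.
Proof.
rewrite !coefE mcoeffE; case: ifP => // /negbT/mcoeff_outdom ->.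
by rewrite mulr0.
Qed.

Lemma par_lin : is_lin par.
Proof.
move=> c p q; apply/coefP => m; rewrite coef_par coef_lin mulrDr mulrCA -!coef_par.
by symmetry; apply: coef_lin.
Qed.

Fact Par_seal : {P : endo U | forall p, P p = par p}.
Proof. by exists (Endo par_lin). Qed.
Definition Par := sval Par_seal.

Lemma ParE p : Par p = par p.
Proof. exact: (svalP Par_seal). Qed.

Lemma Par_mon m : Par << m >> = (-1) ^+ mdeg m *: << m >>.
Proof.
transitivity (<< (-1) ^+ mdeg m *g m >> : U); last exact: monalgZ.
apply/coefP => k; rewrite ParE coef_par [RHS]coefU [X in _ * X]coefU.
by case: eqP => [->|]; rewrite ?mulr0n ?mulr0 ?mulr1n ?mulr1.
Qed.

Lemma Par1 : Par 1 = 1.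
Proof. by rewrite [LHS]Par_mon mdeg1 expr0 scale1r. Qed.

Lemma Par_Var v : Par * Var v = - (Var v * Par).
Proof. exact: mon_Par_Var endo_mon Var_mon Par_mon v. Qed.

Lemma Par_Der v : Par * Der v = - (Der v * Par).
Proof. exact: mon_Par_Der endo_mon Der_mon Par_mon v. Qed.

End Parity.

End Polynomials.

Section Rename.
Context (F : fieldType) (V W : choiceType) (x : V -> W).

Fact ren_seal : {f : pol F V -> pol F W | forall p, f p = rename x p}.
Proof. by exists (rename x). Qed.
Definition ren := sval ren_seal.

Lemma renE p : rename x p = ren p.
Proof. by symmetry; exact: (svalP ren_seal). Qed.

Lemma ren_lin c p q : ren (c *: p + q) = c *: ren p + ren q.
Proof.
rewrite -!renE /rename raddfD /=; congr (_ + _).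
rewrite (@mmapEw _ _ _ _ _ (msupp p)) ?msuppZ_le // scaler_sumr.
apply: eq_bigr => m _; rewrite mcoeffZ -[RHS]mul_malgC [RHS]mulrA.
by congr (_ * _); apply: mpolyCM.
Qed.

Let h (m : {cmonom V}) := \prod_(v <- finsupp m) var F (x v) ^+ m v.

Let ren_mon m : ren << m >> = h m.
Proof. by rewrite -renE /rename mmapU mul1r. Qed.

Lemma ren1 : ren 1 = 1.
Proof. by rewrite [LHS]ren_mon /h mdom1 big_seq_fset0. Qed.

Lemma ren_Var v p : ren (Var F v p) = Var F (x v) (ren p).
Proof.
elim/pol_mon_ind: p => [c p q Hp Hq|m].
  rewrite endo_lin [LHS]ren_lin [in RHS]ren_lin Hp Hq.
  by symmetry; apply: endo_lin.
have hE (k : {cmonom V}) (d : {fset V}) : (finsupp k `<=` d)%fset ->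
    h k = \prod_(v <- d) var F (x v) ^+ k v.
  move=> le; apply: big_fset_incl => // i _.
  by rewrite -cmE_eq0 => /eqP ->; rewrite expr0.
rewrite Var_mon [LHS]ren_mon [in RHS]ren_mon VarE.
rewrite (hE m (finsupp (mmul (ucm v) m))); last first.
  by rewrite mdomD fsubsetUr.
have -> : var F (x v) = h (ucm v) by rewrite /h mdomU big_seq_fset1 cmUU.
rewrite (hE (ucm v) (finsupp (mmul (ucm v) m))) ?mdomD ?fsubsetUl //.
by rewrite /h -big_split mdomD; apply: eq_bigr => i _; rewrite cmM exprD.
Qed.

Lemma ren0 : ren 0 = 0.
Proof. by have := ren_lin (-1) 0 0; rewrite scaler0 addr0 scaleN1r addNr. Qed.

Lemma ren_Der v p : injective x -> ren (Der F v p) = Der F (x v) (ren p).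
Proof.
move=> xI; elim/Var_ind: p => [c p q Hp Hq||u p IH].
- by rewrite !(endo_lin, ren_lin) Hp Hq.
- by rewrite ren1 !Der1 ren0.
- rewrite ren_Var -!endoEM !Der_Var !endoED !endoEZ !endoE1 !endoEM.
  by rewrite ren_lin ren_Var IH (inj_eq xI).
Qed.

Lemma Der_ren_out u p : (forall v, u <> x v) -> Der F u (ren p) = 0.
Proof.
move=> ux; elim/Var_ind: p => [c p q Hp Hq||v p IH].
- by rewrite ren_lin endo_lin Hp Hq scaler0 addr0.
- by rewrite ren1 Der1.
- rewrite ren_Var -endoEM Der_Var endoED endoEZ endoE1 endoEM IH endoB0.
  by case: eqP => [/ux//|]; rewrite scale0r addr0.
Qed.

Lemma coef_mone_ren p : coef mone (ren p) = coef mone p.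
Proof.
elim/Var_ind: p => [c p q Hp Hq||v p IH].
- by rewrite ren_lin !coef_lin Hp Hq.
- by rewrite ren1 !coefU !eqxx.
- by rewrite ren_Var !VarE !coef_mone !coef_mone_var !mul0r.
Qed.

End Rename.

(** * Locally finite sums and exponentials *)

Lemma fsum_window (I : choiceType) (U : zmodType) (A : set I) (f : I -> U) s :
    uniq s -> (forall i, A i -> i \notin s -> f i = 0) ->
  \sum_(i \in A) f i = \sum_(i <- s | i \in A) f i.
Proof.
move=> us fs; rewrite [RHS]bigfs ?set_mem_set // => i iA; apply: fs.
by rewrite inE in iA.
Qed.

(** When all terms outside the triangle vanish, the product of two sums truncated at K equals its
    truncated Cauchy product. Every product of exponentials, binomial series and flows below is
    computed in this way. *)
Lemma triangle_sum (U : zmodType) (K : nat) (g : nat -> nat -> U) :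
    (forall i j, (K <= i + j)%N -> g i j = 0) ->
  \sum_(i < K) \sum_(j < K) g i j = \sum_(n < K) \sum_(i < n.+1) g i (n - i)%N.
Proof.
move=> g0; have E (n : 'I_K) :
    \sum_(i < n.+1) g i (n - i)%N = \sum_(i < K | (i <= n)%N) g i (n - i)%N.
  rewrite -(big_mkord xpredT (fun i => g i (n - i)%N)).
  rewrite -(big_mkord (fun i => (i <= n)%N) (fun i => g i (n - i)%N)).
  rewrite [RHS]big_mkcond /=.
  rewrite (@big_cat_nat _ _ _ n.+1 0 K) //=.
  rewrite [X in _ + X]big1_seq ?addr0; last first.
    by move=> i; rewrite mem_index_iota; case: (leqP i n) => //; lia.
  by rewrite !big_nat; apply: eq_bigr => i /andP[_]; rewrite ltnS => ->.
rewrite [RHS](eq_bigr _ (fun n _ => E n)) [RHS](exchange_big_dep xpredT) //=.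
apply: eq_bigr => i _; rewrite -(big_mkord xpredT (g i)).
rewrite -(big_mkord (fun n => (i <= n)%N) (fun n => g i (n - i)%N)).
have iK := ltn_ord i; rewrite (@big_cat_nat _ _ _ (K - i)) //=; last by lia.
rewrite [X in _ + X]big1_seq ?addr0; last first.
  by move=> j; rewrite mem_index_iota => /andP[_ H]; apply: g0; lia.
rewrite (@big_cat_nat _ _ _ i 0 K) //=; last by lia.
rewrite [X in _ = X + _]big1_seq ?add0r; last first.
  move=> j /andP[ij]; rewrite mem_index_iota; lia.
rewrite -{3}[nat_of_ord i]add0n big_addn big_nat_cond [RHS]big_nat_cond.
by apply: eq_big => [j|j _]; rewrite ?leq_addl ?addnK ?andbT.
Qed.

Section LocalSums.
Context (F : fieldType) (U : lmodType F) (I : choiceType).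
Implicit Types (A : set I) (f : I -> endo U).

Definition locfin A f :=
  forall p, exists2 s, uniq s & forall i, A i -> i \notin s -> f i p = 0.

(** Without local finiteness the sum need not be linear, and [mkendo] then returns 0. Thus [lsum] is
    total and takes no proof as an argument. *)
Fact lsum_seal : {f : set I -> (I -> endo U) -> endo U |
  forall A g p, locfin A g -> f A g p = \sum_(i \in A) g i p}.
Proof.
exists (fun A f => mkendo (fun p => \sum_(i \in A) f i p)) => A f p lf.
rewrite mkendoE // => c {}p q.
have [s1 _ H1] := lf p; have [s2 _ H2] := lf q; have [s3 _ H3] := lf (c *: p + q).
pose s := undup (s1 ++ s2 ++ s3).
rewrite !(@fsum_window _ _ _ _ s) ?undup_uniq //; first last.
- by move=> i Ai; rewrite mem_undup !mem_cat !negb_or => /and3P[? ? ?]; apply: H3.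
- by move=> i Ai; rewrite mem_undup !mem_cat !negb_or => /and3P[? ? ?]; apply: H1.
- by move=> i Ai; rewrite mem_undup !mem_cat !negb_or => /and3P[? ? ?]; apply: H2.
rewrite scaler_sumr -big_split; apply: eq_bigr => i _; exact: endo_lin.
Qed.
Definition lsum := sval lsum_seal.

Lemma lsum_fsum A f p : locfin A f -> lsum A f p = \sum_(i \in A) f i p.
Proof. exact: (svalP lsum_seal). Qed.

Lemma lsumE A f p s : locfin A f -> uniq s ->
    (forall i, A i -> i \notin s -> f i p = 0) ->
  lsum A f p = \sum_(i <- s | i \in A) f i p.
Proof. by move=> lf us fs; rewrite lsum_fsum // (fsum_window us). Qed.

Lemma shift_lsum (wle : filtration U) c A f :
    (forall i, A i -> shift wle c (f i)) -> locfin A f ->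
  shift wle c (lsum A f).
Proof.
move=> sf lf d p dp; have [s us fs] := lf p; rewrite (lsumE lf us fs).
by apply: wle_sum => i; rewrite inE => Ai; apply: sf.
Qed.

End LocalSums.

Section Lie.
Context (F : fieldType) (U : lmodType F).
Implicit Types (A B C W X : endo U).

Definition lie A B := A * B - B * A.

Lemma lieDl A B C : lie (A + B) C = lie A C + lie B C.
Proof. by rewrite /lie mulrDl mulrDr opprD addrACA. Qed.
Lemma lieZl a A B : lie (a *: A) B = a *: lie A B.
Proof. by rewrite /lie -endo_scaleAl -endo_scaleAr scalerBr. Qed.
Lemma lieNl A B : lie (- A) B = - lie A B.
Proof. by rewrite -!(scaleN1r _) lieZl. Qed.
Lemma lieC A B : lie A B = - lie B A. Proof. by rewrite /lie opprB. Qed.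
Lemma lieBl A B C : lie (A - B) C = lie A C - lie B C.
Proof. by rewrite lieDl lieNl. Qed.
Lemma lie0l A : lie 0 A = 0. Proof. by rewrite /lie mul0r mulr0 subr0. Qed.
Lemma lieZr a A B : lie A (a *: B) = a *: lie A B.
Proof. by rewrite lieC lieZl -scalerN -lieC. Qed.
Lemma lieMl A B X : lie (A * B) X = A * lie B X + lie A X * B.
Proof. by rewrite /lie mulrBr mulrBl !mulrA addrA subrK. Qed.
Lemma lie_scalar A c : lie A (c *: (1 : endo U)) = 0.
Proof. by rewrite lieZr /lie mulr1 mul1r subrr scaler0. Qed.
Lemma lieE A B p : lie A B p = A (B p) - B (A p).
Proof. by rewrite endoEB !endoEM. Qed.

Lemma jacobi A B X : lie (lie A B) X = lie (lie A X) B + lie A (lie B X).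
Proof.
rewrite -[lie A B]/(A * B - B * A) lieBl !lieMl.
rewrite -[lie (lie A X) B]/(lie A X * B - B * lie A X).
rewrite -[lie A (lie B X)]/(A * lie B X - lie B X * A).
by rewrite opprD (addrC (A * _)) addrACA.
Qed.

Lemma shift_lie (wle : filtration U) c c' A B :
  shift wle c A -> shift wle c' B -> shift wle (c + c') (lie A B).
Proof.
move=> sA sB; apply: shiftB; first exact: shiftM.
by rewrite addrC; apply: shiftM.
Qed.

(** [lie D] is the sum of left multiplication by D and right multiplication by -D. These commute, so
    the binomial formula applies in the ring of endomorphisms of [endo U]. *)
Lemma iter_lie D W n : iter n (lie D) W =
  \sum_(i < n.+1) (D ^+ (n - i)%N * W * (- D) ^+ i) *+ 'C(n, i).
Proof.
have LL : is_lin (fun X : endo U => D * X).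
  by move=> c p q; rewrite mulrDr endo_scaleAr.
have LR : is_lin (fun X : endo U => X * (- D)).
  by move=> c p q; rewrite mulrDl endo_scaleAl.
pose L : endo (endo U) := Endo LL; pose R : endo (endo U) := Endo LR.
have -> : iter n (lie D) W = ((L + R) ^+ n) W.
  rewrite endoEX; elim: n => //= n ->.
  by rewrite endoED /= /lie mulrN.
rewrite exprDn_comm; last first.
  by apply: endoP => X; rewrite !endoEM /= mulrA.
rewrite endoE_sum; apply: eq_bigr => i _; rewrite endoEMn endoEM !endoEX.
congr (_ *+ _); have -> : iter i R W = W * (- D) ^+ i.
  elim: (nat_of_ord i) => [|k IH]; first by rewrite expr0 mulr1.
  by rewrite iterS IH /= exprSr mulrA.
elim: (n - i)%N => [|k IH]; first by rewrite expr0 mul1r.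
by rewrite iterS IH /= exprS !mulrA.
Qed.

End Lie.

Section Exponential.
Context (F : fieldType) (U : lmodType F) (wle : filtration U).
Hypothesis charF : forall n, n.+1%:R != 0 :> F.
Implicit Types (A B D W : endo U).
Local Notation lowers := (shift wle (-1)).

Definition eexp D : endo U :=
  lsum [set: nat] (fun n => n`!%:R^-1 *: D ^+ n).

Lemma fact_neq0 n : n`!%:R != 0 :> F.
Proof. by rewrite -(prednK (fact_gt0 n)). Qed.

Lemma lowersX D n d p : lowers D -> wle d p -> d < n%:Z -> (D ^+ n) p = 0.
Proof.
by move=> lD dp dn; apply: (shift_eq0 (shiftX n lD) dp); rewrite mulNrn; lia.
Qed.

Lemma locfin_exp D : lowers D ->
  locfin [set: nat] (fun n => n`!%:R^-1 *: D ^+ n).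
Proof.
move=> lD p; have [d dp] := wle_exists wle p.
exists (iota 0 d.+1); first exact: iota_uniq.
move=> i _; rewrite mem_iota leq0n add0n -leqNgt endoEZ => di.
by rewrite (lowersX lD dp) ?scaler0.
Qed.

Lemma eexpE D K d p : lowers D -> wle d p -> d < K%:Z ->
  eexp D p = \sum_(n < K) n`!%:R^-1 *: (D ^+ n) p.
Proof.
move=> lD dp dK; rewrite /eexp (lsumE (s := index_iota 0 K) (locfin_exp lD)).
- rewrite big_mkord; apply: eq_big => [n|n _]; last by rewrite endoEZ.
  by rewrite in_setT.
- exact: iota_uniq.
- move=> n _; rewrite mem_index_iota leq0n /= -leqNgt endoEZ => Kn.
  by rewrite (lowersX lD dp) ?scaler0 //; lia.
Qed.

Lemma expopE D p : lowers D ->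
  \sum_(n \in [set: nat]) n`!%:R^-1 *: iter n D p = eexp D p.
Proof.
move=> lD; rewrite (lsum_fsum _ (locfin_exp lD)).
by apply: eq_fsbigr => n _; rewrite endoEZ endoEX.
Qed.

Lemma shift_exp D : lowers D -> shift wle 0 (eexp D).
Proof.
move=> lD; apply: shift_lsum; last exact: locfin_exp.
move=> n _; apply: shiftZ; apply: (shiftS _ (shiftX n lD)).
by rewrite mulNrn; lia.
Qed.

Lemma eexp_eq D p : lowers D -> D p = 0 -> eexp D p = p.
Proof.
move=> lD Dp; have [d dp] := wle_exists wle p.
rewrite (eexpE (K := d.+1) lD dp) ?big_ord_recl /=; last by lia.
rewrite big1; first by rewrite fact0 invr1 scale1r expr0 endoE1 addr0.
by move=> i _; rewrite exprSr endoEM Dp endoB0 scaler0.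
Qed.

Lemma lowersN D : lowers D -> lowers (- D).
Proof. exact: shiftN. Qed.

Lemma binom_fact n i : (i <= n)%N ->
  n`!%:R^-1 * 'C(n, i)%:R = (n - i)%N`!%:R^-1 * i`!%:R^-1 :> F.
Proof.
move=> le; rewrite -(bin_fact le) !natrM.
have C0 : ('C(n, i))%:R != 0 :> F.
  by rewrite -(prednK (_ : 0 < 'C(n, i))%N) ?bin_gt0.
have fi0 := fact_neq0 i; have fni0 := fact_neq0 (n - i)%N.
by field; rewrite C0 fi0 fni0.
Qed.

Lemma eexpD A B : lowers A -> lowers B -> A * B = B * A ->
  eexp (A + B) = eexp A * eexp B.
Proof.
move=> lA lB AB; apply: endoP => p; have [d dp] := wle_exists wle p.
have dK : d%:Z < d.+1%:Z by lia.
rewrite endoEM (eexpE (shiftD lA lB) dp dK).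
rewrite (@eexpE A d.+1 d%:Z); [|by []| |by []]; last first.
  by have := shift_exp lB dp; rewrite addr0.
rewrite (eexpE lB dp dK).
transitivity (\sum_(i < d.+1) \sum_(j < d.+1)
    (i`!%:R^-1 * j`!%:R^-1) *: (A ^+ i) ((B ^+ j) p)); last first.
  apply: eq_bigr => i _; rewrite endo_sum scaler_sumr; apply: eq_bigr => j _.
  by rewrite endo_scale scalerA.
rewrite (triangle_sum (g := fun i j => (i`!%:R^-1 * j`!%:R^-1) *: (A ^+ i) ((B ^+ j) p))).
  apply: eq_bigr => n _; rewrite exprDn_comm //.
  rewrite endoE_sum scaler_sumr (reindex_inj rev_ord_inj) /=.
  apply: eq_bigr => i _; rewrite endoEMn endoEM subSS -scaler_nat scalerA.
  by rewrite (binom_fact (leq_subr _ _)) subKn // -ltnS.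
move=> i j dij; rewrite -endoEM (shift_eq0 (shiftM (shiftX i lA) (shiftX j lB)) dp).
  by rewrite scaler0.
by rewrite !mulNrn; lia.
Qed.

Lemma eexp0 : eexp 0 = 1.
Proof.
have l0 : lowers 0 by exact: shift0.
by apply: endoP => p; rewrite eexp_eq ?endoE1 ?endoE0.
Qed.

Lemma eexpK D : lowers D -> eexp D * eexp (- D) = 1.
Proof.
move=> lD; rewrite -eexpD ?subrr ?eexp0 //; last by rewrite mulNr mulrN.
exact: lowersN.
Qed.

Lemma eexpNK D : lowers D -> eexp (- D) * eexp D = 1.
Proof. by move=> lD; rewrite -{2}[D]opprK eexpK //; apply: lowersN. Qed.

(** Conjugation by exp D is the exponential of ad D. On degree d the series stops at d + c, and the
    finite sum depends on p only through d, as [ord_local] requires. *)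
Lemma eexp_conj D W c (K d : nat) p : lowers D -> shift wle c%:Z W ->
    wle d p -> (d + c < K)%N ->
  (eexp D * W * eexp (- D)) p = (\sum_(n < K) n`!%:R^-1 *: iter n (lie D) W) p.
Proof.
move=> lD sW dp dK; rewrite !endoEM.
have lND := lowersN lD.
rewrite (eexpE (K := K) lND dp); last by lia.
transitivity (\sum_(i < K) \sum_(j < K)
    (i`!%:R^-1 * j`!%:R^-1) *: (D ^+ i) (W (((- D) ^+ j) p))).
  rewrite exchange_big /= endo_sum endo_sum; apply: eq_bigr => j _.
  rewrite !endo_scale (eexpE (K := K) (d := (d + c)%N%:Z) lD); last by lia.
    by rewrite scaler_sumr; apply: eq_bigr => i _; rewrite scalerA mulrC.
  have := sW _ _ (shiftX j lND dp); apply: wleS; rewrite mulNrn; lia.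
rewrite (triangle_sum (g := fun i j => (i`!%:R^-1 * j`!%:R^-1) *: (D ^+ i) (W (((- D) ^+ j) p)))).
  rewrite endoE_sum; apply: eq_bigr => n _; rewrite endoEZ iter_lie endoE_sum.
  rewrite scaler_sumr (reindex_inj rev_ord_inj) /=; apply: eq_bigr => i _.
  rewrite subSS endoEMn -scaler_nat scalerA binom_fact -1?ltnS //.
  by rewrite !endoEM subKn // -ltnS.
move=> i j dij; rewrite -!endoEM.
rewrite (shift_eq0 (shiftM (shiftM (shiftX i lD) sW) (shiftX j lND)) dp) ?scaler0 //.
by rewrite !mulNrn; lia.
Qed.

Lemma shift_conj D W c : lowers D -> shift wle c W ->
  shift wle c (eexp D * W * eexp (- D)).
Proof.
move=> lD sW; rewrite -[c]addr0 -{1}[c]add0r; apply: shiftM.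
  by apply: shiftM => //; apply: shift_exp.
exact/shift_exp/lowersN.
Qed.

End Exponential.

(** * Normally ordered cubic operators *)

(* J lists the generators of a Heisenberg algebra: J x is dual to J (star x),
   neg x marks creation operators, e x is the weight of J x. *)
Section Heisenberg.
Context (F : fieldType) (U : lmodType F) (wle : filtration U).
Hypothesis charF : forall n, n.+1%:R != 0 :> F.
Context (L : choiceType) (J : L -> endo U) (star : L -> L) (kap : L -> F).
Context (neg : pred L) (e : L -> int) (Par : endo U) (one : U).
Hypothesis lieJ : forall x y,
  lie (J x) (J y) = ((y == star x)%:R * kap x) *: (1 : endo U).
Hypothesis starK : involutive star.
Hypothesis kap_neq0 : forall x, kap x != 0.
Hypothesis shiftJ : forall x, shift wle (e x) (J x).
Hypothesis e_star : forall x, e (star x) = - e x.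
Hypothesis finJ : forall M : nat,
  exists2 s, uniq s & forall x, `|e x| <= M%:Z -> x \in s.
Hypothesis scalarJ : forall A, (forall x, lie A (J x) = 0) ->
  exists c, A = c *: (1 : endo U).
Hypothesis ParJ : forall x, Par * J x = - (J x * Par).
Hypothesis Par_one : Par one = one.
Hypothesis one_neq0 : one != 0.
Implicit Types (A B D W X Y : endo U) (x y z : L).

(* Bernstein filtration: ord n W says that W has order < n. *)
Fixpoint ord n W : Prop :=
  if n is n'.+1 then forall x, ord n' (lie W (J x)) else W = 0.

Lemma ord0 n : ord n 0.
Proof. by elim: n => //= n IH x; rewrite lie0l. Qed.

Lemma ordD n A B : ord n A -> ord n B -> ord n (A + B).
Proof.
elim: n A B => [A B /= -> ->|n IH A B oA oB x]; first by rewrite addr0.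
by rewrite lieDl; apply: IH.
Qed.

Lemma ordZ n c A : ord n A -> ord n (c *: A).
Proof.
elim: n A => [A /= ->|n IH A oA x]; first by rewrite scaler0.
by rewrite lieZl; apply: IH.
Qed.

Lemma ordS n A : ord n A -> ord n.+1 A.
Proof.
elim: n A => [A /= -> x|n IH A oA x]; first by rewrite lie0l.
exact: IH.
Qed.

Lemma ord_scalar A : ord 1 A -> exists c, A = c *: (1 : endo U).
Proof. exact: scalarJ. Qed.

Lemma scalar_ord c : ord 1 (c *: (1 : endo U)).
Proof. by move=> x /=; rewrite lieC lie_scalar oppr0. Qed.

Lemma ordJ x : ord 2 (J x).
Proof. by move=> y; rewrite lieJ; apply: scalar_ord. Qed.

(** With [ord n.+1] read as order at most n, orders add. The Leibniz rule lowers one of the two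
    orders at a time, hence the induction on a bound k of their sum. *)
Lemma ordM m n A B : ord m.+1 A -> ord n.+1 B -> ord (m + n).+1 (A * B).
Proof.
move: {2}(m + n)%N (leqnn (m + n)) => k.
elim: k m n A B => [|k IH] m n A B mn oA oB x.
  case: m n mn oA oB => [[_ oA oB|//]|//] /=.
  by rewrite lieMl (oA x) (oB x) mulr0 mul0r addr0.
rewrite lieMl; apply: ordD.
  case: n mn oB => [_ oB|n mn oB]; first by rewrite (oB x) mulr0; apply: ord0.
  by rewrite plusE addnS; apply: (IH m n) => //; lia.
case: m mn oA => [_ oA|m mn oA]; first by rewrite (oA x) mul0r; apply: ord0.
by rewrite plusE addSn; apply: (IH m n) => //; lia.
Qed.

Lemma ord1_lie A B : ord 1 A -> lie A B = 0.
Proof. by move=> /ord_scalar[c ->]; rewrite lieC lie_scalar oppr0. Qed.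

(** The order of a commutator is two less than that of the product, because commutators of two J are
    scalars. Hence the commutator with an operator of order at most 2 does not raise the order. *)
Lemma ord_lie m n A B : ord m.+2 A -> ord n.+2 B -> ord (m + n).+1 (lie A B).
Proof.
move: {2}(m + n)%N (leqnn (m + n)) => k.
elim: k m n A B => [|k IH] m n A B mn oA oB x; rewrite jacobi.
  case: m n mn oA oB => [[_ oA oB|//]|//] /=.
  by rewrite (ord1_lie _ (oA x)) lieC (ord1_lie _ (oB x)) oppr0 addr0.
apply: ordD.
  case: m mn oA => [_ oA|m mn oA]; first by rewrite (ord1_lie _ (oA x)); apply: ord0.
  by rewrite plusE addSn; apply: (IH m n) => //; lia.
case: n mn oB => [_ oB|n mn oB].
  by rewrite lieC (ord1_lie _ (oB x)) oppr0; apply: ord0.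
by rewrite plusE addnS; apply: (IH m n) => //; lia.
Qed.

Definition agree (d : int) A B := forall p, wle d p -> A p = B p.

(** Reduces infinite sums to finite truncations. The degree is enlarged by |e x| in the induction,
    since [J x] may raise it before W acts. *)
Lemma ord_local n W :
  (forall d : nat, exists2 W', ord n W' & agree d W W') -> ord n W.
Proof.
elim: n W => [W H|n IH W H x].
  apply: endoP => p; have [d dp] := wle_exists wle p.
  by have [W' /= -> ->] := H d.
apply: IH => d; have [W' oW' WW'] := H (d + `|e x|)%N.
exists (lie W' (J x)); first exact: oW'.
move=> p dp; rewrite !lieE.
have d1 : wle (d + `|e x|)%N p by apply: (wleS _ dp); lia.
have d2 : wle (d + `|e x|)%N (J x p) by apply: (wleS _ (shiftJ x dp)); lia.
by rewrite (WW' _ d1) (WW' _ d2).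
Qed.

Lemma ord_lsum (I : choiceType) (A : set I) (f : I -> endo U) n :
    (forall d : nat, exists2 s, uniq s & forall p i,
       wle d p -> A i -> i \notin s -> f i p = 0) ->
    (forall i, A i -> ord n (f i)) ->
  ord n (lsum A f).
Proof.
move=> lf fo; apply: ord_local => d; have [s us fs] := lf d.
exists (\sum_(i <- s | i \in A) f i).
  elim/big_rec: _ => [|i X iA oX]; first exact: ord0.
  by apply: ordD oX; apply: fo; rewrite inE in iA.
move=> p dp; rewrite endoE_sum; apply: lsumE => //.
  move=> q; have [d' dq] := wle_exists wle q; have [s' us' fs'] := lf d'.
  by exists s' => // i Ai /(fs' q)->.
by move=> i; apply: fs.
Qed.

Lemma ord_conj D W n c : shift wle (-1) D -> shift wle c W ->
  ord 3 D -> ord n.+2 W -> ord n.+2 (eexp D * W * eexp (- D)).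
Proof.
move=> lD sW oD oW.
have {}sW : shift wle `|c|%N%:Z W by apply: shiftS sW; lia.
apply: ord_local => d; exists (\sum_(k < (d + `|c|).+1) k`!%:R^-1 *: iter k (lie D) W).
  elim/big_rec: _ => [|k X _ oX]; first exact: ord0.
  apply: ordD oX; apply: ordZ; elim: (nat_of_ord k) => //= j IH.
  by have /= := ord_lie oD IH.
by move=> p dp; apply: eexp_conj sW dp _.
Qed.

Definition parity b W := Par * W = (-1) ^+ b *: (W * Par).

Lemma parityJ x : parity 1 (J x).
Proof. by rewrite /parity ParJ expr1 scaleN1r. Qed.

Lemma parity0 b : parity b 0.
Proof. by rewrite /parity mulr0 mul0r scaler0. Qed.

Lemma parity1 : parity 0 1.
Proof. by rewrite /parity mulr1 mul1r expr0 scale1r. Qed.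

Lemma parityM b b' A B : parity b A -> parity b' B -> parity (b + b') (A * B).
Proof.
rewrite /parity => pA pB; rewrite mulrA pA -endo_scaleAl -mulrA pB -endo_scaleAr.
by rewrite scalerA mulrA exprD.
Qed.

Lemma parityD b A B : parity b A -> parity b B -> parity b (A + B).
Proof. by rewrite /parity => pA pB; rewrite mulrDr pA pB mulrDl scalerDr. Qed.

Lemma parityZ b c A : parity b A -> parity b (c *: A).
Proof.
rewrite /parity => pA; rewrite -endo_scaleAr pA -endo_scaleAl !scalerA.
by rewrite mulrC.
Qed.

Lemma parityB b A B : parity b A -> parity b B -> parity b (A - B).
Proof. by move=> pA pB; rewrite -scaleN1r; apply/parityD/parityZ. Qed.

Lemma parity_lie b b' A B : parity b A -> parity b' B -> parity (b + b') (lie A B).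
Proof.
move=> pA pB; apply: parityB; first exact: parityM.
by rewrite addnC; apply: parityM.
Qed.

Lemma parity_mod2 b A : parity b.+2 A -> parity b A.
Proof. by rewrite /parity 2!exprS !mulN1r opprK. Qed.

Lemma parity_lsum (I : choiceType) (A : set I) (f : I -> endo U) b :
  locfin A f -> (forall i, A i -> parity b (f i)) -> parity b (lsum A f).
Proof.
move=> lf fp; apply: endoP => p; rewrite endoEZ !endoEM.
have [s us fs] := lf p; have [s' us' fs'] := lf (Par p).
pose t := undup (s ++ s').
rewrite !(lsumE (s := t) lf) ?undup_uniq //; last 2 first.
- by move=> i Ai; rewrite mem_undup mem_cat negb_or => /andP[? ?]; apply: fs'.
- by move=> i Ai; rewrite mem_undup mem_cat negb_or => /andP[? ?]; apply: fs.
rewrite endo_sum scaler_sumr; apply: eq_bigr => i; rewrite inE => Ai.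
by rewrite -!endoEM (fp i Ai) endoEZ endoEM.
Qed.

Lemma parity_exp D : shift wle (-1) D -> parity 0 D -> parity 0 (eexp D).
Proof.
move=> lD pD; apply: parity_lsum; first exact: (locfin_exp lD).
move=> n _; apply: parityZ; elim: n => [|n IH]; first by rewrite expr0; apply: parity1.
by rewrite exprS -[0%N]addn0; apply: parityM.
Qed.

(* The n-fold commutators of W are scalars of odd parity, hence vanish. *)
Lemma ord_parity n W : ord n.+1 W -> parity n.+1 W -> ord n W.
Proof.
elim: n W => [W /ord_scalar[c ->]|n IH W oW pW x].
  rewrite /parity => /(congr1 (fun A : endo U => A one)).
  rewrite expr1 scaleN1r endoEN !endoEM !endoEZ !endoE1 endo_scale Par_one.
  move/eqP; rewrite -addr_eq0 -scalerDl scaler_eq0 (negPf one_neq0) orbF.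
  rewrite -mulr2n -mulr_natr mulf_eq0 (negPf (charF 1)) orbF => /eqP -> /=.
  by rewrite scale0r.
apply: IH; first exact: oW.
apply: parity_mod2; rewrite -[n.+3]addn1; apply: parity_lie pW _.
exact: parityJ.
Qed.

(** On normally ordered polynomials in the J, [dlie x] is the partial derivative by [J x], because
    [J x, J (star x)] = kap x, and [nord x] is multiplication by [J x] in normal order. So [euler k]
    is the operator sum :J_(x1)...J_(xk): d_(x1)...d_(xk). *)
Definition dlie x W := (kap x)^-1 *: lie W (J (star x)).
Definition nord x X := if neg x then J x * X else X * J x.
Fixpoint euler k W : endo U :=
  if k is k'.+1 then lsum [set: L] (fun x => nord x (euler k' (dlie x W))) else W.

Hypothesis neg_e : forall x, neg x -> 0 <= e x.
Hypothesis npos_e : forall x, ~~ neg x -> e x <= 0.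

Lemma shift_dlie c x W : shift wle c W -> shift wle (c - e x) (dlie x W).
Proof. by move=> sW; apply: shiftZ; rewrite -e_star; apply: shift_lie. Qed.

Lemma shift_nord c x X : shift wle (c - e x) X -> shift wle c (nord x X).
Proof.
move=> sX; rewrite /nord; case: ifP => _.
  by rewrite -[c](subrK (e x)) addrC; apply: shiftM.
by rewrite -[c](subrK (e x)); apply: shiftM.
Qed.

(** Here normal order matters. A creation letter stands on the left, and X, acting first, lowers the
    degree by e x up to c; any other letter stands on the right and lowers the degree itself. Either
    way only finitely many x contribute in bounded degree. *)
Lemma nord_far c (d : nat) x X p : shift wle (c - e x) X -> wle d p ->
  (d + `|c|)%N%:Z < `|e x| -> nord x X p = 0.
Proof.
move=> sX dp far; rewrite /nord; case: ifP => nx; rewrite endoEM.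
  rewrite (shift_eq0 sX dp) ?endoB0 //.
  by have := neg_e nx; lia.
rewrite (shift_eq0 (shiftJ x) dp) ?endoB0 //.
by have := npos_e (negbT nx); lia.
Qed.

Lemma locfin_nord c (X : L -> endo U) :
    (forall x, shift wle (c - e x) (X x)) ->
  forall d : nat, exists2 s, uniq s & forall p x,
    wle d p -> [set: L] x -> x \notin s -> nord x (X x) p = 0.
Proof.
move=> sX d; have [s us fs] := finJ (d + `|c|); exists s => // p x dp _ xs.
apply: nord_far (sX x) dp _; rewrite ltNge; apply/negP => /fs.
by rewrite (negPf xs).
Qed.

Lemma locfin_nord_pt c (X : L -> endo U) :
  (forall x, shift wle (c - e x) (X x)) ->
  locfin [set: L] (fun x => nord x (X x)).
Proof.
move=> sX p; have [d dp] := wle_exists wle p.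
by have [s us fs] := locfin_nord sX d; exists s => // i Ai /(fs p)->.
Qed.

Lemma shift_euler k c W : shift wle c W -> shift wle c (euler k W).
Proof.
elim: k c W => //= k IH c W sW.
have sX x : shift wle (c - e x) (euler k (dlie x W)) by apply/IH/shift_dlie.
apply: shift_lsum; last exact: (locfin_nord_pt sX).
by move=> x _; apply/shift_nord/sX.
Qed.

Lemma locfin_euler k c W : shift wle c W ->
  locfin [set: L] (fun x => nord x (euler k (dlie x W))).
Proof.
by move=> sW; apply: (@locfin_nord_pt c) => x; apply/shift_euler/shift_dlie.
Qed.

Lemma parity_euler k c b W : shift wle c W -> parity b W -> parity b (euler k W).
Proof.
elim: k c b W => //= k IH c b W sW pW.
apply: parity_lsum; first exact: (locfin_euler _ sW).
move=> x _; have pX : parity (b + 1) (euler k (dlie x W)).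
  apply: IH; first exact: (shift_dlie x sW).
  by apply/parityZ/parity_lie/parityJ.
apply: parity_mod2; rewrite /nord; case: ifP => _.
  by rewrite (_ : b.+2 = 1 + (b + 1))%N; [apply: parityM (parityJ x) pX|lia].
by rewrite (_ : b.+2 = b + 1 + 1)%N; [apply: parityM pX (parityJ x)|lia].
Qed.

Lemma nord0 x : nord x 0 = 0.
Proof. by rewrite /nord mulr0 mul0r if_same. Qed.

Lemma nordZ x a X : nord x (a *: X) = a *: nord x X.
Proof. by rewrite /nord -endo_scaleAl -endo_scaleAr; case: ifP. Qed.

Lemma nordD x X Y : nord x (X + Y) = nord x X + nord x Y.
Proof. by rewrite /nord mulrDl mulrDr; case: ifP. Qed.

Lemma dlieZ x a W : dlie x (a *: W) = a *: dlie x W.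
Proof. by rewrite /dlie lieZl !scalerA mulrC. Qed.

Lemma euler0 k : euler k 0 = 0.
Proof.
elim: k => //= k IH; apply: endoP => p; rewrite endoE0.
rewrite (lsumE (s := [::])) ?big_nil //; last by move=> i _ _; rewrite /dlie lie0l scaler0 IH nord0 endoE0.
by move=> q; exists [::] => // i _ _; rewrite /dlie lie0l scaler0 IH nord0 endoE0.
Qed.

Lemma eulerZ k a c W : shift wle c W -> euler k (a *: W) = a *: euler k W.
Proof.
elim: k c W => //= k IH c W sW; apply: endoP => p; rewrite endoEZ.
have lf1 := locfin_euler k sW; have lf2 := locfin_euler k (shiftZ a sW).
have [s1 _ H1] := lf1 p; have [s2 _ H2] := lf2 p.
rewrite !(lsumE (s := undup (s1 ++ s2))) ?undup_uniq //; first last.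
- by move=> i Ai; rewrite mem_undup mem_cat negb_or => /andP[? ?]; apply: H2.
- by move=> i Ai; rewrite mem_undup mem_cat negb_or => /andP[? ?]; apply: H1.
rewrite scaler_sumr; apply: eq_bigr => x _; rewrite dlieZ.
by rewrite (IH _ _ (shift_dlie x sW)) nordZ endoEZ.
Qed.

(** Partial derivatives commute: in the Jacobi identity the remaining term is a commutator with the
    scalar [J (star x), J y]. *)
Lemma dlie_lie x y W : lie (dlie x W) (J y) = dlie x (lie W (J y)).
Proof.
rewrite /dlie lieZl; congr (_ *: _).
by rewrite jacobi lieJ lie_scalar addr0.
Qed.

Lemma lie_nord x y X :
  lie (nord x X) (J y) = nord x (lie X (J y)) + ((y == star x)%:R * kap x) *: X.
Proof.
rewrite /nord; case: ifP => _; rewrite lieMl lieJ.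
  by rewrite -endo_scaleAl mul1r.
by rewrite -endo_scaleAr mulr1 addrC.
Qed.

Lemma kap_star_dlie y W : kap (star y) *: dlie (star y) W = lie W (J y).
Proof. by rewrite /dlie starK scalerA divff // scale1r. Qed.

(** The commutator with [J y] is a partial derivative. It hits either W or one of the k letters of
    the normally ordered product, and each such letter leaves one copy of [euler k.-1] of the
    derivative. *)
Lemma lie_euler k c W y : shift wle c W ->
  lie (euler k W) (J y) =
    euler k (lie W (J y)) + k%:R *: euler k.-1 (lie W (J y)).
Proof.
elim: k c W => [|k IH] c W sW; first by rewrite /= scale0r addr0.
have sWy := shift_lie sW (shiftJ y).
apply: endoP => p; rewrite lieE /= endoED endoEZ.
have lf1 := locfin_euler k sW; have lf2 := locfin_euler k sWy.
have lf3 := locfin_euler k.-1 sWy.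
have [s1 _ H1] := lf1 p; have [s2 _ H2] := lf1 (J y p).
have [s3 _ H3] := lf2 p; have [s4 _ H4] := lf3 p.
pose s := undup (star y :: s1 ++ s2 ++ s3 ++ s4).
have us : uniq s by apply: undup_uniq.
have sub i : i \notin s -> [/\ i \notin s1, i \notin s2, i \notin s3 & i \notin s4].
  by rewrite mem_undup inE !mem_cat !negb_or => /andP[_ /and4P[]].
rewrite (lsumE lf1 us (fun i Ai ni => H1 i Ai (let: And4 h _ _ _ := sub i ni in h))).
rewrite (lsumE lf1 us (fun i Ai ni => H2 i Ai (let: And4 _ h _ _ := sub i ni in h))).
rewrite (lsumE lf2 us (fun i Ai ni => H3 i Ai (let: And4 _ _ h _ := sub i ni in h))).
rewrite endo_sum -sumrB.
transitivity (\sum_(x <- s | x \in [set: L]%classic)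
   (nord x (euler k (dlie x (lie W (J y)))) p
    + k%:R *: nord x (euler k.-1 (dlie x (lie W (J y)))) p
    + ((x == star y)%:R * kap x) *: euler k (dlie x W) p)).
  apply: eq_bigr => x _; rewrite -lieE lie_nord (IH _ _ (shift_dlie x sW)).
  rewrite dlie_lie nordD nordZ !endoED !endoEZ; congr (_ + _ *: _).
  by congr (_%:R * _); rewrite -(inv_eq starK) eq_sym.
rewrite !big_split /= -addrA; congr (_ + _).
have -> : \sum_(x <- s | x \in [set: L]%classic)
    ((x == star y)%:R * kap x) *: euler k (dlie x W) p = euler k (lie W (J y)) p.
  rewrite (eq_bigl xpredT); last by move=> x; rewrite in_setT.
  rewrite (bigD1_seq (star y)) //=; last by rewrite mem_undup mem_head.
  rewrite big1 ?addr0; last by move=> x /negPf->; rewrite mul0r scale0r.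
  rewrite eqxx mul1r -kap_star_dlie.
  by rewrite (eulerZ _ _ (shift_dlie (star y) sW)) endoEZ.
(* The letter x = star y has contributed one [euler k], the induction hypothesis k more. For k = 0
   the meaningless predecessor is multiplied by 0. *)
rewrite -scaler_sumr; case: k {IH lf1 lf2 H1 H2 H3} lf3 H4 => [|k] lf3 H4.
  by rewrite scale0r add0r scale1r.
rewrite /= -(lsumE lf3 us); first by rewrite -[in RHS]addn1 natrD scalerDl scale1r.
by move=> i Ai /sub[*]; apply: H4.
Qed.

(* On normally ordered monomials of degree n, euler k is multiplication by n ^_ k. *)
Lemma euler_ord n k c W : shift wle c W -> ord n.+1 W ->
  ord n (euler k W - (n ^_ k)%:R *: W).
Proof.
elim: n k c W => [|n IH] k c W sW oW.
  case: k => [|k]; first by rewrite ffactn0 scale1r subrr.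
  rewrite ffact0n scale0r subr0 /=; apply: endoP => p; rewrite endoE0.
  have lf := locfin_euler k sW.
  have z x : nord x (euler k (dlie x W)) = 0.
    by rewrite /dlie (oW _) scaler0 euler0 nord0.
  by rewrite (lsumE (s := [::]) lf) ?big_nil // => i _ _; rewrite z endoE0.
move=> y; rewrite lieBl lieZl (lie_euler _ _ sW).
have sWy := shift_lie sW (shiftJ y).
have := IH k _ _ sWy (oW y); have := IH k.-1 _ _ sWy (oW y).
move: (lie W (J y)) => W' o1 o2.
have -> : euler k W' + k%:R *: euler k.-1 W' - (n.+1 ^_ k)%:R *: W' =
    (euler k W' - (n ^_ k)%:R *: W')
    + k%:R *: (euler k.-1 W' - (n ^_ k.-1)%:R *: W').
  (* The recursion of falling factorials that matches [lie_euler]. *)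
  have -> : n.+1 ^_ k = (n ^_ k + k * n ^_ k.-1)%N.
    case: k {o1 o2} => [|k]; first by rewrite !ffactn0.
    rewrite ffactSS ffactnSr -pred_Sn (mulnC (n ^_ k)) -mulnDl.
    case: (leqP k n) => [le|lt]; first by congr muln; lia.
    by rewrite ffact_small ?muln0.
  rewrite natrD natrM scalerDl opprD scalerBr scalerA.
  by rewrite addrACA.
by apply: ordD => //; apply: ordZ.
Qed.

(** As 3 ^_ 3 = 6, subtracting [euler 3 W] divided by 6 removes the order 3 part. The remainder Y
    has order at most 2 and is odd, hence has order at most 1. Then [euler 1 Y - Y] has order 0 and
    is odd, hence vanishes. *)
Lemma cubic_euler W c : shift wle c W -> ord 4 W -> parity 1 W ->
  exists Y, [/\ shift wle c Y, ord 2 Y, Y = euler 1 Y &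
                W = 6%:R^-1 *: euler 3 W + Y].
Proof.
move=> sW oW pW; have n6 : 6%:R != 0 :> F by exact: charF.
exists (W - 6%:R^-1 *: euler 3 W).
have sE := shift_euler 3 sW; have sY : shift wle c (W - 6%:R^-1 *: euler 3 W).
  by apply: shiftB => //; apply: shiftZ.
have pY : parity 1 (W - 6%:R^-1 *: euler 3 W).
  by apply: parityB => //; apply/parityZ/(parity_euler 3 sW pW).
have oY : ord 2 (W - 6%:R^-1 *: euler 3 W).
  apply: ord_parity; last first.
    by rewrite /parity -[3%N]/(2 + 1)%N exprD sqrrN expr1n mul1r.
  have := euler_ord 3 sW oW => /(ordZ (- 6%:R^-1)).
  by rewrite scalerBr scalerA scaleNr mulNr mulVf // scaleN1r opprK addrC.
split=> //; last by rewrite addrCA subrr addr0.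
have := euler_ord 1 sY oY; rewrite scale1r => o1.
apply/esym/eqP; rewrite -subr_eq0; apply/eqP.
apply: (ord_parity (n := 0)); first exact: o1.
by apply: parityB => //; apply: (parity_euler 1 sY pY).
Qed.

Fixpoint eulerw (s : seq L) k W : endo U :=
  if k is k'.+1 then \sum_(x <- s) nord x (eulerw s k' (dlie x W)) else W.

Lemma shift_eulerw s k c W : shift wle c W -> shift wle c (eulerw s k W).
Proof.
elim: k c W => //= k IH c W sW.
by apply: shift_sum => x _; apply/shift_nord/IH/shift_dlie.
Qed.

(** A letter x that contributes has |e x| at most d + |c|. It replaces d by at most d + |e x| and
    |c| by at most |c| + |e x|, so their sum at most triples at each of the k steps. *)
Lemma eulerwE s k c (d : nat) W p : uniq s ->
    (forall x, `|e x| <= (3 ^ k * (d + `|c|))%N%:Z -> x \in s) ->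
    shift wle c W -> wle d p ->
  euler k W p = eulerw s k W p.
Proof.
move=> us; elim: k c d W p => //= k IH c d W p sk sW dp.
have lf := locfin_euler k sW.
have far x : (d + `|c|)%N%:Z < `|e x| -> nord x (euler k (dlie x W)) p = 0.
  by apply: nord_far dp; apply/shift_euler/shift_dlie.
rewrite (lsumE lf us); last first.
  move=> x _ xs; apply: far; rewrite ltNge; apply/negP => ex.
  by case/negP: xs; apply: sk; apply: le_trans ex _; rewrite lez_nat expnS; nia.
rewrite endoE_sum; apply: eq_big => [x|x _]; first by rewrite in_setT.
case: (ltP (d + `|c|)%N%:Z `|e x|) => ex.
  by rewrite far // (nord_far _ dp ex) //; apply/shift_eulerw/shift_dlie.
have IHx q : wle (d + `|e x|)%N q ->
    euler k (dlie x W) q = eulerw s k (dlie x W) q.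
  apply: IH (shift_dlie x sW) => y ey; apply: sk; apply: le_trans ey _.
  by rewrite lez_nat expnSr -mulnA leq_mul2l; apply/orP; right; lia.
rewrite /nord; case: ifP => _; rewrite !endoEM IHx //.
  by apply: (wleS _ dp); lia.
by apply: (wleS _ (shiftJ x dp)); lia.
Qed.

Lemma dlieC x y W : dlie x (dlie y W) = dlie y (dlie x W).
Proof. by rewrite {1}/dlie dlie_lie -dlieZ. Qed.

Hypothesis neg_star : forall x, neg (star x) = ~~ neg x.

Lemma J_comm x y : neg x = neg y -> J x * J y = J y * J x.
Proof.
move=> nxy; apply/eqP; rewrite -subr_eq0; apply/eqP; rewrite [LHS]lieJ.
case: eqP => [yx|_]; last by rewrite mul0r scale0r.
by move: nxy; rewrite yx neg_star; case: (neg x).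
Qed.

Lemma nordC x y X : nord x (nord y X) = nord y (nord x X).
Proof.
rewrite /nord; case nx: (neg x); case ny: (neg y); rewrite ?mulrA //.
  by rewrite (@J_comm x y) // nx.
by rewrite -!mulrA (@J_comm x y) // nx.
Qed.

Lemma nord_sum x I (r : seq I) (P : pred I) f :
  nord x (\sum_(i <- r | P i) f i) = \sum_(i <- r | P i) nord x (f i).
Proof. exact: (big_morph (nord x) (nordD x) (nord0 x)). Qed.

Context (le : rel L).
Hypothesis le_tot : total le.
Hypothesis le_tr : transitive le.
Hypothesis le_neg : forall x y, le x y -> neg y -> neg x.

Definition srt x y z := le x y && le y z.
(** The number of sorted arrangements of a triple. [le] is only a total preorder: distinct letters
    may tie, as currents of different families with the same index do, since the cubic form orders
    the indices but not the families. *)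
Definition cnt x y z : nat :=
  (srt x y z + srt x z y + srt y x z + srt y z x + srt z x y + srt z y x)%N.

Lemma cnt_gt0 x y z : (0 < cnt x y z)%N.
Proof.
rewrite /cnt /srt; have := le_tot x y; have := le_tot y z; have := le_tot x z.
by do 6?case: (le _ _); rewrite ?orbT.
Qed.

(** By [le_neg], creation letters come first in a sorted triple, so the product is normally ordered
    up to exchanging letters of the same kind, which commute. *)
Lemma nord_srt x y z : srt x y z -> nord x (nord y (J z)) = J x * (J y * J z).
Proof.
case/andP => xy yz; rewrite /nord; case ny: (neg y).
  by rewrite (le_neg xy ny).
have nz : neg z = false by apply/negP => /(le_neg yz); rewrite ny.
rewrite (@J_comm y z) ?ny ?nz //; case nx: (neg x) => //.
rewrite [RHS]mulrA (@J_comm x z) ?nx ?nz //.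
by rewrite -!mulrA (@J_comm x y) ?nx ?ny.
Qed.

(* Every triple has a sorted permutation; cnt corrects for triples with several. *)
Lemma sum_sorted (s : seq L) (g : L -> L -> L -> U) :
    (forall x y z, g x y z = g y x z) -> (forall x y z, g x y z = g x z y) ->
  \sum_(x <- s) \sum_(y <- s) \sum_(z <- s) g x y z =
  6%:R *: \sum_(x <- s) \sum_(y <- s) \sum_(z <- s)
    if srt x y z then (cnt x y z)%:R^-1 *: g x y z else 0.
Proof.
move=> g1 g2; set G := fun x y z => if srt x y z then (cnt x y z)%:R^-1 *: g x y z else 0.
have c1 x y z : cnt x y z = cnt y x z by rewrite /cnt; lia.
have c2 x y z : cnt x y z = cnt x z y by rewrite /cnt; lia.
have gE x y z : g x y z = G x y z + G x z y + G y x z + G y z x + G z x y + G z y x.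
  have E (b : bool) : (if b then (cnt x y z)%:R^-1 *: g x y z else 0) =
      (b : nat)%:R *: ((cnt x y z)%:R^-1 *: g x y z).
    by case: b; rewrite ?scale1r ?scale0r.
  rewrite /G (c2 x z y) (g2 x z y) (c1 y x z) (g1 y x z).
  rewrite (c2 y z x) (g2 y z x) (c1 y x z) (g1 y x z).
  rewrite (c1 z x y) (g1 z x y) (c2 x z y) (g2 x z y).
  rewrite (c2 z y x) (g2 z y x) (c1 z x y) (g1 z x y) (c2 x z y) (g2 x z y).
  have c0 : (cnt x y z)%:R != 0 :> F by rewrite -(prednK (cnt_gt0 x y z)).
  by rewrite !E -!scalerDl -!natrD scalerA -/(cnt x y z) (divff c0) scale1r.
have E1 (h : L -> L -> L -> U) :
    \sum_(x <- s) \sum_(y <- s) \sum_(z <- s) h x y z =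
    \sum_(x <- s) \sum_(y <- s) \sum_(z <- s) h y x z by rewrite exchange_big.
have E2 (h : L -> L -> L -> U) :
    \sum_(x <- s) \sum_(y <- s) \sum_(z <- s) h x y z =
    \sum_(x <- s) \sum_(y <- s) \sum_(z <- s) h x z y.
  by apply: eq_bigr => x _; rewrite exchange_big.
under eq_bigr do under eq_bigr do under eq_bigr do rewrite gE.
under eq_bigr do under eq_bigr do rewrite !big_split /=.
under eq_bigr do rewrite !big_split /=.
rewrite !big_split /=.
rewrite -(E2 G) -(E1 G) -[X in _ + X + _ + _](E1 (fun x y z => G x z y)) -(E2 G).
rewrite -[X in _ + X + _](E2 (fun x y z => G y x z)) -(E1 G).
rewrite -[X in _ + X](E1 (fun x y z => G z x y)).
rewrite -[X in _ + X](E2 (fun x y z => G y x z)) -(E1 G).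
by rewrite scaler_nat !mulrSr mulr0n add0r.
Qed.

(** The third derivatives S being scalars, [euler 3 W] is an explicit cubic sum. The bound 27 is the
    factor 3 ^ 3 of [eulerwE]. *)
Lemma cubic_normal_form W Y c (S : L -> L -> L -> F) (b : L -> F) (s : seq L)
    (d : nat) p :
    shift wle c W -> shift wle c Y -> Y = euler 1 Y ->
    W = 6%:R^-1 *: euler 3 W + Y ->
    (forall x y z, dlie z (dlie y (dlie x W)) = S x y z *: (1 : endo U)) ->
    (forall x, dlie x Y = b x *: (1 : endo U)) ->
    uniq s -> (forall x, `|e x| <= (27 * (d + `|c|))%N%:Z -> x \in s) ->
    wle d p ->
  W p = \sum_(x <- s) \sum_(y <- s) \sum_(z <- s)
      (if srt x y z then (S x y z / (cnt x y z)%:R) *: J x (J y (J z p)) else 0)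
    + \sum_(x <- s) b x *: J x p.
Proof.
move=> sW sY YE WE SE bE us ss dp; rewrite {1}WE endoED endoEZ; congr (_ + _); last first.
  rewrite {1}YE (eulerwE (s := s) _ _ sY dp) //=.
    rewrite endoE_sum; apply: eq_bigr => x _; rewrite bE nordZ endoEZ /nord.
    by rewrite mulr1 mul1r if_same.
  by move=> x ex; apply: ss; apply: le_trans ex _; rewrite lez_nat; lia.
rewrite (eulerwE (s := s) _ _ sW dp) //=.
under eq_bigr do rewrite nord_sum.
under eq_bigr do under eq_bigr do rewrite 2!nord_sum.
have nE x y z : nord x (nord y (nord z (dlie z (dlie y (dlie x W))))) =
    S x y z *: nord x (nord y (J z)).
  rewrite SE !nordZ; congr (_ *: nord x (nord y _)).
  by rewrite /nord mulr1 mul1r if_same.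
transitivity (6%:R^-1 *: \sum_(x <- s) \sum_(y <- s) \sum_(z <- s)
    S x y z *: nord x (nord y (J z)) p).
  congr (_ *: _); rewrite endoE_sum; apply: eq_bigr => x _.
  rewrite endoE_sum; apply: eq_bigr => y _; rewrite endoE_sum.
  by apply: eq_bigr => z _; rewrite nE endoEZ.
(* The factor 6 gained by passing to sorted triples cancels the 1/6 in front of [euler 3 W]. *)
rewrite (sum_sorted _ (g := fun x y z => S x y z *: nord x (nord y (J z)) p)).
- rewrite scalerA mulVf; last exact: charF.
  rewrite scale1r; apply: eq_bigr => x _; apply: eq_bigr => y _; apply: eq_bigr => z _.
  by case: ifP => // xyz; rewrite nord_srt // scalerA mulrC !endoEM.
- by move=> x y z; rewrite -!endoEZ -!nE (dlieC y x W) (nordC x y).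
- by move=> x y z; rewrite -!endoEZ -!nE (nordC y z) (dlieC z y (dlie x W)).
Qed.

End Heisenberg.

(** * The currents as generators of a Heisenberg algebra *)

Lemma oddfactS n : oddfact n.+1 = (oddfact n * (2 * n + 1))%N.
Proof. by rewrite /oddfact big_ord_recr. Qed.

Lemma oddfact_gt0 n : (0 < oddfact n)%N.
Proof. by apply: prodn_gt0 => i; rewrite addn1. Qed.

Section Letters.
Context (F : fieldType) (N : nat).
Hypothesis charF : forall n, n.+1%:R != 0 :> F.
Local Notation V := ('I_N * nat)%type.
Local Notation L := ('I_N * int)%type.
Local Notation U := (pol F V).

Lemma pnat_neq0 n : (0 < n)%N -> n%:R != 0 :> F.
Proof. by case: n. Qed.

Definition deg (v : V) : nat := (2 * v.2 + 1)%N.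
Local Notation wle := (wfil F deg).

Definition Jop (x : L) : endo U :=
  if x.2 is Posz n.+1 then (oddfact n.+1)%:R *: Der F (x.1, n)
  else (oddfact `|x.2|)%:R^-1 *: Var F (x.1, `|x.2|%N).
(** For k > 0, J_k = (2k-1)!! d/dT_(k-1) is dual to J_(1-k) = T_(k-1) / (2k-3)!!, so the pairing is
    i <-> 1 - i. The quotient of the two double factorials gives [J_k, J_(1-k)] = 2k - 1, for k <= 0
    as well. *)
Definition star (x : L) : L := (x.1, 1 - x.2).
Definition kap (x : L) : F := (2 * x.2 - 1)%:~R.
Definition creation (x : L) : bool := x.2 <= 0.
Definition wtJ (x : L) : int := 1 - 2 * x.2.
Definition letter_le (x y : L) : bool := x.2 <= y.2.

Variant Jop_spec (a : 'I_N) : int -> endo U -> Type :=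
| JopDer n : Jop_spec a n.+1%:Z ((oddfact n.+1)%:R *: Der F (a, n))
| JopVar n : Jop_spec a (- n%:Z) ((oddfact n)%:R^-1 *: Var F (a, n)).

Lemma JopP a i : Jop_spec a i (Jop (a, i)).
Proof.
case: i => [[|n]|n]; rewrite /Jop /=.
- exact: (JopVar a 0).
- exact: JopDer.
- by rewrite NegzE; apply: JopVar.
Qed.

Lemma currentE a i p : current (pair a) i p = Jop (a, i) p.
Proof.
rewrite /current /Jop /=; case: i => [[|n]|n] //=.
- by rewrite endoEZ VarE.
- by rewrite subn1 /= endoEZ; congr (_ *: _); exact: DerE.
- by rewrite endoEZ VarE.
Qed.

Lemma oddfact_neq0 n : (oddfact n)%:R != 0 :> F.
Proof. exact/pnat_neq0/oddfact_gt0. Qed.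

Lemma lieDV (v u : V) : lie (Der F v) (Var F u) = (v == u)%:R *: (1 : endo U).
Proof. by rewrite /lie Der_Var addrK. Qed.

Lemma lieVD (v u : V) : lie (Var F v) (Der F u) = - (u == v)%:R *: (1 : endo U).
Proof. by rewrite lieC lieDV scaleNr. Qed.

Lemma lieDD (v u : V) : lie (Der F v) (Der F u) = 0.
Proof. by rewrite /lie DerC subrr. Qed.

Lemma lieVV (v u : V) : lie (Var F v) (Var F u) = 0.
Proof. by rewrite /lie VarC subrr. Qed.

Lemma lieJ x y :
  lie (Jop x) (Jop y) = ((y == star x)%:R * kap x) *: (1 : endo U).
Proof.
case: x y => a i [b j]; rewrite /kap /star xpair_eqE /=.
case: JopP => n; case: JopP => m; rewrite !lieZl !lieZr.
- rewrite lieDD !scaler0 (_ : (m.+1%:Z == 1 - n.+1%:Z) = false) ?andbF ?mul0r ?scale0r //.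
  by apply/negbTE; lia.
- rewrite lieDV !scalerA; congr (_ *: _).
  rewrite xpair_eqE /= eq_sym (_ : (- m%:Z == 1 - n.+1%:Z) = (n == m)); last by lia.
  case: (b == a); last by rewrite mulr0 mul0r.
  case: eqP => [->|_] /=; last by rewrite mulr0 mul0r.
  rewrite mulr1 mul1r oddfactS natrM mulrAC divff ?oddfact_neq0 // mul1r.
  by rewrite -[LHS]/((2 * m + 1)%N%:~R); congr (_%:~R); lia.
- rewrite lieVD !scalerA; congr (_ *: _).
  rewrite xpair_eqE (_ : (m.+1%:Z == 1 - - n%:Z) = (m == n)); last by lia.
  case: (b == a); last by rewrite oppr0 mulr0 mul0r.
  case: eqP => [->|_] /=; last by rewrite oppr0 mulr0 mul0r.
  rewrite mulrN mulr1 mul1r oddfactS natrM mulrA mulVf ?oddfact_neq0 // mul1r.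
  by rewrite -[X in - X]/((2 * n + 1)%N%:~R) -rmorphN; congr (_%:~R); lia.
- rewrite lieVV !scaler0 (_ : (- m%:Z == 1 - - n%:Z) = false) ?andbF ?mul0r ?scale0r //.
  by apply/negbTE; lia.
Qed.

Lemma starK : involutive star.
Proof. by case=> a i; rewrite /star /=; congr pair; lia. Qed.

Lemma kap_neq0 x : kap x != 0.
Proof.
rewrite /kap; case E: (2 * x.2 - 1) => [[|n]|n].
- by exfalso; lia.
- exact: charF.
- by rewrite NegzE rmorphN oppr_eq0; apply: charF.
Qed.

Lemma shiftJ x : shift wle (wtJ x) (Jop x).
Proof.
case: x => a i; rewrite /wtJ /=; case: JopP => n; apply: shiftZ.
  by apply: (shiftS _ (@shift_Der _ _ deg _)); rewrite /deg /=; lia.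
by apply: (shiftS _ (@shift_Var _ _ deg _)); rewrite /deg /=; lia.
Qed.

Lemma wtJ_star x : wtJ (star x) = - wtJ x.
Proof. by rewrite /wtJ /star /=; lia. Qed.

Definition window (M : nat) : seq int := [seq k%:Z - M%:Z | k <- iota 0 (2 * M + 2)].
Definition letters (M : nat) : seq L :=
  [seq (a, i) | a <- enum 'I_N, i <- window M].

Lemma window_uniq M : uniq (window M).
Proof. by rewrite map_inj_uniq ?iota_uniq // => i j; lia. Qed.

Lemma mem_window M i : (i \in window M) = (- M%:Z <= i <= M%:Z + 1).
Proof.
apply/mapP/idP => [[k]|H]; first by rewrite mem_iota => ? ->; lia.
by exists (absz (i + M%:Z)); rewrite ?mem_iota; lia.
Qed.

Lemma letters_uniq M : uniq (letters M).
Proof.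
apply: allpairs_uniq; [exact: enum_uniq|exact: window_uniq|].
by move=> [? ?] [? ?] _ _ /= [-> ->].
Qed.

Lemma mem_letters M x : `|wtJ x| <= M%:Z -> x \in letters M.
Proof.
case: x => a i; rewrite /wtJ /= => H; apply/allpairsP; exists (a, i).
by rewrite mem_enum mem_window; split=> //=; lia.
Qed.

Lemma finJ (M : nat) :
  exists2 s : seq L, uniq s & forall x, `|wtJ x| <= M%:Z -> x \in s.
Proof. by exists (letters M); [exact: letters_uniq|move=> x; exact: mem_letters]. Qed.

Lemma scalarJ (A : endo U) : (forall x, lie A (Jop x) = 0) ->
  exists c, A = c *: (1 : endo U).
Proof.
move=> AJ; apply: endo_scalar => // -[a n]; apply/eqP; rewrite -subr_eq0; apply/eqP.
  have := AJ (a, - n%:Z); rewrite /Jop /=; case: n => [|n] /=.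
    by rewrite lieZr /oddfact big_ord0 invr1 scale1r.
  rewrite lieZr => /eqP; rewrite scaler_eq0 invr_eq0 (negPf (oddfact_neq0 _)) /=.
  by move/eqP.
have := AJ (a, n.+1%:Z); rewrite /Jop /= lieZr => /eqP.
by rewrite scaler_eq0 (negPf (oddfact_neq0 _)) => /eqP.
Qed.

Lemma ParJ x : Par F V * Jop x = - (Jop x * Par F V).
Proof.
case: x => a i; case: JopP => n; rewrite -endo_scaleAr -endo_scaleAl.
  by rewrite Par_Der scalerN.
by rewrite Par_Var scalerN.
Qed.

Lemma polU_neq0 : (1 : U) != 0.
Proof. exact: oner_neq0. Qed.

Lemma creation_wtJ x : creation x -> 0 <= wtJ x.
Proof. by rewrite /creation /wtJ; lia. Qed.

Lemma ncreation_wtJ x : ~~ creation x -> wtJ x <= 0.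
Proof. by rewrite /creation /wtJ; lia. Qed.

Lemma creation_star x : creation (star x) = ~~ creation x.
Proof. by rewrite /creation /star /=; lia. Qed.

Lemma letter_le_total : total letter_le.
Proof. by move=> x y; apply: le_total. Qed.

Lemma letter_le_creation x y : letter_le x y -> creation y -> creation x.
Proof. exact: le_trans. Qed.

Lemma big_letters M (f : L -> U) :
  \sum_(x <- letters M) f x = \sum_a \sum_(i <- window M) f (a, i).
Proof. by rewrite big_allpairs big_enum. Qed.

Theorem cubic_form_exists (W : endo U) :
    shift wle 3 W -> ord Jop 4 W -> parity (Par F V) 1 W ->
  exists A B, forall p, W p = cubic_form A B p.
Proof.
move=> sW oW pW.
have [Y [sY oY YE WE]] := cubic_euler charF lieJ starK kap_neq0 shiftJ wtJ_star
  finJ scalarJ ParJ (Par1 F V) polU_neq0 creation_wtJ ncreation_wtJ sW oW pW.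
(* Reads the constant c off the operator c *: 1, by applying it to the polynomial 1. *)
pose sc (A : endo U) : F := coef mone (A 1).
have scE c : sc (c *: (1 : endo U)) = c.
  by rewrite /sc endoEZ endoE1 -mul_malgC mulr1 coefU eqxx.
have scP (A : endo U) : ord Jop 1 A -> A = sc A *: (1 : endo U).
  by move=> /scalarJ[c ->]; rewrite scE.
have sc0 (A : endo U) c : shift wle c A -> c < 0 -> sc A = 0.
  move=> sA c0; rewrite /sc (_ : A 1 = 0) ?coef0p //.
  apply: (shift_eq0 (d := 0) sA); last by rewrite add0r.
  exact: wsub1.
pose dl := dlie Jop star kap.
have odl (n : nat) (x : L) (A : endo U) : ord Jop n.+1 A -> ord Jop n (dl x A).
  by move=> oA; apply: ordZ; apply: oA.
pose S x y z := sc (dl z (dl y (dl x W))).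
pose b x := sc (dl x Y).
have SE x y z : dl z (dl y (dl x W)) = S x y z *: (1 : endo U).
  by apply: scP; do 3!apply/odl.
have bE x : dl x Y = b x *: (1 : endo U) by apply: scP; apply: odl.
have sdl c x A : shift wle c A -> shift wle (c - wtJ x) (dl x A).
  exact: (shift_dlie kap shiftJ wtJ_star).
(* This scalar operator shifts the degree by 3 minus the three weights 1 - 2i, that is by 2 (i + j +
   k), so it vanishes when the sum is negative. For the linear coefficients the same count gives 3 -
   (1 - 2j) = 2j + 2. *)
have S0 (x y z : L) : x.2 + y.2 + z.2 < 0 -> S x y z = 0.
  move=> xyz; apply: (sc0 _ _ (sdl _ z _ (sdl _ y _ (sdl _ x _ sW)))).
  by rewrite /wtJ; lia.
have b0 (x : L) : x.2 < -1 -> b x = 0.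
  by move=> xlt; apply: (sc0 _ _ (sdl _ x _ sY)); rewrite /wtJ; lia.
pose A a b' c i j k := S (a, i) (b', j) (c, k) /
  (cnt letter_le (a, i) (b', j) (c, k))%:R.
pose B a j := b (a, j).
exists A, B => p; have [d dp] := wle_exists wle p.
(* The window required by [cubic_normal_form] for an operator of shift 3. *)
pose M := (27 * (d + 3))%N.
have Jkill (x : L) : d%:Z < 2 * x.2 - 1 -> Jop x p = 0.
  by move=> dx; have := shift_eq0 (@shiftJ x) dp; apply; rewrite /wtJ; lia.
rewrite (cubic_normal_form charF lieJ shiftJ wtJ_star finJ polU_neq0
  creation_wtJ ncreation_wtJ creation_star letter_le_total letter_le_creation sW sY
  YE WE SE bE (letters_uniq M) (@mem_letters M) dp).
rewrite /cubic_form; congr (_ + _); last first.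
  rewrite big_letters; apply: eq_bigr => a _.
  rewrite (fsum_window (window_uniq M)); last first.
    move=> j /= j1; rewrite mem_window => jM; rewrite currentE Jkill ?scaler0 //=.
    by rewrite /M in jM *; lia.
  rewrite [RHS]big_mkcond; apply: eq_bigr => j _; rewrite currentE.
  case: ifPn => // /negP; rewrite inE /= => j1.
  by rewrite b0 ?scale0r //=; lia.
rewrite big_letters; apply: eq_bigr => a _.
transitivity (\sum_(b' < N) \sum_(c < N) \sum_(i <- window M) \sum_(j <- window M)
   \sum_(k <- window M)
    (if srt letter_le (a, i) (b', j) (c, k)
     then A a b' c i j k *: Jop (a, i) (Jop (b', j) (Jop (c, k) p)) else 0)).
  under eq_bigr do rewrite big_letters; rewrite exchange_big; apply: eq_bigr => b' _.
  under eq_bigr do under eq_bigr do rewrite big_letters.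
  under eq_bigr do rewrite exchange_big.
  by rewrite exchange_big.
apply: eq_bigr => b' _; apply: eq_bigr => c _.
pose s := [seq (ij, k) | ij <- [seq (i, j) | i <- window M, j <- window M], k <- window M].
rewrite (@fsum_window _ _ _ _ s); first last.
(* The set of triples is infinite, but J_k p = 0 unless 2k - 1 <= d. This bounds all three indices
   above, and i + j + k >= 0 then bounds them below. *)
- move=> [[i j] k] [/= ij jk ijk] ns; rewrite !currentE.
  rewrite (Jkill (c, k)) ?endoB0 ?scaler0 //=.
  rewrite ltNge; apply/negP => kd; case/negP: ns.
  have H n : (- (M%:Z) <= n) -> n <= M%:Z + 1 -> n \in window M.
    by move=> ? ?; rewrite mem_window; apply/andP.
  apply/allpairsP; exists ((i, j), k); split=> //=; last by apply: H; rewrite /M; lia.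
  by apply/allpairsP; exists (i, j); split=> //=; apply: H; rewrite /M; lia.
- apply: allpairs_uniq; [|exact: window_uniq|by move=> [? ?] [? ?] _ _ /= [-> ->]].
  by apply: allpairs_uniq; [exact: window_uniq..|move=> [? ?] [? ?] _ _ /= [-> ->]].
rewrite [RHS]big_mkcond /= !big_allpairs.
apply: eq_bigr => i _; apply: eq_bigr => j _; apply: eq_bigr => k _ /=.
rewrite !currentE; case: ifPn => [/andP[ij jk]|ns].
  case: ifPn => // /negP; rewrite inE /= => ns.
  rewrite /A S0 ?mul0r ?scale0r //= ltNge; apply/negP => ijk.
  by apply: ns; split.
case: ifPn => //; rewrite inE /= => -[ij jk _].
by case/negP: ns; apply/andP.
Qed.

End Letters.

(** * Virasoro, rotation and cut-and-join operators *)

Section UniformLocal.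
Context (F : fieldType) (U : lmodType F) (wle : filtration U) (I : choiceType).

(** Local finiteness with a support depending only on the degree, so that one finite sum agrees with
    the infinite one on a whole step of the filtration, as [ord_lsum] requires. *)
Definition ulocfin (A : set I) (f : I -> endo U) :=
  forall d : nat, exists2 s, uniq s & forall p i,
    wle d p -> A i -> i \notin s -> f i p = 0.

Lemma ulocfin_locfin A f : ulocfin A f -> locfin A f.
Proof.
move=> uf p; have [d dp] := wle_exists wle p; have [s us fs] := uf d.
by exists s => // i; apply: fs.
Qed.

End UniformLocal.

Lemma ulocfin_nat (F : fieldType) (U : lmodType F) (wle : filtration U)
    (A : set nat) (f : nat -> endo U) (K : nat -> nat) :
    (forall (d : nat) p i, wle d p -> A i -> (K d <= i)%N -> f i p = 0) ->
  ulocfin wle A f.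
Proof.
move=> fK d; exists (iota 0 (K d)); first exact: iota_uniq.
by move=> p i dp Ai; rewrite mem_iota leq0n /= -leqNgt; apply: fK dp Ai.
Qed.

Lemma ulocfin_shift (F : fieldType) (U : lmodType F) (wle : filtration U)
    (A : set nat) (f : nat -> endo U) :
  (forall k, A k -> shift wle (- k%:Z) (f k)) -> ulocfin wle A f.
Proof.
move=> sf; apply: (@ulocfin_nat _ _ _ _ _ S) => d p i dp Ai di.
by apply: (shift_eq0 (sf i Ai) dp); lia.
Qed.

Section Virasoro.
Context (F : fieldType) (V : choiceType) (x : nat -> V).
Local Notation U := (pol F V).

Definition Derz (k : int) : endo U := if k is Posz n then Der F (x n) else 0.

Definition square (n : nat) : seq (nat * nat) :=
  [seq (i, j) | i <- iota 0 n, j <- iota 0 n].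

Definition Virmid (m : int) (k : nat) : endo U :=
  ((oddfact `|k%:Z + m + 1|)%:R / (oddfact k)%:R) *: (Var F (x k) * Derz (k%:Z + m)).

(** For each m only the middle sum is infinite: i + j = -m-1 or m-1 forces both indices into the
    square of side |m| + 2. *)
Definition Vir (m : int) : endo U :=
  2^-1 *: (\sum_(ij <- square `|m|.+2 |
              ij \in [set ij : nat * nat | ij.1%:Z + ij.2%:Z = - m - 1])
    (oddfact ij.1 * oddfact ij.2)%:R^-1 *: (Var F (x ij.1) * Var F (x ij.2)))
  + lsum [set: nat] (Virmid m)
  + 2^-1 *: (\sum_(ij <- square `|m|.+2 |
              ij \in [set ij : nat * nat | ij.1%:Z + ij.2%:Z = m - 1])
    (oddfact ij.1.+1 * oddfact ij.2.+1)%:R *: (Der F (x ij.1) * Der F (x ij.2))).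

Lemma square_uniq n : uniq (square n).
Proof.
by apply: allpairs_uniq; [exact: iota_uniq..|move=> [? ?] [? ?] _ _ /= [-> ->]].
Qed.

Lemma mem_square n ij : (ij \in square n) = (ij.1 < n)%N && (ij.2 < n)%N.
Proof.
apply/allpairsP/andP => [[[i j] /= [Hi Hj ->]]|[Hi Hj]].
  by move: Hi Hj; rewrite !mem_iota.
by exists ij; split; rewrite ?mem_iota //; case: ij {Hi Hj}.
Qed.

Lemma pderivzE k p : pderivz x k p = Derz k p.
Proof. by case: k => n /=; rewrite ?endoE0 // DerE. Qed.

Context (w : V -> nat) (w_ge : forall k, (k <= w (x k))%N).
Local Notation wle := (wfil F w).

Lemma ulocfin_Virmid m : ulocfin wle [set: nat] (Virmid m).
Proof.
apply: (@ulocfin_nat _ _ _ _ _ (fun d => d + `|m| + 1)%N) => d p k dp _ dk.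
rewrite endoEZ endoEM; suff -> : Derz (k%:Z + m) p = 0 by rewrite endoB0 scaler0.
case E: (k%:Z + m) => [n|n] /=; last exact: endoE0.
have := shift_eq0 (@shift_Der F V w (x n)) dp; apply.
by have := w_ge n; lia.
Qed.

Lemma virasoroE m p : virasoro x m p = Vir m p.
Proof.
rewrite /Vir endoED endoED endoEZ endoEZ.
apply: (congr2 +%R); first apply: (congr2 +%R); first apply: (congr1 ( *:%R _)).
- rewrite (fsum_window (square_uniq `|m|.+2)) ?endoE_sum.
    by apply: eq_bigr => ij _; rewrite endoEZ endoEM !VarE mulrA.
  by move=> [i j] /= H; rewrite mem_square /=; lia.
- rewrite (lsum_fsum _ (ulocfin_locfin (ulocfin_Virmid m))).
  apply: eq_fsbigr => k _; rewrite /Virmid endoEZ endoEM VarE.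
  by congr (_ *: (_ * _)); exact: pderivzE.
- apply: (congr1 ( *:%R _)); rewrite (fsum_window (square_uniq `|m|.+2)) ?endoE_sum.
    apply: eq_bigr => ij _; rewrite endoEZ endoEM; congr (_ *: _).
    by rewrite DerE; congr (Der _ _ _); exact: DerE.
  by move=> [i j] /= H; rewrite mem_square /=; lia.
Qed.

(** The factor c allows for both weights: 1 for [deg], and 1 or 3, depending on the family, for the
    rescaled weight. *)
Lemma shift_Vir c m : (forall k, w (x k) = (c * (2 * k + 1))%N) ->
  shift wle (- (2 * c%:Z * m)) (Vir m).
Proof.
move=> wE; apply: shiftD; first apply: shiftD.
- apply: shiftZ; apply: shift_sum => -[i j]; rewrite inE /= => H; apply: shiftZ.
  have := shiftM (@shift_Var F V w (x i)) (@shift_Var F V w (x j)).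
  by apply: shiftS; rewrite !wE; nia.
- apply: shift_lsum; last exact: (ulocfin_locfin (ulocfin_Virmid m)).
  move=> k _; apply: shiftZ.
  case E: (k%:Z + m) => [n|n] /=; last by rewrite mulr0; apply: shift0.
  have := shiftM (@shift_Var F V w (x k)) (@shift_Der F V w (x n)).
  by apply: shiftS; rewrite !wE; nia.
- apply: shiftZ; apply: shift_sum => -[i j]; rewrite inE /= => H; apply: shiftZ.
  have := shiftM (@shift_Der F V w (x i)) (@shift_Der F V w (x j)).
  by apply: shiftS; rewrite !wE; nia.
Qed.

End Virasoro.

Section Operators.
Context (F : fieldType) (N : nat).
Hypothesis charF : forall n, n.+1%:R != 0 :> F.
Local Notation V := ('I_N * nat)%type.
Local Notation U := (pol F V).
Local Notation wle := (wfil F (@deg N)).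

Definition graded n b (A : endo U) := ord (@Jop F N) n A /\ parity (Par F V) b A.

Lemma gradedD n b A B : graded n b A -> graded n b B -> graded n b (A + B).
Proof. by move=> [? ?] [? ?]; split; [apply: ordD|apply: parityD]. Qed.

Lemma gradedZ n b c A : graded n b A -> graded n b (c *: A).
Proof. by move=> [? ?]; split; [apply: ordZ|apply: parityZ]. Qed.

Lemma graded0 n b : graded n b 0.
Proof. by split; [apply: ord0|apply: parity0]. Qed.

Lemma graded_sum n b I (r : seq I) (P : pred I) f :
  (forall i, P i -> graded n b (f i)) -> graded n b (\sum_(i <- r | P i) f i).
Proof.
by move=> H; elim/big_rec: _ => [|i X Pi]; [exact: graded0|apply/gradedD/H].
Qed.

Lemma gradedM m n b b' A B : graded m.+1 b A -> graded n.+1 b' B ->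
  graded (m + n).+1 (b + b') (A * B).
Proof.
by move=> [? ?] [? ?]; split; [apply: (ordM (polU_neq0 F N))|apply: parityM].
Qed.

Lemma graded_lsum n b (I : choiceType) (A : set I) f :
    ulocfin wle A f -> (forall i, A i -> graded n b (f i)) ->
  graded n b (lsum A f).
Proof.
move=> uf gf; split.
  apply: (ord_lsum (@shiftJ F N) (polU_neq0 F N) uf) => i Ai.
  by have [] := gf i Ai.
apply: parity_lsum; first exact: (ulocfin_locfin uf).
by move=> i Ai; have [] := gf i Ai.
Qed.

Lemma gradedJ x : graded 2 1 (Jop F x).
Proof. by split; [apply: (ordJ (lieJ charF))|apply/parityJ/ParJ]. Qed.

Lemma graded_Der (v : V) : graded 2 1 (Der F v).
Proof.
case: v => a n; have := gradedZ (oddfact n.+1)%:R^-1 (gradedJ (a, n.+1%:Z)).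
by rewrite /Jop /= scalerA mulVf ?oddfact_neq0 // scale1r.
Qed.

Lemma graded_Var (v : V) : graded 2 1 (Var F v).
Proof.
case: v => a [|n].
  have := gradedJ (a, 0); rewrite /Jop /= /oddfact big_ord0 invr1 scale1r.
  by [].
have := gradedZ (oddfact n.+1)%:R (gradedJ (a, Negz n)).
by rewrite /Jop /= scalerA divff ?oddfact_neq0 // scale1r.
Qed.

Lemma graded_mod2 n b A : graded n b.+2 A -> graded n b A.
Proof. by move=> [? ?]; split=> //; apply: parity_mod2. Qed.

Lemma gradedVV u v : graded 3 0 (Var F u * Var F v).
Proof. exact/graded_mod2/(gradedM (graded_Var u) (graded_Var v)). Qed.
Lemma gradedVD u v : graded 3 0 (Var F u * Der F v).
Proof. exact/graded_mod2/(gradedM (graded_Var u) (graded_Der v)). Qed.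
Lemma gradedDD u v : graded 3 0 (Der F u * Der F v).
Proof. exact/graded_mod2/(gradedM (graded_Der u) (graded_Der v)). Qed.

Lemma deg_ge (a : 'I_N) k : (k <= deg (a, k))%N.
Proof. by rewrite /deg /=; lia. Qed.

Lemma graded_Vir a m : graded 3 0 (Vir F (pair a) m).
Proof.
apply: gradedD; first apply: gradedD.
- by apply: gradedZ; apply: graded_sum => ij _; apply/gradedZ/gradedVV.
- apply: graded_lsum; first exact: (ulocfin_Virmid F (deg_ge a) m).
  move=> k _; apply: gradedZ; case: (k%:Z + m) => n /=; first exact: gradedVD.
  by rewrite mulr0; apply: graded0.
- by apply: gradedZ; apply: graded_sum => ij _; apply/gradedZ/gradedDD.
Qed.

Lemma shift_Vir_deg a m : shift wle (- (2 * m)) (Vir F (pair a) m).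
Proof.
have wE k : deg (a, k) = (1 * (2 * k + 1))%N by rewrite mul1n.
by have := shift_Vir (F := F) (deg_ge a) (m := m) wE; apply: shiftS; lia.
Qed.

Definition Vlie (a : 'I_N) (chi : nat -> F) : endo U :=
  lsum [set k : nat | (1 <= k)%N] (fun k => chi k *: Vir F (pair a) k%:Z).

Lemma ulocfin_Vlie a chi :
  ulocfin wle [set k : nat | (1 <= k)%N] (fun k => chi k *: Vir F (pair a) k%:Z).
Proof.
apply: ulocfin_shift => k _; apply: shiftZ.
by have := @shift_Vir_deg a k; apply: shiftS; lia.
Qed.

Lemma V_genE a chi p : V_gen a chi p = Vlie a chi p.
Proof.
rewrite /Vlie (lsum_fsum _ (ulocfin_locfin (ulocfin_Vlie a chi))).
apply: eq_fsbigr => k _; rewrite endoEZ; congr (_ *: _).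
exact: (virasoroE (deg_ge a)).
Qed.

Lemma graded_Vlie a chi : graded 3 0 (Vlie a chi).
Proof.
apply: graded_lsum; first exact: ulocfin_Vlie.
by move=> k _; apply/gradedZ/graded_Vir.
Qed.

Lemma lowers_Vlie a chi : shift wle (-1) (Vlie a chi).
Proof.
apply: shift_lsum; last exact: (ulocfin_locfin (ulocfin_Vlie a chi)).
by move=> k /= k1; apply: shiftZ; have := @shift_Vir_deg a k; apply: shiftS; lia.
Qed.

Definition Rmid (c : F) (a b : 'I_N) k j : endo U :=
  c *: (Var F (a, j) * Der F (b, (k + j)%N)).

Definition Rpart (r : nat -> 'M[F]_N) k : endo U :=
  \sum_(a < N) \sum_(b < N)
    (lsum [set: nat] (Rmid (r k b a) a b k)
     + 2^-1 *: \sum_(j < k) ((-1) ^+ j.+1 * r k b a) *: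
         (Der F (a, j : nat) * Der F (b, (k - j - 1)%N))).

Definition Rlie (r : nat -> 'M[F]_N) : endo U :=
  lsum [set k : nat | (1 <= k)%N] (Rpart r).

Lemma ulocfin_Rmid c a b k : ulocfin wle [set: nat] (Rmid c a b k).
Proof.
apply: (@ulocfin_nat _ _ _ _ _ id) => d p j dp _ dj; rewrite endoEZ endoEM.
rewrite (shift_eq0 (@shift_Der F V (@deg N) (b, (k + j)%N)) dp) ?endoB0 ?scaler0 //.
by rewrite /deg /=; lia.
Qed.

Lemma shift_Rpart r k : shift wle (- (2 * k%:Z)) (Rpart r k).
Proof.
apply: shift_sum => a _; apply: shift_sum => b _; apply: shiftD.
  apply: shift_lsum; last exact: (ulocfin_locfin (ulocfin_Rmid _ a b k)).
  move=> j _; apply: shiftZ.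
  have := shiftM (@shift_Var F V (@deg N) (a, j)) (@shift_Der F V (@deg N) (b, (k + j)%N)).
  by apply: shiftS; rewrite /deg /=; lia.
apply: shiftZ; apply: shift_sum => j _; apply: shiftZ; have jk := ltn_ord j.
have := shiftM (@shift_Der F V (@deg N) (a, j : nat))
  (@shift_Der F V (@deg N) (b, (k - j - 1)%N)).
by apply: shiftS; rewrite /deg /=; lia.
Qed.

Lemma ulocfin_Rlie r : ulocfin wle [set k : nat | (1 <= k)%N] (Rpart r).
Proof.
by apply: ulocfin_shift => k _; have := @shift_Rpart r k; apply: shiftS; lia.
Qed.

Lemma R_genE r p : R_gen r p = Rlie r p.
Proof.
rewrite /Rlie (lsum_fsum _ (ulocfin_locfin (ulocfin_Rlie r))).
apply: eq_fsbigr => k _; rewrite endoE_sum; apply: eq_bigr => a _.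
rewrite endoE_sum; apply: eq_bigr => b _; rewrite endoED endoEZ; congr (_ + _ *: _).
  rewrite (lsum_fsum _ (ulocfin_locfin (ulocfin_Rmid _ a b k))).
  apply: eq_fsbigr => j _; rewrite endoEZ endoEM VarE; congr (_ *: (_ * _)).
  exact: DerE.
rewrite endoE_sum; apply: eq_bigr => j _; rewrite endoEZ endoEM; congr (_ *: _).
by rewrite DerE; congr (Der _ _ _); exact: DerE.
Qed.

Lemma graded_Rlie r : graded 3 0 (Rlie r).
Proof.
apply: graded_lsum; first exact: ulocfin_Rlie.
move=> k _; apply: graded_sum => a _; apply: graded_sum => b _; apply: gradedD.
  apply: graded_lsum; first exact: ulocfin_Rmid.
  by move=> j _; apply/gradedZ/gradedVD.
by apply: gradedZ; apply: graded_sum => j _; apply/gradedZ/gradedDD.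
Qed.

Lemma lowers_Rlie r : shift wle (-1) (Rlie r).
Proof.
apply: shift_lsum; last exact: (ulocfin_locfin (ulocfin_Rlie r)).
by move=> k /= k1; have := @shift_Rpart r k; apply: shiftS; lia.
Qed.

Definition Wpart (al : nat) (a : 'I_N) (k : nat) : endo U :=
  (oddfact k)%:R^-1 *: (Var F (a, k) *
     (Vir F (pair a) (k%:Z - al%:Z) + ((k == al)%:R / 8) *: (1 : endo U))).

Definition Wlie (alpha : 'I_N -> nat) (s : 'I_N -> F) : endo U :=
  \sum_(a < N) (s a / (2 * alpha a + 1)%:R) *: lsum [set: nat] (Wpart (alpha a) a).

Lemma ulocfin_Wpart al a : ulocfin wle [set: nat] (Wpart al a).
Proof.
apply: (@ulocfin_nat _ _ _ _ _ (fun d => d + al + 1)%N) => d p k dp _ dk.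
rewrite endoEZ endoEM endoED endoEZ endoE1 (_ : (k == al) = false); last by lia.
rewrite mul0r scale0r addr0 (shift_eq0 (@shift_Vir_deg a (k%:Z - al%:Z)) dp).
  by rewrite endoB0 scaler0.
by lia.
Qed.

(** The degree of T_k L_(k - al) is (2k + 1) - 2 (k - al), which does not depend on k. It is at most
    3 since al <= 1. *)
Lemma shift_Wpart al a k : shift wle (2 * al + 1)%N%:Z (Wpart al a k).
Proof.
apply: shiftZ; rewrite mulrDr; apply: shiftD.
  have := shiftM (@shift_Var F V (@deg N) (a, k)) (@shift_Vir_deg a (k%:Z - al%:Z)).
  by apply: shiftS; rewrite /deg /=; lia.
case: eqP => [->|_]; last by rewrite mul0r scale0r mulr0; apply: shift0.
rewrite -endo_scaleAr mulr1; apply: shiftZ.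
by have := @shift_Var F V (@deg N) (a, al); apply: shiftS; rewrite /deg.
Qed.

Lemma W_DeltaE alpha s p : W_Delta alpha s p = Wlie alpha s p.
Proof.
rewrite endoE_sum; apply: eq_bigr => a _; rewrite endoEZ; congr (_ *: _).
rewrite (lsum_fsum _ (ulocfin_locfin (ulocfin_Wpart (alpha a) a))).
apply: eq_fsbigr => k _; rewrite endoEZ endoEM VarE endoED endoEZ endoE1.
by congr (_ *: (_ * (_ + _))); exact: (virasoroE (deg_ge a)).
Qed.

Lemma graded_Wlie alpha s : graded 4 1 (Wlie alpha s).
Proof.
apply: graded_sum => a _; apply: gradedZ.
apply: graded_lsum; first exact: ulocfin_Wpart.
move=> k _; apply: gradedZ; apply: (gradedM (graded_Var _)) (_ : graded 3 0 _).
apply: gradedD; first exact: graded_Vir.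
split; last exact/parityZ/parity1.
by apply/ordS/ordS/scalar_ord.
Qed.

Lemma shift_Wlie alpha s : (forall a, alpha a <= 1)%N ->
  shift wle 3 (Wlie alpha s).
Proof.
move=> al1; apply: shift_sum => a _; apply: shiftZ.
apply: shift_lsum; last exact: (ulocfin_locfin (ulocfin_Wpart (alpha a) a)).
by move=> k _; have := @shift_Wpart (alpha a) a k; apply: shiftS; have := al1 a; lia.
Qed.

Lemma conj_cubic D W : shift wle (-1) D -> graded 3 0 D ->
    shift wle 3 W -> graded 4 1 W ->
  shift wle 3 (eexp D * W * eexp (- D)) /\ graded 4 1 (eexp D * W * eexp (- D)).
Proof.
move=> lD [oD pD] sW [oW pW]; split; first exact: shift_conj.
split.
  exact: (ord_conj charF (@shiftJ F N) (scalarJ charF) (polU_neq0 F N) lD sW oD oW).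
have pN : parity (Par F V) 0 (- D) by rewrite -scaleN1r; apply: parityZ.
have := parityM (parityM (parity_exp lD pD) pW) (parity_exp (lowersN lD) pN).
by rewrite addn0.
Qed.

End Operators.

(** * Composition and inversion of the exponentials *)

Section Commutation.
Context (F : fieldType) (U : lmodType F).
Implicit Types A B : endo U.

Lemma commZ A B c : GRing.comm A B -> GRing.comm A (c *: B).
Proof. by rewrite /GRing.comm -endo_scaleAr -endo_scaleAl => ->. Qed.

Lemma comm_sum A I (r : seq I) (P : pred I) (f : I -> endo U) :
  (forall i, P i -> GRing.comm A (f i)) -> GRing.comm A (\sum_(i <- r | P i) f i).
Proof.
by move=> H; elim/big_rec: _ => [|i X Pi]; [exact: commr0|apply/commrD/H].
Qed.

Lemma comm_lsum A (I : choiceType) (S : set I) (f : I -> endo U) : locfin S f ->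
  (forall i, S i -> GRing.comm A (f i)) -> GRing.comm A (lsum S f).
Proof.
move=> lf cf; apply: endoP => p; rewrite !endoEM.
have [s1 _ H1] := lf p; have [s2 _ H2] := lf (A p).
pose s := undup (s1 ++ s2).
have sub i : i \notin s -> i \notin s1 /\ i \notin s2.
  by rewrite mem_undup mem_cat negb_or => /andP.
rewrite !(lsumE (s := s) lf) ?undup_uniq //.
- rewrite endo_sum; apply: eq_bigr => i; rewrite inE => Si.
  by rewrite -!endoEM (cf i Si).
- by move=> i Si /sub[_ ?]; apply: H2.
- by move=> i Si /sub[? _]; apply: H1.
Qed.

Lemma opinvE' (D : U -> U) (A B : endo U) p :
  D =1 A -> A * B = 1 -> B * A = 1 -> 'pinv_(fun=> 0) [set: U] D p = B p.
Proof.
move=> DA AB BA; have -> : p = D (B p) by rewrite DA -endoEM AB endoE1.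
rewrite pinvKV ?inE // => [|x y _ _]; last first.
  by rewrite !DA => /(congr1 B); rewrite -!endoEM BA !endoE1.
by rewrite DA -[A (B p)]endoEM AB endoE1.
Qed.

End Commutation.

Section Conjugation.
Context (F : fieldType) (N : nat).
Hypothesis charF : forall n, n.+1%:R != 0 :> F.
Local Notation V := ('I_N * nat)%type.
Local Notation U := (pol F V).
Local Notation wle := (wfil F (@deg N)).

Lemma comm_Vir (A : endo U) (b : 'I_N) m :
    (forall j, GRing.comm A (Var F (b, j))) ->
    (forall j, GRing.comm A (Der F (b, j))) ->
  GRing.comm A (Vir F (pair b) m).
Proof.
move=> AV AD; apply: commrD; first apply: commrD.
- apply/commZ/comm_sum => ij _; apply: commZ; apply: commrM; exact: AV.
- apply: comm_lsum; first exact: (ulocfin_locfin (ulocfin_Virmid F (deg_ge b) m)).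
  move=> j _; apply: commZ; apply: commrM; first exact: AV.
  by case: (j%:Z + m) => n /=; [exact: AD|exact: commr0].
- apply/commZ/comm_sum => ij _; apply: commZ; apply: commrM; exact: AD.
Qed.

Lemma comm_Vlie_gen (A : endo U) (b : 'I_N) chi :
    (forall j, GRing.comm A (Var F (b, j))) ->
    (forall j, GRing.comm A (Der F (b, j))) ->
  GRing.comm A (Vlie b chi).
Proof.
move=> AV AD; apply: comm_lsum; first exact: (ulocfin_locfin (ulocfin_Vlie b chi)).
by move=> k _; apply/commZ/comm_Vir.
Qed.

Lemma comm_Vlie (a b : 'I_N) chi chi' : a != b ->
  GRing.comm (Vlie (F := F) a chi) (Vlie b chi').
Proof.
move=> ab; have nab i j : ((a, i) == (b, j)) = false by rewrite xpair_eqE (negPf ab).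
have nba i j : ((b, i) == (a, j)) = false by rewrite xpair_eqE eq_sym (negPf ab).
apply: comm_Vlie_gen => j; apply/commr_sym/comm_Vlie_gen => i.
- exact: VarC.
- by rewrite /GRing.comm Der_Var nab scale0r add0r.
- by rewrite /GRing.comm Der_Var nba scale0r add0r.
- exact: DerC.
Qed.

Definition Vtot (chi : 'I_N -> nat -> F) : endo U := \sum_(a < N) Vlie a (chi a).

Lemma lowers_Vtot chi : shift wle (-1) (Vtot chi).
Proof. by apply: shift_sum => a _; apply: lowers_Vlie. Qed.

Lemma graded_Vtot chi : graded 3 0 (Vtot chi).
Proof. by apply: graded_sum => a _; apply: graded_Vlie. Qed.

Lemma expop_eexp (D : U -> U) (A : endo U) p : D =1 A -> shift wle (-1) A ->
  expop D p = eexp A p.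
Proof.
move=> DA lA; rewrite -(expopE p lA); apply: eq_fsbigr => n _; congr (_ *: _).
by elim: n => //= n ->; rewrite DA.
Qed.

(** Distinct families share no variables, so the factors commute and [V_hat] is a single
    exponential, whose inverse is the exponential of the opposite. *)
Lemma V_hatE chi p : V_hat chi p = eexp (Vtot chi) p.
Proof.
rewrite /V_hat /Vtot; have := index_enum_uniq 'I_N; move: (index_enum _) p => r.
elim: r => [|a r IH] p /=; first by rewrite !big_nil (eexp0 wle) endoE1.
case/andP => ar ur; rewrite !big_cons /= IH //.
apply: (etrans (expop_eexp _ (V_genE a (chi a)) (@lowers_Vlie F N a (chi a)))).
rewrite -endoEM (eexpD charF (@lowers_Vlie F N a (chi a))) //.
  by apply: shift_sum => b _; apply: lowers_Vlie.
rewrite big_seq; apply: comm_sum => b br; apply: comm_Vlie.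
by apply: contraNneq ar => ->.
Qed.

Lemma R_hatE (r : nat -> 'M[F]_N) p : R_hat r p = eexp (Rlie r) p.
Proof. exact: expop_eexp (R_genE r) (@lowers_Rlie F N r). Qed.

Definition Wend (alpha : 'I_N -> nat) s r chi : endo U :=
  eexp (Rlie r) * (eexp (Vtot chi) * Wlie alpha s * eexp (- Vtot chi))
    * eexp (- Rlie r).

Lemma W_hatE alpha s r chi p : W_hat alpha s r chi p = Wend alpha s r chi p.
Proof.
have lR := @lowers_Rlie F N r; have lV := @lowers_Vtot chi.
have oR q : opinv (R_hat r) q = eexp (- Rlie r) q.
  exact: (opinvE' q (R_hatE r) (eexpK charF lR) (eexpNK charF lR)).
have oV q : opinv (V_hat chi) q = eexp (- Vtot chi) q.
  exact: (opinvE' q (V_hatE chi) (eexpK charF lV) (eexpNK charF lV)).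
rewrite /Wend !endoEM -oR -oV.
apply: (etrans (R_hatE r _)); congr (eexp _ _).
apply: (etrans (V_hatE chi _)); congr (eexp _ _).
exact: W_DeltaE.
Qed.

Lemma W_hat_cubic (alpha : 'I_N -> nat) (s : 'I_N -> F) r chi :
    (forall a, alpha a <= 1)%N ->
  exists A B, forall p : U, W_hat alpha s r chi p = cubic_form A B p.
Proof.
move=> al1.
have [sV gV] := conj_cubic charF (@lowers_Vtot chi) (graded_Vtot chi)
  (@shift_Wlie F N alpha s al1) (graded_Wlie charF alpha s).
have [sW [oW pW]] := conj_cubic charF (@lowers_Rlie F N r) (graded_Rlie charF r) sV gV.
have [A [B AB]] := cubic_form_exists charF sW oW pW.
by exists A, B => p; rewrite W_hatE AB.
Qed.

End Conjugation.

(** * Virasoro constraints for the product of tau-functions *)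

Lemma clear_halves (F : fieldType) (W : lmodType F) (A B C : W) (c d : F) :
    (forall n, n.+1%:R != 0 :> F) ->
    2^-1 *: A - (c / 2) *: C + (d / 16) *: B = 0 ->
  A + (d / 8) *: B = c *: C.
Proof.
move=> charF; have two0 : 2 != 0 :> F := charF 1.
have c16 : 16 != 0 :> F := charF 15; have c8 : 8 != 0 :> F := charF 7.
move=> /(congr1 ( *:%R 2)); rewrite scaler0 scalerDr scalerBr !scalerA.
rewrite mulfV // scale1r mulrCA mulfV // mulr1 => /eqP.
rewrite addrAC subr_eq0 => /eqP <-; congr (_ + _ *: _).
by field; rewrite c16 c8.
Qed.

Lemma rescale_eq (F : fieldType) (W : lmodType F) (A B : endo W) (q q' : W)
    (c d s : F) n :
    A q + d *: q = c *: B q' ->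
  s *: (A (s ^+ n *: q) + d *: (s ^+ n *: q)) = c *: B (s ^+ n.+1 *: q').
Proof.
move=> E; rewrite !endo_scale scalerA (mulrC d) -scalerA -scalerDr E !scalerA.
by rewrite -exprS mulrC.
Qed.

Lemma ps_mulC (A : comNzRingType) (f g : nat -> A) : ps_mul f g = ps_mul g f.
Proof.
apply/funext => n; rewrite /ps_mul (reindex_inj rev_ord_inj); apply: eq_bigr => i _.
by rewrite /= subSS mulrC subKn // -ltnS.
Qed.

Section Tau.
Context (F : fieldType) (N : nat).
Hypothesis charF : forall n, n.+1%:R != 0 :> F.
Local Notation V := ('I_N * nat)%type.
Local Notation U := (pol F V).

Section RenameVirasoro.
Context (a : 'I_N).
Local Notation rn := (@ren F nat V (pair a)).

Lemma ren_scale c p : rn (c *: p) = c *: rn p.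
Proof. by rewrite -[c *: p]addr0 ren_lin ren0 addr0. Qed.

Lemma ren_add p q : rn (p + q) = rn p + rn q.
Proof. by rewrite -[p]scale1r ren_lin !scale1r. Qed.

Lemma ren_sum I (r : seq I) (P : pred I) (f : I -> pol F nat) :
  rn (\sum_(i <- r | P i) f i) = \sum_(i <- r | P i) rn (f i).
Proof.
apply: (big_morph rn) => [p q|]; [exact: ren_add|exact: ren0].
Qed.

Lemma ren_Derz k p : rn (Derz F id k p) = Derz F (pair a) k (rn p).
Proof.
case: k => n /=; last by rewrite !endoE0 ren0.
by apply: ren_Der => i j [].
Qed.

Lemma ren_Vir m p : rn (Vir F id m p) = Vir F (pair a) m (rn p).
Proof.
rewrite /Vir !endoED !endoEZ !endoE_sum.
have le_id k : (k <= id k)%N by [].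
have lf1 := ulocfin_locfin (@ulocfin_Virmid F nat id id le_id m).
have lf2 := ulocfin_locfin (ulocfin_Virmid F (deg_ge a) m).
have [s1 _ H1] := lf1 p; have [s2 _ H2] := lf2 (rn p).
pose s := undup (s1 ++ s2).
have sub i : i \notin s -> i \notin s1 /\ i \notin s2.
  by rewrite mem_undup mem_cat negb_or => /andP.
have us : uniq s := undup_uniq _.
rewrite (lsumE lf1 us (fun i Ai ni => H1 i Ai (proj1 (sub i ni)))).
rewrite (lsumE lf2 us (fun i Ai ni => H2 i Ai (proj2 (sub i ni)))).
apply: (etrans (ren_add _ _)); apply: (congr2 +%R).
  apply: (etrans (ren_add _ _)); apply: (congr2 +%R).
    apply: (etrans (ren_scale _ _)); apply: (congr1 ( *:%R _)).
    apply: (etrans (ren_sum _ _ _)); apply: eq_bigr => ij _.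
    rewrite endoEZ endoEM [LHS]ren_scale [X in _ *: X = _]ren_Var.
    by rewrite [X in _ *: Var _ _ X]ren_Var endoEZ endoEM.
  apply: (etrans (ren_sum _ _ _)); apply: eq_bigr => k _.
  rewrite /Virmid endoEZ endoEM [LHS]ren_scale [X in _ *: X = _]ren_Var.
  by rewrite ren_Derz endoEZ endoEM.
apply: (etrans (ren_scale _ _)); apply: (congr1 ( *:%R _)).
apply: (etrans (ren_sum _ _ _)); apply: eq_bigr => ij _.
have pI : injective (@pair 'I_N nat a) by move=> i j [].
rewrite endoEZ endoEM [LHS]ren_scale [X in _ *: X = _]ren_Der //.
by rewrite [X in _ *: Der _ _ X]ren_Der // endoEZ endoEM.
Qed.

End RenameVirasoro.

(* The Virasoro constraints in the family T^a, rescaled by hbar -> s hbar and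
   multiplied by 2 s hbar. *)
Definition constrained (a : 'I_N) (al : nat) (s : F) (G : nat -> U) :=
  (forall j, Der F (a, j) (G 0%N) = 0) /\
  (forall j n, s *: (Vir F (pair a) (j%:Z - al%:Z) (G n) + ((j == al)%:R / 8) *: G n)
     = (oddfact j.+1)%:R *: Der F (a, j) (G n.+1)).

Definition free_of (a : 'I_N) (G : nat -> U) := forall j n, Der F (a, j) (G n) = 0.

Lemma tau_constrained al (t : nat -> pol F nat) (s : F) a :
    is_tau al t ->
  constrained a al s (fun n => s ^+ n *: rename (pair a) (t n)).
Proof.
move=> [_ H].
have le_id k : (k <= id k)%N by [].
(* Setting k = j - al lets j run over all natural numbers, exactly as k runs over k >= -al. *)
have key j e : Vir F id (j%:Z - al%:Z) (laurent t e)
    + ((j == al)%:R / 8) *: laurent t e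
    = (oddfact j.+1)%:R *: Der F j (laurent t (e + 1)).
  have le_al : - al%:Z <= j%:Z - al%:Z by lia.
  have := H _ le_al e; rewrite (subrK al%:Z j%:Z).
  rewrite (@virasoroE F nat id id le_id) -[pderivz _ _ _]/(pderiv j _) DerE.
  rewrite (_ : (j%:Z - al%:Z == 0) = (j == al)); last by lia.
  rewrite (_ : absz (j%:Z + 1) = j.+1); last by lia.
  exact: clear_halves.
split=> [j|j n].
  rewrite endo_scale renE -[Der F (a, j) _]/(Der F (pair a j) _) -ren_Der; last first.
    by move=> i k [].
  (* The coefficient of hbar^(-1): only the derivative of t 0 survives, as [laurent] vanishes at
     negative exponents. *)
  have := key j (-1); rewrite addNr /= endoB0 scaler0 addr0 => /esym/eqP.
  by rewrite scaler_eq0 (negPf (oddfact_neq0 charF _)) => /eqP ->; rewrite ren0 scaler0.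
apply: rescale_eq; rewrite !renE -ren_Vir.
rewrite -[Der F (a, j) _]/(Der F (pair a j) _) -(@ren_Der _ _ _ (pair a)); last first.
  by move=> i k [].
apply: (etrans _ (ren_scale _ _ _)).
apply: (etrans (etrans (congr2 +%R (erefl _) (esym (ren_scale _ _ _)))
  (esym (ren_add _ _ _)))).
by have := key j n%:Z; rewrite (_ : n%:Z + 1 = n.+1%:Z) /=; [move=> ->|lia].
Qed.

Lemma tau_free (t : nat -> pol F nat) (s : F) (a b : 'I_N) : a != b ->
  free_of b (fun n => s ^+ n *: rename (pair a) (t n)).
Proof.
move=> ab j n; rewrite endo_scale renE Der_ren_out ?scaler0 // => k [ba _].
by rewrite ba eqxx in ab.
Qed.

Lemma Vir_mul (a : 'I_N) m (p q : U) : (forall j, Der F (a, j) q = 0) ->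
  Vir F (pair a) m (p * q) = Vir F (pair a) m p * q.
Proof.
move=> q0; have C : GRing.comm (Mul q) (Vir F (pair a) m).
  apply: comm_Vir => j.
    apply: endoP => r; rewrite !endoEM !MulE !VarE; exact: mulrCA.
  by rewrite /GRing.comm Der_Mul q0 -[X in X + _](_ : 0 = _) ?add0r //;
    apply: endoP => r; rewrite endoE0 MulE mul0r.
have /(congr1 (fun A : endo U => A p)) := C; rewrite !endoEM !MulE.
by rewrite (mulrC q p) (mulrC q _) => ->.
Qed.

Lemma ps_mul_const (f g : nat -> U) :
    (forall n, coef mone (f n) = (n == 0%N)%:R) ->
    (forall n, coef mone (g n) = (n == 0%N)%:R) ->
  forall n, coef mone (ps_mul f g n) = (n == 0%N)%:R.
Proof.
move=> f0 g0 n; rewrite /ps_mul coef_sump big_ord_recl big1 => [|i _].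
  by rewrite coef_mone f0 g0 mul1r subn0 addr0.
by rewrite coef_mone f0 mul0r.
Qed.

Lemma ps_mul_free a (f g : nat -> U) : free_of a f -> free_of a g ->
  free_of a (ps_mul f g).
Proof.
move=> f0 g0 j n; rewrite /ps_mul endo_sum big1 // => i _.
by rewrite DerM f0 g0 mul0r mulr0 addr0.
Qed.

Lemma ps_mul_constrainedl a al s (f g : nat -> U) :
  constrained a al s f -> free_of a g -> constrained a al s (ps_mul f g).
Proof.
move=> [f0 fS] g0; split=> [j|j n]; rewrite /ps_mul.
  by rewrite big_ord_recl big_ord0 addr0 DerM f0 g0 mul0r mulr0 addr0.
rewrite endo_sum scaler_sumr -big_split scaler_sumr /=.
rewrite [in RHS]big_ord_recl [in RHS]endo_additive DerM f0 g0 mul0r mulr0 !add0r.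
rewrite endo_sum scaler_sumr; apply: eq_bigr => i _.
rewrite DerM g0 mulr0 addr0 Vir_mul; last by move=> k; apply: g0.
by rewrite scalerAl -mulrDl scalerAl fS -scalerAl.
Qed.

Lemma ps_mul_constrainedr a al s (f g : nat -> U) :
  free_of a f -> constrained a al s g -> constrained a al s (ps_mul f g).
Proof. by move=> f0 g0; rewrite ps_mulC; apply: ps_mul_constrainedl. Qed.

Context (alpha : 'I_N -> nat) (s : 'I_N -> F) (tau : 'I_N -> nat -> pol F nat).
Hypothesis tauP : forall a, is_tau (alpha a) (tau a).

Local Notation G := (Delta_hat s tau).

Lemma Delta_hat_props :
  (forall n, coef mone (G n) = (n == 0%N)%:R) /\
  (forall a, constrained a (alpha a) (s a) G).
Proof.
(* Strengthened for an induction on the list of families: a partial product satisfies the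
   constraints of its own families and is free of the variables of the others. *)
have [] : (forall n, coef mone (G n) = (n == 0%N)%:R) /\
    (forall a, if a \in index_enum 'I_N then constrained a (alpha a) (s a) G
               else free_of a G); last first.
  move=> G0 GC; split=> [n|a]; first exact: G0.
  by have := GC a; rewrite mem_index_enum; apply.
rewrite /Delta_hat; have := index_enum_uniq 'I_N; elim: (index_enum _) => [_|a r IH].
  rewrite big_nil; split=> [n|a j n]; rewrite /ps_one.
    by case: n => [|n]; rewrite ?coefU ?eqxx ?coef0p.
  by case: n => [|n]; rewrite ?Der1 ?endoB0.
case/andP => ar ur; have {IH}[G0 GC] := IH ur; rewrite big_cons; split.
  apply: ps_mul_const G0 => n; rewrite coef_scale renE coef_mone_ren coefE.
  by rewrite (tauP a).1; case: n => [|n]; rewrite ?mulr0 // expr0 mul1r.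
move=> b; have := GC b; rewrite inE; case: (eqVneq b a) => [->|ba] /=.
  rewrite (negPf ar) => fa; apply: ps_mul_constrainedl fa.
  exact: tau_constrained.
case: ifP => _ H.
  by apply: ps_mul_constrainedr H; apply: tau_free; rewrite // eq_sym.
by apply: ps_mul_free H; apply: tau_free; rewrite // eq_sym.
Qed.

End Tau.

(** * Homogeneity *)

Section LieSums.
Context (F : fieldType) (U : lmodType F) (I : choiceType).
Implicit Types (A B C : endo U) (S : set I) (f : I -> endo U).

Lemma lsum_eq S f g p q : locfin S f -> locfin S g ->
  (forall i, S i -> f i p = g i q) -> lsum S f p = lsum S g q.
Proof.
move=> lf lg fg; rewrite !lsum_fsum //; apply: eq_fsbigr => i; rewrite inE.
exact: fg.
Qed.

(** s0 lets a caller force a distinguished index into the finite window. *)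
Lemma lie_lsum S f B p (s0 : seq I) : locfin S f ->
  exists s : seq I, [/\ uniq s, {subset s0 <= s},
    lie (lsum S f) B p = \sum_(i <- s | i \in S) lie (f i) B p &
    forall i, S i -> i \notin s -> f i p = 0].
Proof.
move=> lf; have [s1 _ H1] := lf p; have [s2 _ H2] := lf (B p).
pose s := undup (s1 ++ s2 ++ s0).
have sub i : i \notin s -> i \notin s1 /\ i \notin s2.
  by rewrite mem_undup !mem_cat !negb_or => /and3P[].
have us : uniq s := undup_uniq _.
exists s; split=> // [i is0||i Si /sub[? _]]; last exact: H1.
  by rewrite mem_undup !mem_cat is0 !orbT.
rewrite lieE (lsumE lf us (fun i Ai ni => H1 i Ai (proj1 (sub i ni)))).
rewrite (lsumE lf us (fun i Ai ni => H2 i Ai (proj2 (sub i ni)))).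
by rewrite endo_sum -sumrB; apply: eq_bigr => i _; rewrite lieE.
Qed.

Lemma lie_lsum_single f B C i0 : locfin [set: I] f ->
    (forall i, lie (f i) B = (i == i0)%:R *: C) ->
  lie (lsum [set: I] f) B = C.
Proof.
move=> lf H; apply: endoP => p.
have [s [us s0 -> _]] := lie_lsum B p [:: i0] lf.
rewrite (eq_bigl xpredT); last by move=> i; rewrite in_setT.
rewrite (bigD1_seq i0) ?s0 ?mem_head //= H eqxx scale1r big1 ?addr0 // => i i0i.
by rewrite H (negPf i0i) scale0r endoE0.
Qed.

Lemma lie_lsum_eig S f B c : locfin S f ->
  (forall i, S i -> lie (f i) B = c *: f i) -> lie (lsum S f) B = c *: lsum S f.
Proof.
move=> lf H; apply: endoP => p; have [s [us _ -> fs]] := lie_lsum B p [::] lf.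
rewrite endoEZ (lsumE lf us fs) scaler_sumr; apply: eq_bigr => i; rewrite inE => Si.
by rewrite H // endoEZ.
Qed.

Lemma lie_suml J (r : seq J) (P : pred J) (f : J -> endo U) B :
  lie (\sum_(j <- r | P j) f j) B = \sum_(j <- r | P j) lie (f j) B.
Proof.
exact: (big_morph (fun A => lie A B) (fun A C => lieDl A C B) (lie0l B)).
Qed.

End LieSums.

Lemma eigen_step (F : fieldType) (W : lmodType F) (A B : endo W) (c d : F) q :
  A * B = B * A + c *: B -> A q = d *: q -> A (B q) = (d + c) *: B q.
Proof.
move=> AB Aq; rewrite -endoEM AB endoED endoEZ endoEM Aq endo_scale.
by rewrite scalerDl.
Qed.

Lemma eigen_scale (F : fieldType) (W : lmodType F) (A : endo W) (c d : F) q :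
  A q = d *: q -> A (c *: q) = d *: (c *: q).
Proof. by move=> Aq; rewrite endo_scale Aq !scalerA mulrC. Qed.

Section Homogeneity.
Context (F : fieldType) (N : nat).
Hypothesis charF : forall n, n.+1%:R != 0 :> F.
Local Notation V := ('I_N * nat)%type.
Local Notation U := (pol F V).
Context (alpha : 'I_N -> nat).
Hypothesis alpha_le1 : forall a, (alpha a <= 1)%N.

(* Rescaled weight, for which the coefficient of hbar^n in every tau_alpha is
   homogeneous of degree 3n. *)
Definition scale3 (a : 'I_N) : nat := if alpha a == 0%N then 3 else 1.
Definition deg3 (v : V) : nat := (scale3 v.1 * (2 * v.2 + 1))%N.

Lemma scale3E a : (scale3 a * (2 * alpha a + 1) = 3)%N.
Proof. by rewrite /scale3; have := alpha_le1 a; case: (alpha a) => [|[|]]. Qed.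

Lemma scale3_gt0 a : (0 < scale3 a)%N.
Proof. by rewrite /scale3; case: ifP. Qed.

Lemma deg3_ge a k : (k <= deg3 (a, k))%N.
Proof. by rewrite /deg3 /=; have := scale3_gt0 a; nia. Qed.

Definition Epart (a : 'I_N) (k : nat) : endo U :=
  (deg3 (a, k))%:R *: (Var F (a, k) * Der F (a, k)).
Definition Euler : endo U := \sum_(a < N) lsum [set: nat] (Epart a).

Lemma locfin_Epart a : locfin [set: nat] (Epart a).
Proof.
apply: (@ulocfin_locfin _ _ (wfil F (@deg N))).
apply: (@ulocfin_nat _ _ _ _ _ id) => d p k dp _ dk; rewrite endoEZ endoEM.
rewrite (shift_eq0 (@shift_Der F V (@deg N) (a, k)) dp) ?endoB0 ?scaler0 //.
by rewrite /deg /=; lia.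
Qed.

(** That is, [Euler, A] = c A: A is homogeneous of degree exactly c, whereas [shift] only bounds the
    degree. *)
Definition eigen (c : int) (A : endo U) := lie A Euler = - c%:~R *: A.

Lemma eigenE c A : eigen c A -> Euler * A = A * Euler + c%:~R *: A.
Proof.
rewrite /eigen /lie => /eqP; rewrite subr_eq => /eqP ->.
by rewrite scaleNr addrAC addNr add0r.
Qed.

Lemma eigenM c c' A B : eigen c A -> eigen c' B -> eigen (c + c') (A * B).
Proof.
rewrite /eigen => eA eB; rewrite lieMl eA eB -endo_scaleAl -endo_scaleAr -scalerDl.
by rewrite rmorphD opprD addrC.
Qed.

Lemma eigenD c A B : eigen c A -> eigen c B -> eigen c (A + B).
Proof. by rewrite /eigen => eA eB; rewrite lieDl eA eB scalerDr. Qed.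

Lemma eigen0 c : eigen c 0.
Proof. by rewrite /eigen lie0l scaler0. Qed.

Lemma eigenZ c a A : eigen c A -> eigen c (a *: A).
Proof. by rewrite /eigen => eA; rewrite lieZl eA !scalerA mulrC. Qed.

Lemma eigen_sum c I (r : seq I) (P : pred I) f :
  (forall i, P i -> eigen c (f i)) -> eigen c (\sum_(i <- r | P i) f i).
Proof.
by move=> H; elim/big_rec: _ => [|i X Pi]; [exact: eigen0|apply/eigenD/H].
Qed.

Lemma eigen_lsum c (I : choiceType) (S : set I) f : locfin S f ->
  (forall i, S i -> eigen c (f i)) -> eigen c (lsum S f).
Proof. exact: lie_lsum_eig. Qed.

Lemma eigenS c c' A : c = c' -> eigen c A -> eigen c' A.
Proof. by move=> ->. Qed.

Lemma lie_Epart a k B :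
  lie (Epart a k) B = (deg3 (a, k))%:R *:
    (Var F (a, k) * lie (Der F (a, k)) B + lie (Var F (a, k)) B * Der F (a, k)).
Proof. by rewrite lieZl lieMl. Qed.

Lemma lie_Euler (b : 'I_N) j B C :
    (forall a k, lie (Epart a k) B = ((a == b) && (k == j))%:R *: C) ->
  lie B Euler = - C.
Proof.
move=> H; rewrite lieC; congr (- _); rewrite lie_suml (bigD1 b) //= big1 => [|a ab].
  rewrite addr0; apply: (lie_lsum_single (i0 := j)); first exact: locfin_Epart.
  by move=> k; rewrite H eqxx.
rewrite (lie_lsum_eig (c := 0)) ?scale0r //; first exact: locfin_Epart.
by move=> k _; rewrite H (negPf ab) !scale0r.
Qed.

Lemma eigen_Var v : eigen (deg3 v) (Var F v).
Proof.
case: v => b j; rewrite /eigen scaleNr; apply: (lie_Euler (b := b) (j := j)) => a k.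
rewrite lie_Epart lieDV lieVV mul0r addr0 xpair_eqE -endo_scaleAr mulr1 !scalerA mulrC.
by case: eqP => [->|]; case: eqP => [->|]; rewrite ?mul0r ?scale0r.
Qed.

Lemma eigen_Der v : eigen (- (deg3 v)%:Z) (Der F v).
Proof.
case: v => b j; rewrite /eigen rmorphN opprK -[X in _ = X]opprK -scaleNr.
apply: (lie_Euler (b := b) (j := j)) => a k.
rewrite lie_Epart lieDD mulr0 add0r lieVD xpair_eqE -endo_scaleAl mul1r.
rewrite !scalerA eq_sym (eq_sym j) mulrN mulrC -mulrN.
by case: eqP => [->|]; case: eqP => [->|]; rewrite ?mul0r ?scale0r.
Qed.

Lemma eigen_Vir a m : eigen (- (2 * (scale3 a)%:Z * m)) (Vir F (pair a) m).
Proof.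
apply: eigenD; first apply: eigenD.
- apply: eigenZ; apply: eigen_sum => -[i j]; rewrite inE /= => H; apply: eigenZ.
  apply: eigenS (eigenM (eigen_Var (a, i)) (eigen_Var (a, j))).
  by rewrite /deg3 /=; nia.
- apply: eigen_lsum; first exact: (ulocfin_locfin (ulocfin_Virmid F (deg_ge a) m)).
  move=> k _; apply: eigenZ; case E: (k%:Z + m) => [n|n] /=; last first.
    by rewrite mulr0; apply: eigen0.
  apply: eigenS (eigenM (eigen_Var (a, k)) (eigen_Der (a, n))).
  by rewrite /deg3 /=; nia.
- apply: eigenZ; apply: eigen_sum => -[i j]; rewrite inE /= => H; apply: eigenZ.
  apply: eigenS (eigenM (eigen_Der (a, i)) (eigen_Der (a, j))).
  by rewrite /deg3 /=; nia.
Qed.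

Lemma eigen_Wlie s : eigen 3 (Wlie alpha s).
Proof.
apply: eigen_sum => a _; apply: eigenZ; apply: eigen_lsum.
  exact: (ulocfin_locfin (ulocfin_Wpart F (alpha a) a)).
move=> k _; apply: eigenZ; have s3 := scale3E a; rewrite mulrDr; apply: eigenD.
  apply: eigenS (eigenM (eigen_Var (a, k)) (eigen_Vir a _)).
  by rewrite /deg3 /=; nia.
rewrite -endo_scaleAr mulr1; case: eqP => [->|_]; last first.
  by rewrite mul0r scale0r; apply: eigen0.
by apply: eigenZ; apply: eigenS (eigen_Var _); rewrite /deg3 s3.
Qed.

Lemma coef_Euler m p : coef m (Euler p) = (wt deg3 m)%:R * coef m p.
Proof.
elim/pol_mon_ind: p m => [c p q Hp Hq m|k m].
  by rewrite endo_lin !coef_lin Hp Hq mulrDr mulrCA.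
suff -> : Euler << k >> = (wt deg3 k)%:R *: << k >>.
  by rewrite coef_scale coefU; case: eqP => [->|]; rewrite ?mulr0n ?mulr0.
elim/mon_ind: k => [|v k IH].
  rewrite wt1 scale0r endoE_sum big1 // => a _.
  rewrite (lsumE (s := [::]) (@locfin_Epart a)) ?big_nil // => j _ _.
  rewrite endoEZ endoEM (_ : Der _ _ _ = 0) ?endoB0 ?scaler0 //.
  exact: Der1.
by rewrite wtM wtU addnC natrD -Var_mon; apply: eigen_step (eigenE (eigen_Var v)) IH.
Qed.

End Homogeneity.

(** * The product of tau-functions as an exponential *)

(** Applied with o = (2k-1)!!, o' = 2k+1, c / d = 3 / (2 alpha_a + 1), w the rescaled weight of
    T^a_k and A the multiplication by T^a_k: it exchanges a term of the Euler operator for a term of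
    3 W_Delta. *)
Lemma constraint_step (F : fieldType) (W : lmodType F) (A : endo W) (X Y : W)
    (s w c d o o' : F) :
    o != 0 -> w = c / d * o' -> s *: X = (o * o') *: Y ->
  w *: A Y = (c * (s / d)) *: (o^-1 *: A X).
Proof.
move=> o0 -> XY; rewrite scalerA (_ : _ / o = c / d / o * s); last by ring.
rewrite -[RHS]scalerA -[s *: A X]endo_scale XY endo_scale scalerA; congr (_ *: _).
by rewrite mulrA divfK.
Qed.

Lemma exp_step (F : fieldType) (W : lmodType F) (A : endo W) (g X : W) n :
    (forall n, n.+1%:R != 0 :> F) ->
    (3 * n.+1)%:R *: g = 3 *: A (n`!%:R^-1 *: X) ->
  g = n.+1`!%:R^-1 *: A X.
Proof.
move=> charF; have n1 := charF n; have t0 : 3 != 0 :> F := charF 2.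
rewrite natrM -scalerA => /(scalerI t0)/(congr1 ( *:%R n.+1%:R^-1)).
rewrite scalerA mulVf // scale1r => ->.
by rewrite endo_scale scalerA factS natrM invfM.
Qed.

Section Exponential_tau.
Context (F : fieldType) (N : nat).
Hypothesis charF : forall n, n.+1%:R != 0 :> F.
Local Notation V := ('I_N * nat)%type.
Local Notation U := (pol F V).
Context (alpha : 'I_N -> nat) (s : 'I_N -> F).
Hypothesis alpha_le1 : forall a, (alpha a <= 1)%N.
Context (G : nat -> U).
Hypothesis G_const : forall n, coef mone (G n) = (n == 0%N)%:R.
Hypothesis G_constrained : forall a, constrained a (alpha a) (s a) G.
Local Notation E := (Euler F alpha).
Local Notation WD := (Wlie alpha s).

Lemma Euler_constrained n : E (G n.+1) = 3 *: WD (G n).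
Proof.
rewrite !endoE_sum scaler_sumr; apply: eq_bigr => a _; rewrite endoEZ scalerA.
set c := 3 * _.
have lW := ulocfin_locfin (ulocfin_Wpart F (alpha a) a).
have lcW : locfin [set: nat] (fun k => c *: Wpart F (alpha a) a k).
  move=> p; have [t ut H] := lW p; exists t => // i Ai ni.
  by rewrite endoEZ H // scaler0.
transitivity (lsum [set: nat] (fun k => c *: Wpart F (alpha a) a k) (G n)).
  apply: lsum_eq lcW _ => [|k _]; first exact: locfin_Epart.
  rewrite !endoEZ !endoEM endoED endoEZ endoE1; have [_ /(_ k n)] := G_constrained a.
  rewrite oddfactS natrM; apply: constraint_step; first exact: oddfact_neq0.
  rewrite /deg3 /= natrM; congr (_ * _); rewrite -(scale3E alpha_le1 a) natrM mulfK //.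
  by apply: pnat_neq0 => //; rewrite addn1.
rewrite -[RHS]endoEZ; congr (endo_fun _ _); apply: endoP => p.
rewrite endoEZ (lsum_fsum _ lcW) (lsum_fsum _ lW).
have [t ut H] := lW p; rewrite !(fsum_window ut) //.
  by rewrite scaler_sumr; apply: eq_bigr => i _; rewrite endoEZ.
by move=> i Ai ni; rewrite endoEZ H // scaler0.
Qed.

Lemma Euler_G0 : E (G 0%N) = 0.
Proof.
rewrite endoE_sum big1 // => a _.
rewrite (lsumE (s := [::]) (@locfin_Epart _ _ alpha a)) ?big_nil // => k _ _.
by rewrite endoEZ endoEM (proj1 (G_constrained a)) endoB0 scaler0.
Qed.

Lemma wt3_eq0 m : wt (deg3 alpha) m = 0%N -> m = mone.
Proof.
elim/mon_ind: m => // v m _; rewrite wtM wtU => /eqP; rewrite addn_eq0 => /andP[+ _].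
by rewrite /deg3 muln_eq0 addn1 orbF eqn0Ngt scale3_gt0.
Qed.

(** By induction E G_(n+1) = 3 W_Delta G_n is homogeneous of degree 3 (n + 1). Since E multiplies
    each monomial by its weight, which is nonzero except for 1, and G_(n+1) has no constant term,
    G_(n+1) is homogeneous too. *)
Lemma Euler_G n : E (G n) = (3 * n)%:R *: G n.
Proof.
elim: n => [|n IH]; first by rewrite muln0 scale0r Euler_G0.
have EE : E (E (G n.+1)) = (3 * n.+1)%:R *: E (G n.+1).
  rewrite Euler_constrained; apply: eigen_scale.
  have := eigen_step (eigenE (eigen_Wlie (F := F) alpha_le1 s)) IH.
  by rewrite -[3%:~R]/(3%:R) -natrD addnC -mulnS.
apply/coefP => m.
have [w0|w0] := eqVneq (wt (deg3 alpha) m) 0%N.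
  by rewrite coef_Euler w0 mul0r (wt3_eq0 w0) [RHS]coef_scale G_const mulr0.
have w1 : (wt (deg3 alpha) m)%:R != 0 :> F by apply: pnat_neq0; rewrite // lt0n.
have := congr1 (coef m) EE; rewrite [LHS]coef_Euler [in RHS]coef_scale coef_Euler.
by rewrite [RHS]mulrCA => /(mulfI w1) ->; symmetry; apply: coef_scale.
Qed.

Theorem G_exp n : G n = n`!%:R^-1 *: iter n WD 1.
Proof.
elim: n => [|n IH].
  rewrite fact0 invr1 scale1r; apply/coefP => m; rewrite [RHS]coefU.
  have [<-|mm] := eqVneq mone m; first by rewrite G_const.
  have w1 : (wt (deg3 alpha) m)%:R != 0 :> F.
    apply: pnat_neq0; rewrite // lt0n; apply/eqP => w0.
    by rewrite (wt3_eq0 w0) eqxx in mm.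
  have := congr1 (coef m) Euler_G0; rewrite coef_Euler coef0p => /eqP.
  by rewrite mulf_eq0 (negPf w1) => /eqP ->.
have EG : (3 * n.+1)%:R *: G n.+1 = 3 *: WD (n`!%:R^-1 *: iter n WD 1).
  apply: (etrans (esym (Euler_G n.+1))); apply: (etrans (Euler_constrained n)).
  exact: (congr1 (fun x => 3 *: WD x) IH).
exact: exp_step charF EG.
Qed.

End Exponential_tau.

(** * Power series *)

Lemma leibniz_sum (U : zmodType) (g : nat -> nat -> U) n :
  (\sum_(i < n.+2) g i (n.+1 - i)%N) *+ n.+1 =
  \sum_(i < n.+1) (g i.+1 (n - i)%N *+ i.+1 + g i (n - i).+1 *+ (n - i).+1).
Proof.
rewrite -sumrMnl (eq_bigr (fun i : 'I_n.+2 => g i (n.+1 - i)%N *+ i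
    + g i (n.+1 - i)%N *+ (n.+1 - i))); last first.
  by move=> i _; rewrite -mulrnDr subnKC // -ltnS.
rewrite !big_split /=; congr (_ + _).
  by rewrite big_ord_recl mulr0n add0r; apply: eq_bigr => i _; rewrite subSS.
rewrite big_ord_recr /= subnn mulr0n addr0; apply: eq_bigr => i _.
by rewrite subSn // -ltnS.
Qed.

(** For products g i j = a_i b_j of divided powers, where D acts by a_i -> (i+1) a_(i+1) and
    likewise on b, the Cauchy products obey the same recursion. *)
Lemma leibniz_step (U : zmodType) (D : U -> U) (g : nat -> nat -> U) n :
    {morph D : x y / x + y} -> D 0 = 0 ->
    (forall i j, D (g i j) = g i.+1 j *+ i.+1 + g i j.+1 *+ j.+1) ->
  D (\sum_(i < n.+1) g i (n - i)%N) = (\sum_(i < n.+2) g i (n.+1 - i)%N) *+ n.+1.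
Proof.
move=> DD D0 Dg; rewrite leibniz_sum (big_morph D DD D0).
by apply: eq_bigr => i _; apply: Dg.
Qed.

Section PowerSeries.
Context (F : fieldType).
Hypothesis charF : forall n, n.+1%:R != 0 :> F.
Implicit Types (f g : nat -> F) (p q : {poly F}) (K : nat).

(** Series are replaced by polynomials modulo z^(K+1), in order to compute with the ring structure
    and the derivation of {poly F}. *)
Definition trunc K f : {poly F} := \poly_(i < K.+1) f i.
Definition cong K p q := forall i, (i <= K)%N -> p`_i = q`_i.

Lemma cong_trunc K f i : (i <= K)%N -> (trunc K f)`_i = f i.
Proof. by move=> iK; rewrite coef_poly ltnS iK. Qed.

Lemma congM K p q p' q' : cong K p p' -> cong K q q' -> cong K (p * q) (p' * q').
Proof.
move=> pp qq i iK; rewrite !coefM; apply: eq_bigr => j _.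
have ji := ltn_ord j; rewrite pp 1?qq //; first exact: leq_trans (leq_subr _ _) iK.
by apply: leq_trans iK; rewrite -ltnS.
Qed.

Lemma congX K p q n : cong K p q -> cong K (p ^+ n) (q ^+ n).
Proof. by move=> pq; elim: n => [|n IH] //; rewrite !exprS; apply: congM. Qed.

Lemma cong_trans K p q r : cong K p q -> cong K q r -> cong K p r.
Proof. by move=> pq qr i iK; rewrite pq ?qr. Qed.

Lemma ps_mulE K f g p q : (forall i, (i <= K)%N -> p`_i = f i) ->
    (forall i, (i <= K)%N -> q`_i = g i) ->
  forall i, (i <= K)%N -> (p * q)`_i = ps_mul f g i.
Proof.
move=> pf qg i iK; rewrite coefM; apply: eq_bigr => j _; have ji := ltn_ord j.
rewrite pf 1?qg //; first exact: leq_trans (leq_subr _ _) iK.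
by apply: leq_trans iK; rewrite -ltnS.
Qed.

Lemma ps_expE K f p n : (forall i, (i <= K)%N -> p`_i = f i) ->
  forall i, (i <= K)%N -> (p ^+ n)`_i = ps_exp f n i.
Proof.
move=> pf; elim: n => [|n IH] i iK; first by rewrite expr0 coef1.
by rewrite exprS; apply: ps_mulE iK.
Qed.

Lemma gbinomS (c : F) n : gbinom c n.+1 *+ n.+1 = (c - n%:R) * gbinom c n.
Proof.
rewrite /gbinom big_ord_recr /= -mulr_natr factS natrM.
have n1 := charF n; have fn := fact_neq0 charF n.
by field; rewrite nat1r n1 fn.
Qed.

Lemma gbinom0 (c : F) : gbinom c 0 = 1.
Proof. by rewrite /gbinom big_ord0 fact0 divr1. Qed.

(** Vandermonde's identity for arbitrary exponents. After multiplication by n + 1, the recursion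
    [gbinomS] gives (a - i) + (b - (n - i)) = a + b - n in every term. *)
Lemma gbinomD (a b : F) n :
  \sum_(i < n.+1) gbinom a i * gbinom b (n - i) = gbinom (a + b) n.
Proof.
elim: n => [|n IH]; first by rewrite big_ord1 !gbinom0 mulr1.
apply: (mulIf (charF n)); rewrite !mulr_natr gbinomS -IH mulr_sumr.
rewrite (leibniz_sum (fun i j => gbinom a i * gbinom b j)); apply: eq_bigr => i _.
rewrite -[X in X + _]mulrnAl -[X in _ + X]mulrnAr !gbinomS natrB; last by rewrite -ltnS.
ring.
Qed.

Definition binpoly K (c : F) p : {poly F} := \sum_(n < K.+1) gbinom c n *: p ^+ n.

Lemma coefX_small p n i : p`_0 = 0 -> (i < n)%N -> (p ^+ n)`_i = 0.
Proof.
move=> p0; elim: n i => // n IH i; rewrite ltnS => ni; rewrite exprS coefM big1 //.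
move=> j _; case: (posnP j) => [->|j0]; first by rewrite p0 mul0r.
by rewrite IH ?mulr0 //; have := ltn_ord j; lia.
Qed.

Lemma binpolyM K a b p : p`_0 = 0 ->
  cong K (binpoly K a p * binpoly K b p) (binpoly K (a + b) p).
Proof.
move=> p0 i iK; rewrite /binpoly mulr_suml !coef_sum.
pose g m n : F := ((gbinom a m * gbinom b n) *: p ^+ (m + n))`_i.
transitivity (\sum_(m < K.+1) \sum_(n < K.+1) g m n).
  apply: eq_bigr => m _; rewrite mulr_sumr coef_sum; apply: eq_bigr => n _.
  by rewrite -scalerAl -scalerAr scalerA -exprD.
rewrite triangle_sum => [|m n mn]; last first.
  by rewrite /g coefZ coefX_small ?mulr0 //; lia.
apply: eq_bigr => n _; rewrite coefZ -gbinomD mulr_suml; apply: eq_bigr => m _.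
by rewrite /g coefZ subnKC // -ltnS.
Qed.

Lemma binpoly0 K p : binpoly K 0 p = 1.
Proof.
rewrite /binpoly big_ord_recl gbinom0 expr0 scale1r big1 ?addr0 // => i _.
by rewrite lift0 /gbinom big_ord_recl subrr !mul0r scale0r.
Qed.

Lemma binpoly1 K p : p`_0 = 0 -> cong K (binpoly K 1 p) (1 + p).
Proof.
move=> p0; case: K => [|K] i iK.
  move: iK; rewrite leqn0 => /eqP ->.
  by rewrite /binpoly big_ord1 gbinom0 scale1r expr0 coefD p0 addr0.
rewrite /binpoly 2!big_ord_recl gbinom0 scale1r expr0 addrA big1 ?addr0.
  have := gbinomS 1 0; rewrite mulr1n subr0 gbinom0 mulr1 => ->.
  by rewrite scale1r expr1.
move=> j _; rewrite !lift0 /gbinom 2!big_ord_recl lift0 subrr mul0r mulr0.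
by rewrite mul0r scale0r.
Qed.

Lemma binpolyX K c p n : p`_0 = 0 ->
  cong K (binpoly K c p ^+ n) (binpoly K (n%:R * c) p).
Proof.
move=> p0; elim: n => [|n IH]; first by rewrite mul0r binpoly0 expr0.
rewrite exprS mulrSr mulrDl mul1r addrC.
apply: cong_trans (binpolyM c (n%:R * c) p0 (K := K)).
exact: congM.
Qed.

Section Flow.
Context (chi : nat -> F).

Definition chis : nat -> F := fun e => if odd e && (1 <= e./2)%N then chi e./2 else 0.
Definition flowp K p : {poly F} := - (trunc K chis * p^`()).

Lemma chis_small e : (e < 3)%N -> chis e = 0.
Proof. by case: e => [|[|[|e]]]. Qed.

Lemma flowpD K : {morph flowp K : p q / p + q}.
Proof. by move=> p q; rewrite /flowp derivD mulrDr opprD. Qed.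

Lemma flowp0 K : flowp K 0 = 0.
Proof. by rewrite /flowp deriv0 mulr0 oppr0. Qed.

Lemma flowpZ K c p : flowp K (c *: p) = c *: flowp K p.
Proof. by rewrite /flowp derivZ -scalerAr scalerN. Qed.

Lemma flowpM K p q : flowp K (p * q) = flowp K p * q + p * flowp K q.
Proof. by rewrite /flowp derivM; ring. Qed.

Lemma chi_fieldE K g p : (forall i, (i <= K)%N -> p`_i = g i) ->
  forall i, (i <= K)%N -> (flowp K p)`_i = chi_field chi g i.
Proof.
move=> pg i iK; rewrite /flowp coefN coefM /chi_field /ps_mul; congr (- _).
apply: eq_bigr => j _; have ji := ltn_ord j.
rewrite cong_trunc ?coef_deriv; last by apply: leq_trans iK; rewrite -ltnS.
(* Differentiation uses one coefficient more, but the vector field starts at z^3, so truncation at K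
   loses nothing. *)
case: (ltnP j 3) => j3; first by rewrite -/(chis j) chis_small // !mul0r.
by rewrite pg // /ps_deriv; lia.
Qed.

Lemma iter_chi_fieldE K g p n : (forall i, (i <= K)%N -> p`_i = g i) ->
  forall i, (i <= K)%N -> (iter n (flowp K) p)`_i = iter n (chi_field chi) g i.
Proof.
move=> pg; elim: n => [|n IH] i iK; first exact: pg.
by rewrite !iterS; apply: chi_fieldE.
Qed.

Lemma chi_field_small g m : (forall i, (i < m)%N -> g i = 0) ->
  forall i, (i < m.+2)%N -> chi_field chi g i = 0.
Proof.
move=> g0 i im; rewrite /chi_field /ps_mul big1 ?oppr0 // => j _; have := ltn_ord j.
case: (ltnP j 3) => j3 ji; first by rewrite -/(chis j) chis_small // mul0r.
by rewrite /ps_deriv g0 ?mul0rn ?mulr0 //; lia.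
Qed.

Lemma iter_chi_field_small g m n : (forall i, (i < m)%N -> g i = 0) ->
  forall i, (i < m + 2 * n)%N -> iter n (chi_field chi) g i = 0.
Proof.
move=> g0; elim: n => [|n IH] i; first by rewrite addn0; apply: g0.
by rewrite mulnS addnCA => im; rewrite iterS; apply: chi_field_small im.
Qed.

Definition expflow K p : {poly F} := \sum_(n < K.+1) n`!%:R^-1 *: iter n (flowp K) p.

Lemma iter_flowp_small K p n i : (i < n)%N -> (i <= K)%N -> (iter n (flowp K) p)`_i = 0.
Proof.
move=> ni iK; rewrite (iter_chi_fieldE (g := fun i => p`_i)) //.
by apply: (@iter_chi_field_small _ 0); rewrite //; lia.
Qed.

(** The exponential of a derivation is multiplicative. Hence the flow of z^m is the m-th power of
    the flow of z. *)
Lemma expflowM K p q : cong K (expflow K (p * q)) (expflow K p * expflow K q).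
Proof.
pose a n : {poly F} := n`!%:R^-1 *: iter n (flowp K) p.
pose b n : {poly F} := n`!%:R^-1 *: iter n (flowp K) q.
have step r n : flowp K (n`!%:R^-1 *: iter n (flowp K) r) =
    (n.+1`!%:R^-1 *: iter n.+1 (flowp K) r) *+ n.+1.
  rewrite flowpZ -scaler_nat scalerA -iterS; congr (_ *: _).
  rewrite factS natrM; have n1 := charF n; have fn := fact_neq0 charF n.
  by field; rewrite nat1r n1 fn.
have L n : n`!%:R^-1 *: iter n (flowp K) (p * q) = \sum_(i < n.+1) a i * b (n - i)%N.
  elim: n => [|n IH]; first by rewrite big_ord1 /a /b fact0 invr1 !scale1r.
  apply: (@scalerI _ _ n.+1%:R); first exact: charF.
  rewrite !scaler_nat -step IH.
  apply: (leibniz_step (g := fun i j => a i * b j)); [exact: flowpD|exact: flowp0|].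
  by move=> i j; rewrite flowpM !step mulrnAl mulrnAr.
move=> c cK; rewrite /expflow (eq_bigr (fun n : 'I_K.+1 => \sum_(i < n.+1) a i * b (n - i)%N)
  (fun n _ => L n)) mulr_suml !coef_sum.
transitivity (\sum_(i < K.+1) \sum_(j < K.+1) (a i * b j)`_c); last first.
  by apply: eq_bigr => i _; rewrite mulr_sumr coef_sum.
rewrite (triangle_sum (g := fun i j => (a i * b j)`_c)).
  by apply: eq_bigr => n _; rewrite coef_sum.
move=> i j ij; rewrite coefM big1 // => k _; rewrite /a /b !coefZ.
have kc := ltn_ord k; case: (ltnP k i) => ki.
  by rewrite (iter_flowp_small p ki) ?mulr0 ?mul0r //; lia.
by rewrite (iter_flowp_small q (n := j)) ?mulr0 //; lia.
Qed.

Lemma expflow1 K : expflow K 1 = 1.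
Proof.
rewrite /expflow big_ord_recl /= fact0 invr1 scale1r big1 ?addr0 // => i _.
have z n : iter n.+1 (flowp K) 1 = 0.
  elim: n => [|n IH]; first by rewrite /= /flowp derivC mulr0 oppr0.
  by rewrite iterS IH flowp0.
by rewrite -iterS z scaler0.
Qed.

Lemma expflowX K p n : cong K (expflow K (p ^+ n)) (expflow K p ^+ n).
Proof.
elim: n => [|n IH]; first by rewrite !expr0 expflow1.
rewrite !exprS; apply: cong_trans (expflowM _ _) _.
exact: congM.
Qed.

Lemma coef_expflow K g p i : (forall i, (i <= K)%N -> p`_i = g i) -> (i <= K)%N ->
  (expflow K p)`_i = \sum_(n < K.+1) n`!%:R^-1 * iter n (chi_field chi) g i.
Proof.
move=> pg iK; rewrite /expflow coef_sum; apply: eq_bigr => n _.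
by rewrite coefZ (iter_chi_fieldE _ pg).
Qed.

Lemma chi_flowE K i : (i <= K)%N -> chi_flow chi i = (expflow K 'X)`_i.
Proof.
move=> iK; rewrite (coef_expflow (g := ps_X F)) //; last by move=> j _; rewrite coefX.
rewrite /chi_flow (@fsum_window _ _ _ _ (index_iota 0 K.+1)).
- by rewrite big_mkord; apply: eq_bigl => j; rewrite in_setT.
- exact: iota_uniq.
- move=> n _; rewrite mem_index_iota leq0n /= -leqNgt => Kn.
  by rewrite (@iter_chi_field_small _ 0) ?mulr0 //; lia.
Qed.

Definition zpow (m : nat) : nat -> F := fun d => (d == m)%:R.

(** With m = 2 al + 1, the flow sends z^m to f^m = z^m (1 + u), where u = -m v / z^m: the m-th root
    in the definition of f disappears. *)
Lemma flow_zpow (al : nat) (s : F) (t : nat -> F) K d :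
    (forall d, f_ser al s t d = chi_flow chi d) -> (d <= K)%N ->
  \sum_(j < K.+1) j`!%:R^-1 * iter j (chi_field chi) (zpow (2 * al + 1)) d =
  zpow (2 * al + 1) d - (2 * al + 1)%:R * v_ser al s t d.
Proof.
move=> H dK; set m := (2 * al + 1)%N; have m0 : m%:R != 0 :> F by rewrite /m addn1.
pose u i : F := - (m%:R * v_ser al s t (i + m)%N).
(* v has no terms up to z^m, so the index shift in u is an exact division by z^m and u has no
   constant term. *)
have v0 i : (i <= m)%N -> v_ser al s t i = 0.
  rewrite /v_ser => im; case: ifP => // /andP[oi]; have := odd_double_half i.
  by rewrite oi /m in im *; lia.
pose up := trunc K u; have up0 : up`_0 = 0.
  by rewrite cong_trunc // /u v0 ?mulr0 ?oppr0.
have fE : cong K (expflow K 'X) ('X * binpoly K m%:R^-1 up).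
  move=> i iK; rewrite -chi_flowE // -H /f_ser; symmetry.
  apply: ps_mulE iK => j jK; first by rewrite coefX.
  rewrite /binpoly coef_sum /ps_pow1D.
  transitivity (\sum_(n < K.+1) gbinom m%:R^-1 n * ps_exp u n j).
    apply: eq_bigr => n _; rewrite coefZ (ps_expE (f := u) (K := K)) //.
    by move=> k kK; rewrite cong_trunc.
  rewrite -!(big_mkord xpredT (fun n => gbinom m%:R^-1 n * ps_exp u n j)).
  rewrite (@big_cat_nat _ _ _ j.+1 0 K.+1) //= [X in _ + X]big_nat [X in _ + X]big1 ?addr0 //.
  move=> n /andP[jn _]; rewrite -(ps_expE (p := up) (K := K)) //.
    by rewrite coefX_small ?mulr0.
  by move=> k kK; rewrite cong_trunc.
rewrite -(coef_expflow (p := 'X^m)) //; last by move=> i _; rewrite coefXn.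
rewrite (expflowX _ _ dK) (congX m fE dK) exprMn.
have E : cong K (binpoly K m%:R^-1 up ^+ m) (1 + up).
  apply: cong_trans (binpolyX _ _ up0) _; rewrite divff //; exact: binpoly1.
rewrite (congM (fun i _ => erefl ('X^m)`_i) E dK) mulrDr mulr1 coefD coefXn.
congr (_ + _); rewrite coefXnM; case: (ltnP d m) => dm; first by rewrite v0 ?mulr0 ?oppr0 // ltnW.
by rewrite cong_trunc ?/u ?subnK //; apply: leq_trans (leq_subr _ _) dK.
Qed.

End Flow.

End PowerSeries.

(** * Exponentials of Virasoro operators as translations *)

(* As functions of the time t, exp (t X) G_e and exp (sum_j t^j Y_j / j!) G_e, where the
   second exponential raises the index of G, solve the same differential equation:
   their Taylor coefficients tayl and tayr obey the same recursion. *)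
Section FlowLemma.
Context (F : fieldType) (U : lmodType F) (wle : filtration U).
Hypothesis charF : forall n, n.+1%:R != 0 :> F.
Context (X : endo U) (Y : nat -> endo U) (G : int -> U).
Hypothesis lowX : shift wle (-1) X.
Hypothesis shiftY : forall j, shift wle (- (3 + j%:Z)) (Y j).
Hypothesis commY : forall i j, Y i * Y j = Y j * Y i.
Hypothesis Y0 : Y 0 = 0.
Hypothesis lieXY : forall j, (0 < j)%N -> lie X (Y j) = Y j.+1.
Hypothesis XG : forall e, X (G e) = Y 1 (G (e + 1)).
Hypothesis wleG : forall e, wle (3 * e) (G e).

Definition Ydiv j : endo U := j`!%:R^-1 *: Y j.

(** The coefficient of t^n in (sum_j t^j Y_j / j!)^m. *)
Fixpoint cpow m n : endo U :=
  if m is m'.+1 then \sum_(i < n.+1) Ydiv i * cpow m' (n - i)%N else (n == 0%N)%:R.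

Lemma Ydiv0 : Ydiv 0 = 0. Proof. by rewrite /Ydiv Y0 scaler0. Qed.

Lemma YdivC i j : Ydiv i * Ydiv j = Ydiv j * Ydiv i.
Proof. by rewrite /Ydiv -!endo_scaleAl -!endo_scaleAr commY !scalerA mulrC. Qed.

Lemma Ydiv_cpowC i m n : Ydiv i * cpow m n = cpow m n * Ydiv i.
Proof.
elim: m n => [|m IH] n /=; first by case: (n == 0%N); rewrite ?mulr1 ?mul1r ?mulr0 ?mul0r.
rewrite mulr_sumr mulr_suml; apply: eq_bigr => j _.
by rewrite mulrA YdivC -!mulrA IH.
Qed.

Lemma cpow_small m n : (n < m)%N -> cpow m n = 0.
Proof.
elim: m n => // m IH n; rewrite ltnS => nm; rewrite /= big1 // => i _.
case: (posnP i) => [->|i0]; first by rewrite Ydiv0 mul0r.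
by rewrite IH ?mulr0 //; have := ltn_ord i; lia.
Qed.

Lemma shift_Ydiv j : shift wle (- (3 + j%:Z)) (Ydiv j).
Proof. exact: shiftZ. Qed.

Lemma shift_cpow m n : shift wle (- (3 * m + n)%N%:Z) (cpow m n).
Proof.
elim: m n => [|m IH] n /=.
  case: n => [|n] /=; last by apply: shift0.
  exact: shift1.
apply: shift_sum => i _; have := shiftM (@shift_Ydiv i) (@IH (n - i)%N).
by apply: shiftS; have := ltn_ord i; lia.
Qed.

Lemma sum_nested_if (f : nat -> endo U) i n : (i <= n)%N ->
  \sum_(k < (n - i).+1) f k = \sum_(k < n.+1) if (i + k <= n)%N then f k else 0.
Proof.
move=> le; rewrite -big_mkcond (big_ord_widen n.+1) ?ltnS ?leq_subr //.
by apply: eq_bigl => k; rewrite ltnS leq_subRL.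
Qed.

Lemma sum_nestedC (f : nat -> nat -> endo U) n :
  \sum_(i < n.+1) \sum_(k < (n - i).+1) f i k =
  \sum_(k < n.+1) \sum_(i < (n - k).+1) f i k.
Proof.
under eq_bigr => i _ do rewrite (sum_nested_if _ (leq_ord i)).
rewrite exchange_big; apply: eq_bigr => k _; rewrite (sum_nested_if (f^~ k) (leq_ord k)).
by apply: eq_bigr => i _; rewrite addnC.
Qed.

(** The coefficient of t^n in t (S^(m+1))' = (m + 1) (t S') S^m for S = sum_j t^j Y_j / j!; this
    uses that the Y_j commute. *)
Lemma cpow_deriv m n : cpow m.+1 n *+ n =
  (\sum_(i < n.+1) (Ydiv i * cpow m (n - i)%N) *+ i) *+ m.+1.
Proof.
elim: m n => [|m IH] n.
  rewrite mulr1n /= -sumrMnl; apply: eq_bigr => i _.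
  case: (eqVneq (n - i)%N 0%N) => [ni|_]; last by rewrite mulr0 !mul0rn.
  by have -> : nat_of_ord i = n by have := ltn_ord i; lia.
rewrite mulrSr; set S := \sum_(i < n.+1) _.
have -> : S *+ m.+1 = \sum_(i < n.+1) (Ydiv i * cpow m.+1 (n - i)%N) *+ (n - i)%N.
  under [RHS]eq_bigr do rewrite -mulrnAr IH mulrnAr mulr_sumr.
  rewrite sumrMnl; congr (_ *+ _).
  rewrite (sum_nestedC (fun i k => Ydiv i * ((Ydiv k * cpow m (n - i - k)%N) *+ k))).
  apply: eq_bigr => k _; rewrite [cpow _ _]/= mulr_sumr -sumrMnl.
  apply: eq_bigr => i _; rewrite mulrnAr; congr (_ *+ _).
  by rewrite !mulrA (YdivC i k) subnAC.
rewrite /= -sumrMnl -big_split; apply: eq_bigr => i _ /=.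
by rewrite -mulrnDr; congr (_ *+ _); have := ltn_ord i; lia.
Qed.

Definition tayl n e : U := n`!%:R^-1 *: (X ^+ n) (G e).
Definition tayr n e : U := \sum_(m < n.+1) m`!%:R^-1 *: cpow m n (G (e + m%:Z)).

Lemma factS_scale (W : lmodType F) n (p : W) :
  (n.+1`!%:R^-1 *: p) *+ n.+1 = n`!%:R^-1 *: p.
Proof.
have n1 := charF n; have fn := fact_neq0 charF n.
rewrite -scaler_nat scalerA factS natrM; congr (_ *: _).
by field; rewrite nat1r n1 fn.
Qed.

Lemma taylS n e : tayl n.+1 e *+ n.+1 =
  \sum_(i < n.+1) (Ydiv i.+1 *+ i.+1) (tayl (n - i)%N (e + 1)).
Proof.
rewrite /tayl factS_scale exprSr endoEM XG.
have -> : n`!%:R^-1 *: (X ^+ n) (Y 1 (G (e + 1))) =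
    (n`!%:R^-1 *: (X ^+ n * Y 1)) (G (e + 1)) by rewrite endoEZ endoEM.
(* X^n has to pass Y 1. By [X, Y i] = Y i.+1, left multiplication by X acts on the products A i B j
   of divided powers by the Leibniz rule. *)
pose A i : endo U := i`!%:R^-1 *: Y i.+1; pose B j : endo U := j`!%:R^-1 *: X ^+ j.
have yS i : Ydiv i.+1 *+ i.+1 = A i by rewrite /Ydiv /A factS_scale.
suff -> : n`!%:R^-1 *: (X ^+ n * Y 1) = \sum_(i < n.+1) A i * B (n - i)%N.
  by rewrite endoE_sum; apply: eq_bigr => i _; rewrite yS endoEM [B _ _]endoEZ.
have XA i : X * A i = A i.+1 *+ i.+1 + A i * X.
  by rewrite /A factS_scale -endo_scaleAr -endo_scaleAl -scalerDr -(@lieXY i.+1) // /lie subrK.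
have XB j : X * B j = B j.+1 *+ j.+1 by rewrite /B factS_scale -endo_scaleAr exprS.
elim: n => [|n IH].
  by rewrite big_ord1 /A /B fact0 invr1 !scale1r expr0 mul1r mulr1.
apply: (@scalerI _ _ n.+1%:R); first exact: charF.
rewrite !scaler_nat factS_scale exprS -mulrA endo_scaleAr IH.
apply: (leibniz_step (D := fun p => X * p) (g := fun i j => A i * B j)) => [p q||i j].
- exact: mulrDr.
- exact: mulr0.
by rewrite mulrA XA mulrDl -mulrnAl -mulrA XB mulrnAr.
Qed.

(** The derivative splits one factor Y off each power. The remaining power has one factor less, so
    the same value of G is reached from e + 1. *)
Lemma tayrS n e : tayr n.+1 e *+ n.+1 =
  \sum_(i < n.+1) (Ydiv i.+1 *+ i.+1) (tayr (n - i)%N (e + 1)).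
Proof.
rewrite /tayr big_ord_recl [cpow _ _]/= endoE0 scaler0 add0r -sumrMnl.
have H (m : nat) : ((m.+1)`!%:R^-1 *: cpow m.+1 n.+1 (G (e + m.+1%:Z))) *+ n.+1 =
    \sum_(i < n.+1) (Ydiv i.+1 *+ i.+1) (m`!%:R^-1 *: cpow m (n - i)%N (G (e + 1 + m%:Z))).
  have -> : e + m.+1%:Z = e + 1 + m%:Z by lia.
  rewrite scalerMnr -endoEMn cpow_deriv endoEMn -scalerMnr factS_scale.
  rewrite big_ord_recl mulr0n add0r endoE_sum scaler_sumr.
  by apply: eq_bigr => i _; rewrite subSS endo_scale -endoEM mulrnAl.
rewrite (eq_bigr _ (fun (m : 'I_n.+1) _ => H m)) exchange_big; apply: eq_bigr => i _ /=.
rewrite endo_sum [RHS](big_ord_widen n.+1 (fun m => (Ydiv i.+1 *+ i.+1)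
  (m`!%:R^-1 *: cpow m (n - i)%N (G (e + 1 + m%:Z))))) ?ltnS ?leq_subr //.
rewrite [RHS]big_mkcond; apply: eq_bigr => m _; case: ifP => // /negbT; rewrite -leqNgt => ltm.
by rewrite cpow_small // endoE0 scaler0 endoB0.
Qed.

Lemma tayl_tayr n e : tayl n e = tayr n e.
Proof.
elim/ltn_ind: n e => -[|n] IH e.
  by rewrite /tayl /tayr big_ord1 fact0 invr1 !scale1r expr0 addr0 !endoE1.
apply: (@scalerI _ _ n.+1%:R); first exact: charF.
rewrite !scaler_nat taylS tayrS; apply: eq_bigr => i _; rewrite IH //.
by have := ltn_ord i; lia.
Qed.

(** Each factor Y_j lowers the degree by 3 + j. The 3 compensates the growth of the degree of G with
    its index, and the j bound the power of t independently of m. *)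
Lemma cpow_eq0 (D : int) m n p : wle (3 * m%:Z + D) p -> D < n%:Z -> cpow m n p = 0.
Proof. by move=> wp Dn; apply: (shift_eq0 (@shift_cpow m n) wp); lia. Qed.

Section Translation.
Context (T : endo U).
Hypothesis TE : forall (K : nat) q, wle K%:Z q -> T q = \sum_(j < K.+1) Ydiv j q.

Lemma TX (K m : nat) p : wle K%:Z p -> (T ^+ m) p = \sum_(n < K.+1) cpow m n p.
Proof.
elim: m p => [|m IH] p wp.
  by rewrite expr0 big_ord_recl /= big1 ?addr0 // => i _; apply: endoE0.
rewrite exprSr endoEM (TE wp) endo_sum.
have wy (j : nat) : wle (K%:Z - (3 + j%:Z)) (Ydiv j p) by apply: shift_Ydiv.
rewrite (eq_bigr (fun j : 'I_K.+1 => \sum_(n < K.+1) cpow m n (Ydiv j p))); last first.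
  by move=> j _; apply: IH; apply: wleS (wy j); lia.
rewrite (triangle_sum (g := fun j n => cpow m n (Ydiv j p))) => [|j n jn].
  by apply: eq_bigr => n _; rewrite endoE_sum; apply: eq_bigr => j _; rewrite Ydiv_cpowC endoEM.
apply: (cpow_eq0 (D := K%:Z - (3 + j%:Z) - 3 * m%:Z)); last by lia.
by rewrite addrC subrK; apply: wy.
Qed.

Lemma flow e : \sum_(n \in [set: nat]) n`!%:R^-1 *: iter n T (G (e + n%:Z)) =
  eexp X (G e).
Proof.
have TG (K n : nat) : 3 * e < K.+1%:Z ->
    (T ^+ n) (G (e + n%:Z)) = \sum_(j < K.+1) cpow n j (G (e + n%:Z)).
  move=> eK; have wG : wle (K + 3 * n)%N%:Z (G (e + n%:Z)) by apply: wleS (wleG _); lia.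
  rewrite (TX n wG) [RHS](big_ord_widen (K + 3 * n).+1
    (fun j => cpow n j (G (e + n%:Z)))); last by lia.
  rewrite [RHS]big_mkcond; apply: eq_bigr => j _; case: ifP => // /negbT.
  rewrite -leqNgt => Kj; apply: (cpow_eq0 (D := 3 * e)); last by lia.
  by apply: wleS (wleG _); lia.
(* Both summations can stop at K: powers of t beyond K vanish by degree, and an m-th power with m >
   K starts only at t^m, as Y 0 = 0. *)
pose K := `|(3 * e)%R|%N; have eK : 3 * e < K.+1%:Z by rewrite /K; lia.
rewrite (fsum_window (s := index_iota 0 K.+1)) ?iota_uniq //; last first.
  move=> n _; rewrite mem_index_iota leq0n /= -leqNgt => Kn.
  rewrite -endoEX (TG K) // big1 ?scaler0 // => j _; rewrite cpow_small ?endoE0 //.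
  exact: leq_trans (ltn_ord j) Kn.
rewrite big_mkord (eexpE lowX (wleG e) eK).
transitivity (\sum_(n < K.+1) tayr n e); last first.
  by apply: eq_bigr => n _; rewrite -tayl_tayr.
rewrite (eq_big predT (fun n : 'I_K.+1 =>
  \sum_(j < K.+1) n`!%:R^-1 *: cpow n j (G (e + n%:Z)))); last 2 first.
- by move=> n; rewrite in_setT.
- by move=> n _; rewrite -endoEX (TG K) // scaler_sumr.
rewrite exchange_big; apply: eq_bigr => j _; rewrite /tayr.
rewrite [RHS](big_ord_widen K.+1 (fun m => m`!%:R^-1 *: cpow m j (G (e + m%:Z)))) //.
rewrite [RHS]big_mkcond; apply: eq_bigr => n _; case: ifP => // /negbT.
by rewrite -leqNgt => jn; rewrite cpow_small ?endoE0 ?scaler0.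
Qed.

End Translation.

End FlowLemma.

Lemma sum_odd (W : zmodType) (f : nat -> W) n : (forall k, f (2 * k)%N = 0) ->
  \sum_(i < 2 * n) f i = \sum_(k < n) f (2 * k + 1)%N.
Proof.
move=> f0; elim: n => [|n IH]; first by rewrite !big_ord0.
by rewrite mulnSr addn2 !big_ord_recr /= IH f0 addr0 addn1.
Qed.

Lemma chis_odd (F : fieldType) (chi : nat -> F) k : (0 < k)%N ->
  chis chi (2 * k + 1) = chi k.
Proof. by rewrite /chis => k0; rewrite addn1 mul2n /= odd_double /= uphalf_double k0. Qed.

Lemma chis_even (F : fieldType) (chi : nat -> F) k : chis chi (2 * k) = 0.
Proof. by rewrite /chis mul2n odd_double. Qed.

Lemma chi_field_odd (F : fieldType) (chi u : nat -> F) m :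
  chi_field chi u (2 * m + 1) =
  - \sum_(k < m.+1) chis chi (2 * k + 1) *
      (u (2 * (m - k) + 1)%N *+ (2 * (m - k) + 1)).
Proof.
congr (- _); rewrite /ps_mul -(big_mkord xpredT (fun i => chis chi i *
  ps_deriv u (2 * m + 1 - i)%N)) big_mkord.
have -> : (2 * m + 1).+1 = (2 * m.+1)%N by lia.
rewrite (sum_odd (f := fun i => chis chi i * ps_deriv u (2 * m + 1 - i)%N)) => [|k].
  apply: eq_bigr => k _; congr (_ * _); rewrite /ps_deriv.
  by congr (u _ *+ _); have := ltn_ord k; lia.
by rewrite chis_even mul0r.
Qed.

Section WittModule.
Context (F : fieldType) (U : lmodType F) (wle : filtration U).
Context (L : nat -> endo U).
Hypothesis shiftL : forall k, shift wle (- k%:Z) (L k).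

Definition Lsum (chi : nat -> F) : endo U :=
  lsum [set k : nat | (1 <= k)%N] (fun k => chi k *: L k).

Lemma L_eq0 (K : int) k q : wle K q -> K < k%:Z -> L k q = 0.
Proof. by move=> wq Kk; apply: (shift_eq0 (@shiftL k) wq); lia. Qed.

Lemma locfin_Lsum chi : locfin [set k : nat | (1 <= k)%N] (fun k => chi k *: L k).
Proof.
by apply: (ulocfin_locfin (wle := wle)); apply: ulocfin_shift => k _; apply: shiftZ.
Qed.

Lemma LsumE (K : nat) chi q : wle K%:Z q ->
  Lsum chi q = \sum_(k < K.+1) chis chi (2 * k + 1) *: L k q.
Proof.
move=> wq; rewrite /Lsum (lsumE (s := index_iota 0 K.+1) (@locfin_Lsum chi)) ?iota_uniq //.
  rewrite big_mkord [LHS]big_mkcond; apply: eq_bigr => k _; rewrite endoEZ.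
  rewrite (_ : _ \in _ = (0 < k)%N); last by apply/idP/idP => [/set_mem|/mem_set].
  by case: posnP => [->|k0]; [rewrite chis_small // scale0r | rewrite chis_odd].
move=> k _; rewrite mem_index_iota leq0n /= -leqNgt endoEZ => Kk.
by rewrite (L_eq0 wq) ?scaler0 //; lia.
Qed.

Context (D : nat -> endo U) (c : nat).
Hypothesis c_gt0 : (0 < c)%N.
Hypothesis shiftD : forall k, shift wle (- (c * (2 * k + 1))%N%:Z) (D k).
Hypothesis lieLD : forall k n, (0 < k)%N ->
  lie (L k) (D n) = - (2 * n + 1)%:R *: D (n + k)%N.

Definition Dsum (u : nat -> F) : endo U :=
  lsum [set: nat] (fun k => u (2 * k + 1)%N *: D k).

Lemma D_eq0 (K : int) k q : wle K q -> K < (2 * k + 1)%N%:Z -> D k q = 0.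
Proof. by move=> wq Kk; apply: (shift_eq0 (@shiftD k) wq); nia. Qed.

Lemma locfin_Dsum u : locfin [set: nat] (fun k => u (2 * k + 1)%N *: D k).
Proof.
apply: (ulocfin_locfin (wle := wle)); apply: ulocfin_shift => k _.
by apply: shiftZ; apply: shiftS (@shiftD k); nia.
Qed.

Lemma DsumE (K : nat) u q : wle K%:Z q ->
  Dsum u q = \sum_(k < K.+1) u (2 * k + 1)%N *: D k q.
Proof.
move=> wq; rewrite /Dsum (lsumE (s := index_iota 0 K.+1) (@locfin_Dsum u)) ?iota_uniq //.
  rewrite big_mkord; apply: eq_big => [k|k _]; last exact: endoEZ.
  by rewrite in_setT.
move=> k _; rewrite mem_index_iota leq0n /= -leqNgt endoEZ => Kk.
by rewrite (D_eq0 wq) ?scaler0 //; lia.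
Qed.

(** Under D n <-> z^(2n+1), [lieLD] says that the commutator with L k is -z^(2k+1) d/dz, so the
    commutator with the whole sum is the vector field acting on the coefficient series. *)
Lemma lie_Lsum_Dsum chi u : lie (Lsum chi) (Dsum u) = Dsum (chi_field chi u).
Proof.
apply: endoP => p; have [K wp] := wle_exists wle p.
rewrite lieE (DsumE u wp) endo_sum (DsumE _ wp).
have wL (k : nat) : wle K%:Z (L k p) by apply: wleS (@shiftL k _ _ wp); lia.
have wD (k : nat) : wle K%:Z (D k p) by apply: wleS (@shiftD k _ _ wp); lia.
rewrite (eq_bigr (fun n : 'I_K.+1 => \sum_(k < K.+1)
    (u (2 * n + 1)%N * chis chi (2 * k + 1)) *: L k (D n p))); last first.
  move=> n _; rewrite endo_scale (LsumE _ (wD n)) scaler_sumr.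
  by apply: eq_bigr => k _; rewrite scalerA.
rewrite (LsumE _ wp) endo_sum.
rewrite [X in _ - X](eq_bigr (fun k : 'I_K.+1 => \sum_(n < K.+1)
    (u (2 * n + 1)%N * chis chi (2 * k + 1)) *: D n (L k p))); last first.
  move=> k _; rewrite endo_scale (DsumE _ (wL k)) scaler_sumr.
  by apply: eq_bigr => n _; rewrite scalerA mulrC.
rewrite exchange_big -sumrB.
pose g k n := - (chis chi (2 * k + 1) * (u (2 * n + 1)%N *+ (2 * n + 1))) *: D (k + n)%N p.
transitivity (\sum_(k < K.+1) \sum_(n < K.+1) g k n).
  apply: eq_bigr => k _; rewrite -sumrB; apply: eq_bigr => n _.
  rewrite -scalerBr -lieE /g; case: (posnP k) => [->|k0].
    by rewrite chis_small // mulr0 mul0r oppr0 !scale0r.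
  rewrite lieLD // endoEZ scalerA [(n + k)%N]addnC; congr (_ *: _).
  by rewrite -mulr_natr; ring.
rewrite triangle_sum => [|k n kn]; last by rewrite /g (D_eq0 wp) ?scaler0 //; lia.
apply: eq_bigr => m _; rewrite chi_field_odd /g -sumrN scaler_suml.
by apply: eq_bigr => k _; rewrite subnKC // -ltnS.
Qed.

End WittModule.

Section TranslationFlow.
Context (F : fieldType) (U : lmodType F) (wle : filtration U).
Hypothesis charF : forall n, n.+1%:R != 0 :> F.
Context (N : nat) (alpha c : 'I_N -> nat) (L D : 'I_N -> nat -> endo U).
Hypothesis cE : forall a, (c a * (2 * alpha a + 1) = 3)%N.
Hypothesis shiftL : forall a k, shift wle (- k%:Z) (L a k).
Hypothesis shiftD : forall a k, shift wle (- (c a * (2 * k + 1))%N%:Z) (D a k).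
Hypothesis lieLD : forall a k n, (0 < k)%N ->
  lie (L a k) (D a n) = - (2 * n + 1)%:R *: D a (n + k)%N.
Hypothesis commLD : forall a b k n, b != a -> GRing.comm (L a k) (D b n).
Hypothesis commDD : forall a b k n, GRing.comm (D a k) (D b n).
Context (s : 'I_N -> F) (t chi : 'I_N -> nat -> F).
Hypothesis flowE : forall a d, f_ser (alpha a) (s a) (t a) d = chi_flow (chi a) d.
Context (G : int -> U).
Hypothesis wleG : forall e, wle (3 * e) (G e).
Hypothesis LG : forall a k e, (0 < k)%N ->
  L a k (G e) = (s a)^-1 *: D a (k + alpha a)%N (G (e + 1)).

Definition Ltot : endo U := \sum_(a < N) Lsum (L a) (chi a).
Definition Ttot : endo U :=
  \sum_(a < N) (s a)^-1 *: Dsum (D a) (v_ser (alpha a) (s a) (t a)).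

Let c_gt0 a : (0 < c a)%N.
Proof. by have := cE a; lia. Qed.

Let field_iter a j : nat -> F :=
  iter j (chi_field (chi a)) (zpow F (2 * alpha a + 1)).
(** The field maps z^m, m = 2 alpha_a + 1, to -m sum_k chi_k z^(2k+m). This factor makes Y_1 equal
    to the sum of s^-1 chi_k D_(k+alpha), which is what the constraints give. *)
Let kappa a : F := - ((s a)^-1 / (2 * alpha a + 1)%:R).

(** The value at 0 drops the term z^m of the flow of z^m, with m = 2 alpha_a + 1: what remains is
    f^m - z^m = -m v, the translation. *)
Definition Yflow j : endo U :=
  if j is 0 then 0 else \sum_(a < N) kappa a *: Dsum (D a) (field_iter a j).

Let locD a u := @locfin_Dsum _ _ _ _ _ (c_gt0 a) (@shiftD a) u.
Let locL a := @locfin_Lsum _ _ _ _ (@shiftL a) (chi a).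

Lemma shift_Ltot : shift wle (-1) Ltot.
Proof.
apply: shift_sum => a _; apply: shift_lsum; last exact: locL.
by move=> k /= k0; apply: shiftZ; apply: shiftS (@shiftL a k); lia.
Qed.

Lemma comm_Dsum a b u v : GRing.comm (Dsum (D a) u) (Dsum (D b) v).
Proof.
apply: comm_lsum; first exact: locD.
move=> k _; apply/commZ/commr_sym/comm_lsum; first exact: locD.
by move=> n _; apply/commZ/commDD.
Qed.

Lemma comm_Lsum_Dsum a b u : b != a -> GRing.comm (Lsum (L a) (chi a)) (Dsum (D b) u).
Proof.
move=> ba; apply: comm_lsum; first exact: locD.
move=> k _; apply/commZ/commr_sym/comm_lsum; first exact: locL.
by move=> n _; apply/commZ/commr_sym/commLD.
Qed.

Lemma comm_Yflow i j : Yflow i * Yflow j = Yflow j * Yflow i.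
Proof.
case: i j => [|i] [|j]; rewrite ?mulr0 ?mul0r //.
apply: comm_sum => b _; apply/commZ/commr_sym/comm_sum => a _.
exact/commZ/comm_Dsum.
Qed.

(** The j-th iterate of the field on z^(2 alpha + 1) starts at z^(2 alpha + 1 + 2j), and c a * (2
    alpha a + 1) = 3, so every D in Y_j lowers the degree by at least 3 + 2j. *)
Lemma shift_Yflow j : shift wle (- (3 + j%:Z)) (Yflow j).
Proof.
case: j => [|j]; first exact: shift0.
apply: shift_sum => a _; apply/shiftZ/shift_lsum; last exact: locD.
move=> k _; case: (ltnP (2 * k + 1) (2 * alpha a + 1 + 2 * j.+1)) => kj.
  rewrite /field_iter (@iter_chi_field_small _ _ _ (2 * alpha a + 1)) ?scale0r //.
    exact: shift0.
  by move=> i ilt; rewrite /zpow ltn_eqF.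
by apply: shiftZ; apply: shiftS (@shiftD a k); have := cE a; have := c_gt0 a; nia.
Qed.

Lemma lie_Ltot_Dsum a u : lie Ltot (Dsum (D a) u) = Dsum (D a) (chi_field (chi a) u).
Proof.
rewrite lie_suml (bigD1 a) //= (lie_Lsum_Dsum (@shiftL a) (c_gt0 a)) //; last exact: lieLD.
rewrite big1 ?addr0 // => b ba.
by apply/eqP; rewrite subr_eq0; apply/eqP/comm_Lsum_Dsum; rewrite eq_sym.
Qed.

Lemma lie_Yflow j : (0 < j)%N -> lie Ltot (Yflow j) = Yflow j.+1.
Proof.
case: j => // j _; rewrite lieC lie_suml -sumrN; apply: eq_bigr => a _.
by rewrite -lieC lieZr lie_Ltot_Dsum.
Qed.

Lemma chi_field_zpow a m :
  chi_field (chi a) (zpow F (2 * alpha a + 1)) (2 * m + 1) =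
  - ((2 * alpha a + 1)%:R * (if (alpha a < m)%N then chi a (m - alpha a)%N else 0)).
Proof.
rewrite chi_field_odd; congr (- _); case: ltnP => am.
  have lt : (m - alpha a < m.+1)%N by lia.
  rewrite (bigD1 (Ordinal lt)) //= big1 ?addr0 => [|k /eqP/val_eqP /= km].
    rewrite chis_odd ?subn_gt0 // subKn ?(ltnW am) // /zpow eqxx -mulr_natr mul1r.
    exact: mulrC.
  by rewrite /zpow (_ : (_ == _) = false) ?mul0rn ?mulr0 //; have := ltn_ord k; lia.
rewrite mulr0 big1 // => k _; case: (posnP k) => [->|k0].
  by rewrite chis_small // mul0r.
by rewrite /zpow (_ : (_ == _) = false) ?mul0rn ?mulr0 //; have := ltn_ord k; lia.
Qed.

Lemma Ltot_G e : Ltot (G e) = Yflow 1 (G (e + 1)).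
Proof.
rewrite !endoE_sum; apply: eq_bigr => a _; rewrite endoEZ.
pose K := `|(3 * (e + 1))%R|%N.
have wG : wle K%:Z (G e) by apply: wleS (wleG e); rewrite /K; lia.
have wG1 : wle (alpha a + K)%N%:Z (G (e + 1)) by apply: wleS (wleG (e + 1)); rewrite /K; lia.
rewrite (LsumE (@shiftL a) (chi a) wG) (DsumE (c_gt0 a) (@shiftD a) _ wG1).
(* The first alpha a terms on the right vanish; the others correspond to L k through the shift of
   the index by alpha a. *)
rewrite -addnS [in RHS]big_split_ord /= [X in _ *: (X + _)]big1 ?add0r => [|m _]; last first.
  rewrite chi_field_zpow (_ : (_ < _)%N = false) ?mulr0 ?oppr0 ?scale0r //.
  by have := ltn_ord m; lia.
rewrite scaler_sumr; apply: eq_bigr => k _; rewrite scalerA chi_field_zpow.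
case: (posnP k) => [->|k0].
  by rewrite chis_small // addn0 ltnn mulr0 oppr0 mulr0 !scale0r.
rewrite LG // scalerA chis_odd // [(k + _)%N]addnC; congr (_ *: _).
have -> : (alpha a < alpha a + k)%N by lia.
rewrite addKn /kappa; have := charF (2 * alpha a); rewrite -addn1.
by move: (2 * alpha a + 1)%:R (s a)^-1 => w s1 w0; field.
Qed.

Lemma TtotE (K : nat) q : wle K%:Z q -> Ttot q = \sum_(j < K.+1) Ydiv Yflow j q.
Proof.
move=> wq; rewrite big_ord_recl [Ydiv _ _]scaler0 endoE0 add0r endoE_sum.
rewrite (eq_bigr (fun j : 'I_K => \sum_(a < N) \sum_(k < K.+1)
    (j.+1`!%:R^-1 * kappa a * field_iter a j.+1 (2 * k + 1)) *: D a k q)); last first.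
  move=> j _; rewrite endoEZ endoE_sum scaler_sumr; apply: eq_bigr => a _.
  rewrite endoEZ (DsumE (c_gt0 a) (@shiftD a) _ wq) scalerA scaler_sumr.
  by apply: eq_bigr => k _; rewrite scalerA.
rewrite exchange_big; apply: eq_bigr => a _.
rewrite endoEZ (DsumE (c_gt0 a) (@shiftD a) _ wq) scaler_sumr exchange_big.
apply: eq_bigr => k _; rewrite scalerA -scaler_suml.
(* [flow_zpow] is available for coefficients up to K; beyond that, D a k kills q. *)
case: (ltnP K (2 * k + 1)) => kK.
  by rewrite (D_eq0 (c_gt0 a) (@shiftD a) wq) ?scaler0.
congr (_ *: _).
have := flow_zpow charF (flowE a) kK; rewrite big_ord_recl fact0 invr1 mul1r.
move/(addrI _); rewrite /kappa.
set S := \sum_(j < K) _ => ES.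
have -> : \sum_(j < K) j.+1`!%:R^-1 * - ((s a)^-1 / (2 * alpha a + 1)%:R) *
    field_iter a j.+1 (2 * k + 1) = - ((s a)^-1 / (2 * alpha a + 1)%:R) * S.
  by rewrite mulr_sumr; apply: eq_bigr => j _; rewrite mulrCA mulrA.
rewrite ES; have := charF (2 * alpha a); rewrite -addn1.
by move: (2 * alpha a + 1)%:R (s a)^-1 => w s1 w0; field.
Qed.

Theorem translation_flow e :
  \sum_(n \in [set: nat]) n`!%:R^-1 *: iter n Ttot (G (e + n%:Z)) = eexp Ltot (G e).
Proof.
apply: (flow charF shift_Ltot shift_Yflow comm_Yflow) => //.
- exact: lie_Yflow.
- exact: Ltot_G.
- exact: TtotE.
Qed.

End TranslationFlow.

(** * Commutators of Virasoro operators and derivations *)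

Lemma lie_middle (F : fieldType) (W : lmodType F) (A B C X : endo W) (c d : F) :
  A = 0 -> lie C X = 0 -> lie (c *: A + B + d *: C) X = lie B X.
Proof. by move=> -> CX; rewrite scaler0 add0r lieDl lieZl CX scaler0 addr0. Qed.

Lemma endo_middle0 (F : fieldType) (W : lmodType F) (A B C : endo W) (c d : F) p :
  A = 0 -> B p = 0 -> C p = 0 -> (c *: A + B + d *: C) p = 0.
Proof. by move=> -> Bp Cp; rewrite scaler0 add0r endoED endoEZ Bp Cp scaler0 addr0. Qed.

Lemma lie_mid (F : fieldType) (W : lmodType F) (A B X Y : endo W) (c : F) (b : bool) :
  lie A X = - b%:R *: (1 : endo W) -> lie B X = 0 -> (b -> B = Y) ->
  lie (c *: (A * B)) X = b%:R *: (- c *: Y).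
Proof.
move=> AX BX BY; rewrite lieZl lieMl BX mulr0 add0r AX -endo_scaleAl mul1r.
case: b BY AX => [->|_] // _; rewrite ?oppr0 ?scale0r ?scaler0 //.
by rewrite scale1r !scaleNr scale1r scalerN.
Qed.

Section CurrentAlgebra.
Context (F : fieldType) (N : nat).
Hypothesis charF : forall n, n.+1%:R != 0 :> F.
Local Notation V := ('I_N * nat)%type.
Local Notation U := (pol F V).

Lemma Vir_VV0 (a : 'I_N) (k : nat) :
  \sum_(ij <- square `|k%:Z|.+2 |
        ij \in [set ij : nat * nat | ij.1%:Z + ij.2%:Z = - k%:Z - 1])
    (oddfact ij.1 * oddfact ij.2)%:R^-1 *: (Var F (a, ij.1) * Var F (a, ij.2)) = 0 :> endo U.
Proof. by apply: big1 => ij; rewrite inE /= => H; exfalso; lia. Qed.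

Lemma lie_Vir_Der (a : 'I_N) (k n : nat) :
  lie (Vir F (pair a) k%:Z) (Der F (a, n)) =
  - ((oddfact (n + k).+1)%:R / (oddfact n)%:R) *: Der F (a, (n + k)%N) :> endo U.
Proof.
transitivity (lie (lsum [set: nat] (Virmid F (pair a) k%:Z)) (Der F (a, n))).
  apply: lie_middle; first exact: Vir_VV0.
  rewrite lie_suml; apply: big1 => ij _; rewrite lieZl lieMl !lieDD mulr0 mul0r addr0.
  exact: scaler0.
apply: (lie_lsum_single (i0 := n)) (ulocfin_locfin (ulocfin_Virmid F (deg_ge a) k%:Z)) _ => i.
have DE : Derz F (pair a) (i%:Z + k%:Z) = Der F (a, (i + k)%N) by [].
rewrite /Virmid DE; apply: etrans (lie_mid (b := i == n) (Y := Der F (a, (n + k)%N)) _ _ _ _) _.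
- by rewrite lieVD xpair_eqE eqxx eq_sym.
- exact: lieDD.
- by move/eqP=> ->.
case: eqVneq => [->|_]; last by rewrite !scale0r.
by congr (_ *: (- (_ / _) *: _)); congr (oddfact _)%:R; lia.
Qed.

(** This is J^a_(k+1). In this normalization no double factorials remain in its commutators with the
    L_k. *)
Definition Dnorm (a : 'I_N) (k : nat) : endo U := (oddfact k.+1)%:R *: Der F (a, k).

Lemma lie_Vir_Dnorm (a : 'I_N) (k n : nat) :
  lie (Vir F (pair a) k%:Z) (Dnorm a n) = - (2 * n + 1)%:R *: Dnorm a (n + k).
Proof.
rewrite /Dnorm lieZr lie_Vir_Der; apply: etrans (scalerA _ _ _) _.
apply: etrans _ (esym (scalerA _ _ _)); congr (_ *: _).
have := oddfact_neq0 charF n; rewrite oddfactS natrM.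
by move: (oddfact n)%:R => o o0; field.
Qed.

Lemma comm_Vir_Dnorm (a b : 'I_N) (k n : nat) : b != a ->
  GRing.comm (Vir F (pair a) k%:Z) (Dnorm b n).
Proof.
move=> ba; apply/commZ/commr_sym/comm_Vir => j; last exact: DerC.
by rewrite /GRing.comm Der_Var xpair_eqE (negPf ba) scale0r add0r.
Qed.

Lemma comm_Dnorm (a b : 'I_N) (k n : nat) : GRing.comm (Dnorm a k) (Dnorm b n).
Proof. by apply/commZ/commr_sym/commZ/DerC. Qed.

(** For k >= 0 the terms T_i T_j are absent, so every term of L_k begins by differentiating. *)
Lemma Vir_free (a : 'I_N) (k : nat) (p : U) :
  (forall j, Der F (a, j) p = 0) -> Vir F (pair a) k%:Z p = 0.
Proof.
move=> Dp; apply: endo_middle0; first exact: Vir_VV0.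
  rewrite (lsumE (s := [::]) (ulocfin_locfin (ulocfin_Virmid F (deg_ge a) k%:Z))) //.
    exact: big_nil.
  move=> i _ _; have DE : Derz F (pair a) (i%:Z + k%:Z) = Der F (a, (i + k)%N) by [].
  by rewrite endoEZ endoEM DE Dp endoB0 scaler0.
rewrite endoE_sum; apply: big1 => ij _.
by rewrite endoEZ endoEM Dp endoB0 scaler0.
Qed.

End CurrentAlgebra.

(** * The ancestor potential *)

Lemma natr_charF_inj (F : fieldType) (charF : forall n, n.+1%:R != 0 :> F) :
  injective (fun n : nat => n%:R : F).
Proof.
move=> m n; wlog mn : m n / (m <= n)%N => [H|] E.
  by case/orP: (leq_total m n) => ?; [apply: H|symmetry; apply: H].
case: (ltngtP m n) mn => // mn _; have /negP[] : (n - m)%:R != 0 :> F.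
  by apply: pnat_neq0; rewrite ?subn_gt0.
by rewrite natrB ?(ltnW mn) // E subrr.
Qed.

(** v omits the indices k <= al. Among the positive ones this is only k = 1 for al = 1, where t
    vanishes: here the condition on Delta T_1^a enters. For s = 0 both sides vanish with x. *)
Lemma v_ser_cancel (F : fieldType) (W : lmodType F) (al k : nat) (s : F) (t : nat -> F)
    (x : W) : (forall n, n.+1%:R != 0 :> F) ->
    (al <= 1)%N -> (al = 1%N -> t 1%N = 0) -> (s = 0 -> x = 0) ->
  s^-1 *: (v_ser al s t (2 * k + 1) *: ((oddfact k.+1)%:R *: x)) =
  (if (0 < k)%N then t k else 0) *: x.
Proof.
move=> charF al1 t1 sx; have [s0|s0] := eqVneq s 0; first by rewrite sx // !scaler0.
rewrite !scalerA; congr (_ *: _).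
rewrite /v_ser addn1 mul2n /= odd_double /= uphalf_double.
have o0 := oddfact_neq0 charF k.+1; case: (leqP (1 + al) k) => k1.
  have -> : (0 < k)%N by lia.
  by field; rewrite s0 o0.
rewrite mulr0 mul0r; case: posnP => // k0.
have k1' : k = 1%N by lia.
by rewrite k1' t1 //; lia.
Qed.

Lemma constrained_solve (F : fieldType) (W : lmodType F) (s h : F) (x g z : W) :
  s != 0 -> h = 0 -> s *: (x + h *: g) = z -> x = s^-1 *: z.
Proof. by move=> s0 -> <-; rewrite scale0r addr0 scalerA mulVf ?scale1r. Qed.

Lemma endo_cancel2 (F : fieldType) (W : lmodType F) (A A' B B' : endo W) x :
  A' * A = 1 -> B' * B = 1 -> B' (A' (A (B x))) = x.
Proof. by move=> AA BB; rewrite -(endoEM A') AA endoE1 -endoEM BB endoE1. Qed.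

Section Ancestor.
Context (F : fieldType) (N : nat).
Hypothesis charF : forall n, n.+1%:R != 0 :> F.
Local Notation V := ('I_N * nat)%type.
Local Notation U := (pol F V).
Context (alpha : 'I_N -> nat) (s : 'I_N -> F) (dT : nat -> 'I_N -> F).
Context (chi : 'I_N -> nat -> F) (r : nat -> 'M[F]_N).
Hypothesis alpha_le1 : forall a, (alpha a <= 1)%N.
Hypothesis dT1 : forall a, alpha a = 1%N -> dT 1%N a = 0.
Hypothesis flowE : forall a d,
  f_ser (alpha a) (s a) (fun k => dT k a) d = chi_flow (chi a) d.
Context (G : nat -> U).
Hypothesis G_const : forall n, coef mone (G n) = (n == 0%N)%:R.
Hypothesis G_constrained : forall a, constrained a (alpha a) (s a) G.
Local Notation wle := (wfil F (deg3 alpha)).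

(** For s a = 0 the left side of the constraint vanishes, hence all derivatives along T^a do. *)
Lemma G_free a j n : s a = 0 -> Der F (a, j) (G n) = 0.
Proof.
move=> s0; case: n => [|n]; first exact: (proj1 (G_constrained a)).
have [_ /(_ j n)] := G_constrained a; rewrite s0 scale0r => /esym.
by move/eqP; rewrite scaler_eq0 (negPf (oddfact_neq0 charF _)) => /eqP.
Qed.

Lemma laurent_free a j e : s a = 0 -> Der F (a, j) (laurent G e) = 0.
Proof. by case: e => n s0 /=; [apply: G_free|apply: endoB0]. Qed.

Lemma wle_laurent e : wle (3 * e) (laurent G e).
Proof.
case: e => n; last exact: wle0.
apply/wsub_coef => m cm.
have := congr1 (coef m) (Euler_G charF alpha_le1 G_const G_constrained n).
rewrite [LHS]coef_Euler [RHS]coef_scale => /mulIf -/(_ (introN eqP cm)).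
by move/(natr_charF_inj charF) => ->; lia.
Qed.

Lemma Vir_laurent a k e : (0 < k)%N ->
  Vir F (pair a) k%:Z (laurent G e) =
  (s a)^-1 *: Dnorm F a (k + alpha a) (laurent G (e + 1)).
Proof.
(* For s a = 0 the right side is 0 because the inverse of 0 is 0, and the left side because G does
   not involve T^a. *)
move=> k0; have [s0|s0] := eqVneq (s a) 0.
  rewrite s0 invr0; apply: etrans (esym (scale0r _)).
  by apply: Vir_free => j; apply: laurent_free.
case: e => [n|[|n]].
- apply: (constrained_solve (h := (k + alpha a == alpha a)%N%:R / 8)) s0 _ _.
    by rewrite -[X in _ == X]add0n eqn_add2r (gtn_eqF k0) mul0r.
  have [_ /(_ (k + alpha a)%N n)] := G_constrained a.
  have -> : (k + alpha a)%N%:Z - (alpha a)%:Z = k%:Z by lia.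
  have -> : Posz n + 1 = Posz n.+1 by lia.
  by move=> H; apply: (etrans H); apply/esym/endoEZ.
(* At e = -1 the right side is a derivative of G 0, which is zero. *)
- by rewrite /= endoB0 /Dnorm endoEZ (proj1 (G_constrained a)) !scaler0.
- by rewrite /= !endoB0 scaler0.
Qed.

Definition Tend : endo U := Ttot alpha (@Dnorm F N) s (fun a k => dT k a).

Lemma shift_Dnorm (a : 'I_N) k :
  shift wle (- (scale3 alpha a * (2 * k + 1))%N%:Z) (Dnorm F a k).
Proof. exact/shiftZ/shift_Der. Qed.

Lemma shift3_Vir (a : 'I_N) (k : nat) : shift wle (- k%:Z) (Vir F (pair a) k%:Z).
Proof.
have := @shift_Vir F V (pair a) (deg3 alpha) (deg3_ge alpha a) (scale3 alpha a) k%:Z.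
move=> /(_ (fun _ => erefl)); apply: shiftS.
by have := scale3_gt0 alpha a; nia.
Qed.

(** [Tend] has no translation in a family with s a = 0, whereas [T_gen] may have one. They are
    compared only on polynomials not involving such families. *)
Let free (q : U) := forall (a : 'I_N) (k : nat), s a = 0 -> Der F (a, k) q = 0.

Lemma comm_Der_Tend a k : GRing.comm (Der F (a, k)) Tend.
Proof.
apply: comm_sum => b _; apply/commZ/comm_lsum.
  exact: (locfin_Dsum (scale3_gt0 alpha b) (@shift_Dnorm b)).
by move=> n _; apply/commZ/commZ/DerC.
Qed.

Lemma T_genE q : free q -> T_gen dT q = Tend q.
Proof.
move=> fq; have [K wq] := wle_exists wle q.
rewrite /T_gen (fsum_window (s := index_iota 0 K.+1)) ?iota_uniq //; last first.
  move=> k _; rewrite mem_index_iota leq0n /= -leqNgt => Kk; apply: big1 => a _.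
  rewrite DerE (shift_eq0 (@shift_Der F V (deg3 alpha) (a, k)) wq) ?scaler0 //.
  have := deg3_ge alpha a k; move: (deg3 alpha (a, k)) => d; lia.
rewrite big_mkord big_mkcond.
transitivity (\sum_(k < K.+1) \sum_(a < N)
    (if (0 < k)%N then dT k a else 0) *: Der F (a, k : nat) q).
  apply: eq_bigr => k _.
  rewrite (_ : _ \in _ = (0 < k)%N); last by apply/idP/idP => [/set_mem|/mem_set].
  case: ifP => k0; first by apply: eq_bigr => a _; rewrite DerE.
  by symmetry; apply: big1 => a _; apply: scale0r.
rewrite exchange_big endoE_sum; apply: eq_bigr => a _; rewrite endoEZ.
rewrite (DsumE (scale3_gt0 alpha a) (@shift_Dnorm a) _ wq) scaler_sumr.
apply: eq_bigr => k _; symmetry; rewrite /Dnorm endoEZ.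
apply: (v_ser_cancel k charF (alpha_le1 a)); first exact: dT1.
exact: fq.
Qed.

Lemma iter_T_gen n q : free q -> iter n (T_gen dT) q = iter n Tend q.
Proof.
move=> fq; have fn m : free (iter m Tend q).
  elim: m => //= m IH a k s0.
  by rewrite -endoEM (comm_Der_Tend a k) endoEM IH // endoB0.
by elim: n => //= n ->; apply: T_genE.
Qed.

Lemma T_hatE e : T_hat dT (laurent G) e = eexp (Vtot chi) (laurent G e).
Proof.
transitivity (\sum_(n \in [set: nat]) n`!%:R^-1 *: iter n Tend (laurent G (e + n%:Z))).
  apply: eq_fsbigr => n _; congr (_ *: _); apply: iter_T_gen => a k s0.
  exact: laurent_free.
apply: (translation_flow charF (scale3E alpha_le1) (@shift3_Vir) (@shift_Dnorm) _ _ _ flowE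
  wle_laurent).
- by move=> a k n _; apply: lie_Vir_Dnorm.
- by move=> a b k n; apply: comm_Vir_Dnorm.
- by move=> a b k n; apply: comm_Dnorm.
- exact: Vir_laurent.
Qed.

Lemma eexp_one (D : endo U) : shift (wfil F (@deg N)) (-1) D -> eexp D 1 = 1.
Proof.
move=> lD; apply: (eexp_eq lD); apply: (shift_eq0 lD (d := 0)) => //.
exact: wsub1.
Qed.

Lemma iter_Wend n : iter n (Wend alpha s r chi) 1 =
  eexp (Rlie r) (eexp (Vtot chi) (iter n (Wlie alpha s) 1)).
Proof.
have lR := @lowers_Rlie F N r; have lV := @lowers_Vtot F N chi.
elim: n => [|n IH]; first by rewrite /= (eexp_one lV) (eexp_one lR).
rewrite !iterS IH /Wend !endoEM; congr (eexp _ (eexp _ (Wlie _ _ _))).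
exact: (endo_cancel2 _ (eexpNK charF lR) (eexpNK charF lV)).
Qed.

Lemma ancestorE e : R_hat r (T_hat dT (laurent G) e) = exp_hbar (W_hat alpha s r chi) e.
Proof.
rewrite T_hatE; apply: (etrans (R_hatE r _)).
case: e => n; last by rewrite /= !endoB0.
rewrite /= (G_exp charF alpha_le1 G_const G_constrained n) !endo_scale -iter_Wend.
by congr (_ *: _); elim: n => //= n ->; rewrite W_hatE.
Qed.

End Ancestor.

Theorem theorem1 (Re : realType) (N : nat) (hN : (1 <= N)%N)
    (alpha : 'I_N -> 'I_2)
    (r : nat -> 'M[Re[i]]_N)
    (dT : nat -> 'I_N -> Re[i])
    (hdT : forall a : 'I_N, alpha a = 1%N :> nat -> dT 1%N a = 0)
    (Delta sqD : 'I_N -> Re[i])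
    (hsqD : forall a : 'I_N, sqD a ^+ 2 = Delta a)
    (tau : 'I_2 -> nat -> pol Re[i] nat)
    (htau : forall al : 'I_2, is_tau al (tau al))
    (chi : 'I_N -> nat -> Re[i])
    (hchi : forall (a : 'I_N) (d : nat),
        f_ser (alpha a) (sqD a) (fun k => dT k a) d = chi_flow (chi a) d) :
  let Z := ancestor sqD r dT (fun a => tau (alpha a)) in
  let W := W_hat (fun a => alpha a) sqD r chi in
  (exists (A : 'I_N -> 'I_N -> 'I_N -> int -> int -> int -> Re[i])
          (B : 'I_N -> int -> Re[i]),
     forall p : pol Re[i] ('I_N * nat)%type, W p = cubic_form A B p) /\
  (forall e : int, Z e = exp_hbar W e).
Proof.
have charF n : n.+1%:R != 0 :> Re[i] by rewrite pnatr_eq0.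
have al1 a : (alpha a <= 1)%N by rewrite -ltnS.
move=> Z W; split; first exact: W_hat_cubic.
have [Gc Gp] := Delta_hat_props charF sqD (fun a => htau (alpha a)).
move=> e; exact: (ancestorE charF r al1 hdT hchi Gc Gp).
Qed.
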